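(* Let $d\ge1$ be an integer, $m=1$ and $\alpha=2_*=4/d$. Then the mapping $c\mapsto m_c$ is monotone decreasing (i.e. $m_a\le m_b$ whenever $0<b<a<2\pi\widehat M(Q)$) and lower semicontinuous on $(0,2\pi\widehat M(Q))$.
   Context: $\mathbb{T}=\mathbb{R}/2\pi\mathbb{Z}$; points of $\mathbb{R}^d\times\mathbb{T}$ are written $(x,y)$. $\|\cdot\|_p$ is the norm of $L^p(\mathbb{R}^d\times\mathbb{T})$; functions are complex-valued. $Q\in H^1(\mathbb{R}^d)$ is the unique radial and positive solution of $-\Delta_xQ+Q=Q^{1+\frac4d}$ on $\mathbb{R}^d$, and $\widehat M(v)=\|v\|_{L^2(\mathbb{R}^d)}^2$. For $u\in H^1(\mathbb{R}^d\times\mathbb{T})$ put $$M(u)=\|u\|_2^2,\quad E(u)=\tfrac12\|\nabla_{x,y}u\|_2^2-\tfrac1{\alpha+2}\|u\|_{\alpha+2}^{\alpha+2},\quad K(u)=\|\nabla_x u\|_2^2-\tfrac{\alpha d}{2(\alpha+2)}\|u\|_{\alpha+2}^{\alpha+2},$$ and define $m_c=\inf\{E(u):u\in H^1(\mathbb{R}^d\times\mathbb{T}),\,M(u)=c,\,K(u)=0\}$. *)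

(* Defs.v *)
From HB Require Import structures.
From mathcomp Require Import all_boot all_order all_algebra.
From mathcomp Require Import all_classical all_reals all_analysis.
From mathcomp Require Import complex.

Set Implicit Arguments.
Unset Strict Implicit.
Unset Printing Implicit Defensive.
Import Order.TTheory GRing.Theory Num.Theory.
Import numFieldNormedType.Exports.

Local Open Scope classical_set_scope.
Local Open Scope ring_scope.

(* Row vectors carry the sigma-algebra generated by the coordinates, exactly
   as the library does for tuples; over the reals it is the Borel one. *)
Section rV_measurable.
Context {dsp : measure_display} {T : measurableType dsp} (n : nat).

Let coords : 'I_n -> 'rV[T]_n -> T := fun i x => x ord0 i.

Let rV_set0 : g_sigma_preimage coords set0.
Proof. exact: sigma_algebra0. Qed.

Let rV_setC A : g_sigma_preimage coords A -> g_sigma_preimage coords (~` A).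
Proof. exact: sigma_algebraC. Qed.

Let rV_bigcup (F : _^nat) : (forall i, g_sigma_preimage coords (F i)) ->
  g_sigma_preimage coords (\bigcup_i (F i)).
Proof. exact: sigma_algebra_bigcup. Qed.

HB.instance Definition _ := @isMeasurable.Build (measure_tuple_display dsp)
  'rV[T]_n (g_sigma_preimage coords) rV_set0 rV_setC rV_bigcup.

Lemma measurable_coord (i : 'I_n) :
  measurable_fun [set: 'rV[T]_n] (fun x : 'rV[T]_n => x ord0 i).
Proof.
move=> _ Y mY; rewrite setTI; apply: sub_sigma_algebra => /=.
rewrite -bigcup_seq/=; exists i => /=; first by rewrite mem_index_enum.
by exists Y => //; rewrite setTI.
Qed.

Lemma measurable_fun_coordP d1 (T1 : measurableType d1) (f : T1 -> 'rV[T]_n) :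
  (forall i, measurable_fun [set: T1] (fun x => f x ord0 i)) ->
  measurable_fun [set: T1] f.
Proof.
move=> mf.
suff prefS : g_sigma_preimage (fun i => coords i \o f) `<=` measurable.
  move=> _ A mA; rewrite setTI; apply: prefS.
  rewrite g_sigma_preimage_comp; exists A => //.
  by rewrite setTI.
apply: smallest_sub; first exact: sigma_algebra_measurable.
rewrite -bigcup_seq /=; apply: bigcup_sub => i _.
by move=> A [B mB <-]; exact: mf.
Qed.

End rV_measurable.

Section sigma_finite_bundle.
Context dsp (T : measurableType dsp) (R : realType).
Variables (mu : {measure set T -> \bar R}) (sf : sigma_finite setT mu).

Let nu : set T -> \bar R := mu.
Let nu0 : nu set0 = 0%E. Proof. exact: measure0. Qed.
Let nu_ge0 A : (0 <= nu A)%E. Proof. exact: measure_ge0. Qed.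
Let nu_sigma_additive : semi_sigma_additive nu.
Proof. exact: measure_semi_sigma_additive. Qed.
HB.instance Definition _ := isMeasure.Build _ _ _ nu
  nu0 nu_ge0 nu_sigma_additive.
HB.instance Definition _ := @Measure_isSigmaFinite.Build _ _ _ nu sf.

Lemma sigma_finite_bundle :
  exists nu : {sigma_finite_measure set T -> \bar R},
    mu = nu :> (set T -> \bar R).
Proof. by exists nu. Qed.

End sigma_finite_bundle.

Lemma sigma_finite_prod d1 d2 (T1 : measurableType d1)
    (T2 : measurableType d2) (R : realType)
    (m1 : {sigma_finite_measure set T1 -> \bar R})
    (m2 : {sigma_finite_measure set T2 -> \bar R}) :
  sigma_finite setT (m1 \x m2)%E.
Proof.
have /sigma_finiteP[F [TF ndF Foo]] := sigma_finiteT m1.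
have /sigma_finiteP[G [TG ndG Goo]] := sigma_finiteT m2.
exists (fun n => F n `*` G n).
  rewrite -setXTT TF TG predeqE => -[x y]; split.
    move=> [/= [n _ Fnx] [k _ Gky]]; exists (maxn n k) => //; split.
    - by move: x Fnx; exact/subsetPset/ndF/leq_maxl.
    - by move: y Gky; exact/subsetPset/ndG/leq_maxr.
  by move=> [n _ []/= ? ?]; split; exists n.
move=> k; have [? ?] := Foo k; have [? ?] := Goo k.
split; first exact: measurableX.
by rewrite product_measure1E// lte_mul_pinfty// ge0_fin_numE.
Qed.

Lemma pushforward_sigma_finite d1 d2 (T1 : measurableType d1)
    (T2 : measurableType d2) (R : realType)
    (m : {measure set T1 -> \bar R}) (f : T1 -> T2) (g : T2 -> T1) :
  sigma_finite setT m ->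
  measurable_fun setT f -> measurable_fun setT g -> cancel f g ->
  exists mu : {sigma_finite_measure set T2 -> \bar R}, pushforward m f = mu.
Proof.
move=> [F UF mF] mf mg fK.
pose mu := measure_function_pushforward__canonical__measure_function_Measure m mf.
have sf : sigma_finite setT mu.
  exists (fun i => g @^-1` F i); first by rewrite -preimage_bigcup -UF preimage_setT.
  move=> i; split; first by rewrite -[X in measurable X]setTI; exact: mg (mF i).1.
  rewrite /mu /= /pushforward -comp_preimage.
  have -> : g \o f = id by apply/funext => x /=; rewrite fK.
  exact: (mF i).2.
by have [nu munu] := sigma_finite_bundle sf; exists nu; rewrite -munu.
Qed.

Section lebesgue_rV.
Context {R : realType}.

Definition cons_rV n (p : measurableTypeR R * 'rV[R]_n) : 'rV[R]_n.+1 :=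
  row_mx (const_mx p.1 : 'rV_1) p.2.

Fixpoint lebesgue_rV n : set 'rV[R]_n -> \bar R :=
  match n with
  | 0 => \d_(0 : 'rV[R]_0)
  | n'.+1 => pushforward (lebesgue_measure \x @lebesgue_rV n')%E (@cons_rV n')
  end.

Let lebesgue_rV_bundle n :
  exists mu : {sigma_finite_measure set 'rV[R]_n -> \bar R}, @lebesgue_rV n = mu.
Proof.
elim: n => [|n [mu IH]] /=; first by exists (\d_(0 : 'rV[R]_0)).
rewrite IH.
pose uncons (v : 'rV[R]_n.+1) : measurableTypeR R * 'rV[R]_n :=
  (v ord0 ord0, rsubmx (v : 'rV_(1 + n))).
apply: (pushforward_sigma_finite (f := @cons_rV n) (g := uncons)
  (sigma_finite_prod (@lebesgue_measure R) mu)).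
- apply: (@measurable_fun_coordP _ R n.+1) => i; rewrite /cons_rV.
  under eq_fun do rewrite mxE.
  case: splitP => j _.
    under eq_fun do rewrite mxE; exact: measurable_fst.
  exact: (measurableT_comp (f := fun v : 'rV[R]_n => v ord0 j)
    (@measurable_coord _ R n j) measurable_snd).
- apply/measurable_fun_pairP; split => /=.
    exact: (@measurable_coord _ R n.+1 ord0).
  apply: (@measurable_fun_coordP _ R n) => i; rewrite /comp /=.
  under eq_fun do rewrite mxE; exact: measurable_coord.
- case=> x v; rewrite /uncons /cons_rV /=; congr pair; last by rewrite row_mxKr.
  by rewrite mxE; case: splitP => // j _; rewrite mxE.
Qed.

Let lebesgue_rV0 n : lebesgue_rV (set0 : set 'rV[R]_n) = 0%E.
Proof. by have [mu ->] := lebesgue_rV_bundle n; rewrite measure0. Qed.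

Let lebesgue_rV_ge0 n (A : set 'rV[R]_n) : (0 <= lebesgue_rV A)%E.
Proof. by have [mu ->] := lebesgue_rV_bundle n; exact: measure_ge0. Qed.

Let lebesgue_rV_sigma_additive n : semi_sigma_additive (@lebesgue_rV n).
Proof.
have [mu ->] := lebesgue_rV_bundle n; exact: measure_semi_sigma_additive.
Qed.

HB.instance Definition _ n := isMeasure.Build _ _ _ (@lebesgue_rV n)
  (lebesgue_rV0 n) (@lebesgue_rV_ge0 n) (@lebesgue_rV_sigma_additive n).

Let lebesgue_rV_sigma_finite n : sigma_finite setT (@lebesgue_rV n).
Proof. have [mu ->] := lebesgue_rV_bundle n; exact: sigma_finiteT. Qed.

HB.instance Definition _ n := @Measure_isSigmaFinite.Build _ _ _
  (@lebesgue_rV n) (@lebesgue_rV_sigma_finite n).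

End lebesgue_rV.
Arguments lebesgue_rV {R} n.

(* The torus R/2piZ is the fundamental domain [0, 2pi[: functions on it are
   2pi-periodic functions on R, integrated against this measure. *)
Section torus_measure.
Context {R : realType}.

Definition torus_measure : set R -> \bar R :=
  fun A => lebesgue_measure (A `&` `[0, 2 * pi[).

Let mD : measurable (`[0, 2 * pi[%classic : set (measurableTypeR R)).
Proof. exact: measurable_itv. Qed.

Let torus_measure0 : torus_measure set0 = 0%E.
Proof. by rewrite /torus_measure set0I measure0. Qed.

Let torus_measure_ge0 A : (0 <= torus_measure A)%E.
Proof. exact: measure_ge0. Qed.

Let torus_measure_sigma_additive : semi_sigma_additive torus_measure.
Proof.
exact: (@measure_semi_sigma_additive _ _ _ (mrestr (@lebesgue_measure R) mD)).
Qed.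

HB.instance Definition _ := isMeasure.Build _ _ _ torus_measure
  torus_measure0 torus_measure_ge0 torus_measure_sigma_additive.

Let torus_measure_sigma_finite : sigma_finite setT torus_measure.
Proof.
exists (fun=> setT); first by rewrite bigcup_const.
move=> _; split=> //; rewrite /torus_measure setTI lebesgue_measure_itv/=.
by case: ifP => _; rewrite ?ltry// lte0y.
Qed.

HB.instance Definition _ := @Measure_isSigmaFinite.Build _ _ _ torus_measure
  torus_measure_sigma_finite.

End torus_measure.

(* Iterated directional derivatives exist and are continuous: on a
   finite-dimensional space this is the usual C^k. *)
Fixpoint Ck {R : realType} {V : normedModType R} (k : nat) (f : V -> R) : Prop :=
  if k is k'.+1 then
    continuous f /\
    forall v, (forall x, derivable f x v) /\ Ck k' (fun x => 'D_v f x)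
  else continuous f.

Definition smooth {R : realType} {V : normedModType R} (f : V -> R) : Prop :=
  forall k, Ck k f.

(* [test] is the class of (real) test functions and [D i] the i-th classical
   partial derivative acting on them. *)
Section weak_derivatives.
Context {R : realType} {dsp} {V : measurableType dsp}.
Variables (mu : {measure set V -> \bar R}) (test : set (V -> R)).
Variables (I : Type) (D : I -> (V -> R) -> V -> R).

Definition is_weak_deriv (i : I) (f g : V -> R) : Prop :=
  forall phi, test phi ->
    \int[mu]_x (f x * D i phi x) = - \int[mu]_x (g x * phi x).

Definition H1_real (f : V -> R) : Prop :=
  f \in Lfun mu 2%:E /\
  forall i, exists2 g, g \in Lfun mu 2%:E & is_weak_deriv i f g.

(* meaningful when H1_real f; then unique up to mu-negligible sets *)
Definition weak_deriv (i : I) (f : V -> R) : V -> R :=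
  xget (cst 0) [set g | g \in Lfun mu 2%:E /\ is_weak_deriv i f g].

Definition H1_complex (u : V -> R[i]) : Prop :=
  H1_real (fun x => complex.Re (u x)) /\ H1_real (fun x => complex.Im (u x)).

Definition weak_derivC (i : I) (u : V -> R[i]) : V -> R[i] := fun x =>
  (weak_deriv i (fun x => complex.Re (u x)) x +i*
   weak_deriv i (fun x => complex.Im (u x)) x)%C.

End weak_derivatives.

Definition modulus {R : realType} {V : Type} (u : V -> R[i]) : V -> R :=
  fun x => ComplexField.Normc.normc (u x).

(* weak H^1 solutions of - Delta Q + Q = Q^(1+4/d) *)
Section ground_state.
Context {R : realType} (d : nat).
Implicit Types (Q phi : 'rV[R]_d -> R).

Definition partial_x (i : 'I_d) phi : 'rV[R]_d -> R :=
  fun x => 'D_(delta_mx ord0 i) phi x.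

Definition test_x : set ('rV[R]_d -> R) := [set phi | smooth phi /\
  exists2 K : set 'rV[R]_d, compact K & forall x, ~ K x -> phi x = 0].

(* the library norm on row vectors is the sup norm *)
Definition euclid (x : 'rV[R]_d) : R := Num.sqrt (\sum_(i < d) x ord0 i ^+ 2).

Definition weak_dx (i : 'I_d) Q : 'rV[R]_d -> R :=
  weak_deriv (lebesgue_rV d) test_x partial_x i Q.

Definition ground_state Q : Prop :=
  [/\ H1_real (lebesgue_rV d) test_x partial_x Q,
      forall x y, euclid x = euclid y -> Q x = Q y,
      forall x, 0 < Q x &
      forall phi, test_x phi ->
        \int[lebesgue_rV d]_x
          (\sum_(i < d) weak_dx i Q x * partial_x i phi x + Q x * phi x) =
        \int[lebesgue_rV d]_x (Q x `^ (1 + 4 / d%:R) * phi x)].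

Definition Mhat Q : \bar R := ('N[lebesgue_rV d]_2%:E[EFin \o Q] ^+ 2)%E.

End ground_state.

Section waveguide.
Context {R : realType} (d : nat).
Local Notation RdT := ('rV[R]_d * R)%type.
Implicit Types u : RdT -> R[i].

Definition periodic_y {S : Type} (f : RdT -> S) : Prop :=
  forall x y, f (x, y + 2 * pi) = f (x, y).

Definition leb_xy : {measure set RdT -> \bar R} :=
  (lebesgue_rV d \x torus_measure)%E.

Definition test_xy : set (RdT -> R) := [set phi | [/\ smooth phi,
  periodic_y phi & exists2 K : set 'rV[R]_d, compact K &
    forall x y, ~ K x -> phi (x, y) = 0]].

(* Some i is the direction x_i, None the direction y *)
Definition direction (j : option 'I_d) : RdT :=
  if j is Some i then (delta_mx ord0 i, 0) else (0, 1).

Definition partial_xy (j : option 'I_d) (phi : RdT -> R) : RdT -> R :=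
  fun z => 'D_(direction j) phi z.

Definition H1_xy u : Prop :=
  periodic_y u /\ H1_complex leb_xy test_xy partial_xy u.

Definition weak_dxy (j : option 'I_d) u : RdT -> R[i] :=
  weak_derivC leb_xy test_xy partial_xy j u.

Definition norm_xy (p : R) (f : RdT -> R) : \bar R :=
  'N[leb_xy]_p%:E[EFin \o f]%E.

Definition grad_x u : RdT -> R := fun z =>
  Num.sqrt (\sum_(i < d) modulus (weak_dxy (Some i) u) z ^+ 2).

Definition grad_xy u : RdT -> R := fun z =>
  Num.sqrt (\sum_(j : option 'I_d) modulus (weak_dxy j u) z ^+ 2).

Local Open Scope ereal_scope.

(* M, E and K; extended-real valued, so that no integrability of
   |u|^(alpha+2) is presupposed (u with norm +oo fails K(u) = 0). *)
Definition mass u : \bar R := norm_xy 2 (modulus u) ^+ 2.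

Definition energy (alpha : R) u : \bar R :=
  2^-1%:E * norm_xy 2 (grad_xy u) ^+ 2
  - (alpha + 2)^-1%:E * norm_xy (alpha + 2) (modulus u) `^ (alpha + 2).

Definition virial (alpha : R) u : \bar R :=
  norm_xy 2 (grad_x u) ^+ 2
  - (alpha * d%:R / (2 * (alpha + 2)))%:E
    * norm_xy (alpha + 2) (modulus u) `^ (alpha + 2).

(* +oo if no u satisfies the constraints *)
Definition m_c (alpha c : R) : \bar R :=
  ereal_inf [set energy alpha u |
    u in [set u | [/\ H1_xy u, mass u = c%:E & virial alpha u = 0%:E]]].

End waveguide.

(* Main.v *)
Require Import Defs.
From HB Require Import structures.
From mathcomp Require Import all_boot all_order all_algebra.
From mathcomp Require Import all_classical all_reals all_analysis.
From mathcomp Require Import measurable_realfun complex ring lra.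

Set Implicit Arguments.
Unset Strict Implicit.
Unset Printing Implicit Defensive.
Import Order.TTheory GRing.Theory Num.Theory.
Import numFieldNormedType.Exports.

Local Open Scope classical_set_scope.
Local Open Scope ring_scope.

(** Write A for the squared norm of the x-gradient, B for that of the y-derivative,
    N for the integral of |u|^(alpha+2). At alpha = 4/d the energy is
    E = K/2 + B/2 with K = A - kappa N, so m_c is half the infimum of the transverse
    kinetic energy B over the states of mass c and virial K = 0 ([m_c_le],
    [m_c_lt]). States with K <= 0 compete as well ([m_c_le_virial]): multiplying by
    a plane wave e^{i xi x_1} moves K up to 0 without changing the mass, N or B.

    Monotonicity ([m_c_nonincreasing]). A state u of mass b and virial 0 has to be
    enlarged to mass a > b with little increase of B. Amplify it slightly, by s > 1;
    because alpha > 0 this makes K negative. The missing mass is supplied by a very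
    flat field W independent of y, which does not contribute to B. For s u + W and
    s u - W the mixed terms of A cancel in the sum, and N gains by convexity, so one
    of the two has K <= 0.

    Lower semicontinuity ([m_c_right_lsc]). Left of c monotonicity is enough. Given
    a state u of mass c' slightly above c with virial 0 and B bounded, the mass must
    be lowered; scaling down makes K positive, by an amount small compared with N.
    To compensate, K is first lowered by a fixed fraction of N ([virial_modulation]):
    multiply u by trigonometric factors of y that turn |u|^2 into
    (1 + sg (cos (y - t) - m)) |u|^2, where m is the mean of cos (y - t) under
    |u|^2. This preserves the mass. Averaged over four values of t it preserves A,
    while strict convexity of the power raises N in proportion to
    |(cos y, sin y) - (m1, m2)|^2, the vector (m1, m2) being the mean position on
    the circle. That distance is bounded below because a state with bounded B
    cannot concentrate in y ([nonconcentration]): on almost every slice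
    {x} x T the function is recovered from its weak y-derivative by a bounded kernel
    ([slice_representation]), hence |u(x, y)|^2 is at most a constant times the
    integral over the slice of |u|^2 + |d_y u|^2, and the mass in a thin band is
    small.

    Weak derivatives are handled through the fundamental lemma of the calculus of
    variations ([fundamental_lemma_L1]), proved by a pi-lambda argument on boxes with
    test functions built from exp(-1/z). *)

(** * Iterated directional derivatives *)

Section Ck_calculus.
Context {R : realType} {V : normedModType R}.
Implicit Types (f g : V -> R) (F : nat -> R -> R).

Lemma Ck_continuous k f : Ck k f -> continuous f.
Proof. by case: k => [//|k []]. Qed.

Lemma CkS_derivable k f v x : Ck k.+1 f -> derivable f x v.
Proof. by move=> [_ /(_ v)[]]. Qed.

Lemma CkS_derive k f v : Ck k.+1 f -> Ck k (fun x => 'D_v f x).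
Proof. by move=> [_ /(_ v)[]]. Qed.

Lemma Ck_of_derive k f : continuous f ->
  (forall v, exists2 f', Ck k f' & forall x, is_derive x v f (f' x)) ->
  Ck k.+1 f.
Proof.
move=> cf df; split=> // v; have [f' kf' f'E] := df v; split.
  by move=> x; have [] := f'E x.
suff -> : (fun x => 'D_v f x) = f' by [].
by apply/funext => x; rewrite (@derive_val _ _ _ _ _ _ _ (f'E x)).
Qed.

Lemma CkW k f : Ck k.+1 f -> Ck k f.
Proof.
elim: k f => [|k IH] f; first exact: Ck_continuous.
move=> [cf df]; split=> // v; have [dfv /IH kf] := df v; split => //.
Qed.

Lemma Ck_cst k (c : R) : Ck k (fun _ : V => c).
Proof.
have cc : continuous (fun _ : V => c) by move=> x; exact: cvg_cst.
elim: k c cc => [//|k IH] c cc; apply: Ck_of_derive => // v.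
exists (fun=> 0); last by move=> x; exact: is_derive_cst.
by apply: IH => x; exact: cvg_cst.
Qed.

Lemma CkD k f g : Ck k f -> Ck k g -> Ck k (fun x => f x + g x).
Proof.
elim: k f g => [|k IH] f g kf kg.
  by move=> x; apply: cvgD; [exact: kf|exact: kg].
apply: Ck_of_derive => [x|v].
  by apply: cvgD; [exact: (Ck_continuous kf)|exact: (Ck_continuous kg)].
exists (fun x => 'D_v f x + 'D_v g x).
  by apply: IH; exact: CkS_derive.
by move=> x; apply: is_deriveD; apply: derivableP;
  [exact: CkS_derivable kf|exact: CkS_derivable kg].
Qed.

Lemma CkM k f g : Ck k f -> Ck k g -> Ck k (fun x => f x * g x).
Proof.
elim: k f g => [|k IH] f g kf kg.
  by move=> x; apply: cvgM; [exact: kf|exact: kg].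
apply: Ck_of_derive => [x|v].
  by apply: cvgM; [exact: (Ck_continuous kf)|exact: (Ck_continuous kg)].
exists (fun x => f x * 'D_v g x + g x * 'D_v f x).
  by apply: CkD; apply: IH; do ?[exact: CkS_derive | exact: CkW].
by move=> x; apply: is_deriveM; apply: derivableP;
  [exact: CkS_derivable kf|exact: CkS_derivable kg].
Qed.

Lemma CkV k f : (forall x, f x != 0) -> Ck k f -> Ck k (fun x => (f x)^-1).
Proof.
move=> f0; elim: k => [|k IH] kf.
  by move=> x; apply: cvgV; [exact: f0|exact: kf].
apply: Ck_of_derive => [x|v].
  by apply: cvgV; [exact: f0|exact: (Ck_continuous kf)].
exists (fun x => (- 1) * ((f x)^-1 * (f x)^-1) * 'D_v f x).
  apply: CkM; last exact: CkS_derive.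
  by apply: CkM; [exact: Ck_cst|apply: CkM; apply: IH; exact: CkW].
move=> x; split; first by apply: derivableV => //; exact: CkS_derivable kf.
rewrite deriveV //; last exact: CkS_derivable kf.
by rewrite expr2 invfM mulN1r.
Qed.

Lemma is_derive_comp1 (F : R -> R) f x v (a b : R) :
  is_derive (f x) 1 F a -> is_derive x v f b -> is_derive x v (F \o f) (a * b).
Proof.
move=> dF [df <-].
have df0 : is_derive (0 : R) (1 : R) (fun h : R => f (h *: v + x)) ('D_v f x).
  split; first exact/(derivable1P f x v).
  rewrite /derive; set g1 := fun h => _; set g2 := fun h => _.
  suff -> : g1 = g2 by [].
  by apply/funext => h; rewrite /g1 /g2 /= scale0r addr0 add0r [_%:A]mulr1.
have dF0 : is_derive (f (0 *: v + x)) 1 F a by rewrite scale0r add0r.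
have [dc cE] := is_derive1_comp dF0 df0.
split; first exact/(derivable1P (F \o f) x v).
rewrite -cE /derive; set g1 := fun h => _; set g2 := fun h => _.
suff -> : g1 = g2 by [].
by apply/funext => h; rewrite /g1 /g2 /= scale0r addr0 add0r [_%:A]mulr1.
Qed.

(** A smooth function of one variable is presented by the sequence of its
    successive derivatives. *)
Definition derivative_tower F :=
  forall n (x : R), is_derive x 1 (F n) (F n.+1 x).

Lemma Ck_comp k F n f : derivative_tower F -> Ck k f -> Ck k (F n \o f).
Proof.
move=> dF; have cF m : continuous (F m).
  move=> x; apply/differentiable_continuous/derivable1_diffP.
  by have [] := dF m x.
elim: k n f => [|k IH] n f kf.
  by move=> x; apply: continuous_comp; [exact: kf|exact: cF].
apply: Ck_of_derive => [x|v].
  by apply: continuous_comp; [exact: (Ck_continuous kf)|exact: cF].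
exists (fun x => F n.+1 (f x) * 'D_v f x).
  by apply: CkM; [apply: IH; exact: CkW|exact: CkS_derive].
move=> x; apply: is_derive_comp1; first exact: dF.
by apply: derivableP; exact: CkS_derivable kf.
Qed.

Lemma is_derive_affine f (c : V -> R) v x :
  (forall x v t, f (t *: v + x) = t * c v + f x) -> is_derive x v f (c v).
Proof.
move=> fE.
have fh : (fun h : R => h^-1 *: ((f \o shift x) (h *: v) - f x)) @ 0^' --> c v.
  apply: (@cvg_trans _ ((fun=> c v) @ (0 : R)^')); last exact: cvg_cst.
  apply: near_eq_cvg; near=> h.
  rewrite /= fE addrK [_ *: _]mulrA mulVf ?mul1r//.
  by near: h; exact: nbhs_dnbhs_neq.
by split; [apply/cvg_ex; exists (c v)|exact: cvg_lim fh].
Unshelve. all: by end_near. Qed.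

Lemma smooth_affine f (c : V -> R) : continuous f ->
  (forall x v t, f (t *: v + x) = t * c v + f x) -> smooth f.
Proof.
move=> cf fE [//|k]; apply: Ck_of_derive => // v.
exists (fun=> c v); first exact: Ck_cst.
by move=> x; exact: is_derive_affine.
Qed.

Lemma smooth_cst (c : R) : smooth (fun _ : V => c).
Proof. by move=> k; exact: Ck_cst. Qed.

Lemma smoothD f g : smooth f -> smooth g -> smooth (fun x => f x + g x).
Proof. by move=> sf sg k; apply: CkD. Qed.

Lemma smoothM f g : smooth f -> smooth g -> smooth (fun x => f x * g x).
Proof. by move=> sf sg k; apply: CkM. Qed.

Lemma smoothV f : (forall x, f x != 0) -> smooth f -> smooth (fun x => (f x)^-1).
Proof. by move=> f0 sf k; apply: CkV. Qed.

Lemma smooth_comp F n f : derivative_tower F -> smooth f -> smooth (F n \o f).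
Proof. by move=> dF sf k; apply: Ck_comp. Qed.

Lemma smooth_prod n (f : 'I_n -> V -> R) :
  (forall i, smooth (f i)) -> smooth (fun x => \prod_(i < n) f i x).
Proof.
move=> sf; elim: n f sf => [|n IH] f sf.
  by under eq_fun do rewrite big_ord0; exact: smooth_cst.
under eq_fun do rewrite big_ord_recl.
by apply: smoothM => //; apply: IH.
Qed.

Lemma smooth_derive f v : smooth f -> smooth (fun x => 'D_v f x).
Proof. by move=> sf k; exact: CkS_derive (sf k.+1). Qed.

Lemma smooth_derivable f x v : smooth f -> derivable f x v.
Proof. by move=> sf; exact: CkS_derivable (sf 1%N). Qed.

Lemma smooth_continuous f : smooth f -> continuous f.
Proof. by move=> sf; exact: (sf 0%N). Qed.

End Ck_calculus.

(** * The flat function *)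

Section towers.
Context {R : realType}.

Definition cos_tower (n : nat) : R -> R :=
  fun x => cos (x + n%:R * (pi / 2)).

Lemma cos_tower0 x : cos_tower 0 x = cos x.
Proof. by rewrite /cos_tower mul0r addr0. Qed.

Lemma cos_towerP : derivative_tower cos_tower.
Proof.
move=> n x; rewrite /cos_tower.
have -> : cos (x + n.+1%:R * (pi / 2)) = - sin (x + n%:R * (pi / 2)) * (1 + 0) :> R.
  by rewrite -natr1 mulrDl mul1r addrA cosD cos_pihalf sin_pihalf; ring.
apply: (is_derive1_comp (f := cos) (g := fun x => x + _)).
Qed.

(** The flat functions p(1/z) exp(-1/z): the derivatives of exp(-1/z) all have
    this form and all tend to 0 at 0. *)
Definition flat (p : {poly R}) : R -> R :=
  fun z => if 0 < z then p.[z^-1] * expR (- z^-1) else 0.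

Definition flat_deriv (p : {poly R}) : {poly R} := 'X^2 * (p - p^`()).

(** Half of the exponent is spent at each degree. *)
Lemma poly_expR_bounded (p : {poly R}) (e : R) : 0 < e ->
  exists2 C : R, 0 <= C & forall t : R, 0 <= t -> `|p.[t]| <= C * expR (e * t).
Proof.
elim/poly_ind: p e => [|p c IH] e e0.
  by exists 0 => // t _; rewrite horner0 normr0 mul0r.
have e20 : 0 < e / 2 by rewrite divr_gt0.
have [C C0 HC] := IH _ e20.
exists (C / (e / 2) + `|c|); first by rewrite addr_ge0 ?divr_ge0 // ltW.
move=> t t0; rewrite hornerMXaddC.
apply: (le_trans (ler_normD _ _)); rewrite mulrDl; apply: lerD; last first.
  by rewrite ler_peMr// -expR0 ler_expR mulr_ge0// ltW.
rewrite normrM (ger0_norm t0).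
have tle : t <= (e / 2)^-1 * expR (e / 2 * t).
  rewrite ler_pdivlMl//; apply: le_trans (expR_ge1Dx _).
  by rewrite lerDr.
have -> : expR (e * t) = expR (e / 2 * t) * expR (e / 2 * t).
  by rewrite -expRD -mulrDl -splitr.
rewrite mulrACA; apply: ler_pM => //.
exact: HC.
Qed.

(** Quadratic vanishing at 0, which makes these functions differentiable there. *)
Lemma flat_le (p : {poly R}) : exists2 C : R, 0 <= C &
  forall z, `|flat p z| <= C * `|z| ^+ 2.
Proof.
have [C C0 HC] := poly_expR_bounded ('X^2 * p) ltr01.
exists C => // z; rewrite /flat; case: ifPn => z0; last first.
  by rewrite normr0 mulr_ge0// exprn_ge0.
have zi0 : 0 < z^-1 by rewrite invr_gt0.
have := HC _ (ltW zi0); rewrite hornerM hornerXn mul1r !normrM.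
rewrite (gtr0_norm (expR_gt0 _)) (gtr0_norm z0) (gtr0_norm zi0) -expr2 => H.
rewrite expRN ler_pdivrMr ?expR_gt0// mulrAC -ler_pdivrMr ?exprn_gt0//.
by rewrite mulrC -exprVn.
Qed.

Lemma is_derive_flat (p : {poly R}) (z : R) :
  is_derive z 1 (flat p) (flat (flat_deriv p) z).
Proof.
have [z0|z0|->] := ltgtP z 0.
- rewrite {2}/flat ltNge (ltW z0)/=.
  apply: near_eq_is_derive (is_derive_cst 0 z 1).
  near=> y; rewrite /flat ifF//; apply/negbTE; rewrite -leNgt ltW//.
  by near: y; exact: lt_nbhsl.
- have zN0 : z != 0 by rewrite gt_eqF.
  rewrite {2}/flat z0.
  have dV : is_derive z 1 (fun y : R => y^-1) (- z ^- 2 *: 1).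
    by apply: is_deriveV => //; exact: is_derive_id.
  have dp : is_derive z 1 ((fun y => p.[y]) \o (fun y : R => y^-1))
    (p^`().[z^-1] * (- z ^- 2 *: 1)).
    exact: (is_derive1_comp (is_derive_poly p _) dV).
  have de : is_derive z 1 (expR \o (fun y : R => - y^-1))
    (expR (- z^-1) * - (- z ^- 2 *: 1)).
    apply: is_derive1_comp; exact: is_deriveN.
  have := is_deriveM dp de.
  set w := (X in is_derive _ _ _ X); move=> H.
  have -> : (flat_deriv p).[z^-1] * expR (- z^-1) = w.
    rewrite /w /flat_deriv /= hornerM hornerXn hornerD hornerN.
    rewrite -[_ *: 1]/(- z ^- 2 * 1) -![_ *: _]/(_ * _) exprVn; ring.
  apply: near_eq_is_derive H.
  near=> y; rewrite /flat ifT//.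
  by near: y; exact: lt_nbhsr.
- (* At 0 the difference quotient is at most C |h|. *)
  have [C C0 HC] := flat_le p.
  have fl : (fun h : R => h^-1 *: ((flat p \o shift 0) (h *: 1) - flat p 0)) @ 0^'
      --> flat (flat_deriv p) 0.
    rewrite {2 3}/flat ltxx; apply/cvgr0Pnorm_le => e e0.
    near=> h.
    rewrite /= addr0 subr0 normrM normfV [_%:A]mulr1.
    have h0 : h != 0 by near: h; exact: nbhs_dnbhs_neq.
    have hn0 : 0 < `|h| by rewrite normr_gt0.
    rewrite ler_pdivrMl//; apply: le_trans (HC h) _.
    rewrite expr2 mulrA mulrC ler_pM2l//.
    have : `|h| < e / (C + 1).
      near: h; apply: (@dnbhs0_lt _ R^o).
      by rewrite divr_gt0// ltr_wpDl.
    rewrite ltr_pdivlMr ?ltr_wpDl// => /ltW; apply: le_trans.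
    by rewrite mulrC ler_wpM2l// lerDl.
  by split; [apply/cvg_ex; eexists; exact: fl|exact: cvg_lim fl].
Unshelve. all: by end_near. Qed.

Definition flat_tower (n : nat) : R -> R := flat (iter n flat_deriv 1).

Lemma flat_towerP : derivative_tower flat_tower.
Proof. by move=> n z; exact: is_derive_flat. Qed.

Definition flat_step : R -> R := flat 1.

Lemma flat_step_gt0 z : (0 < flat_step z) = (0 < z).
Proof.
rewrite /flat_step /flat; case: ifP => // _.
by rewrite hornerC mul1r expR_gt0.
Qed.

Lemma flat_step_ge0 z : 0 <= flat_step z.
Proof.
rewrite /flat_step /flat; case: ifP => // _.
by rewrite hornerC mul1r ltW// expR_gt0.
Qed.

Lemma flat_step0 z : z <= 0 -> flat_step z = 0.
Proof. by move=> z0; rewrite /flat_step /flat ltNge z0. Qed.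

Lemma flat_step_le1 z : flat_step z <= 1.
Proof.
rewrite /flat_step /flat; case: ifP => // z0.
by rewrite hornerC mul1r -expR0 ler_expR oppr_le0 invr_ge0 ltW.
Qed.

Lemma cvg_flat_step z : flat_step (n%:R * z) @[n --> \oo] --> (if 0 < z then 1 : R else 0).
Proof.
case: ifPn => z0; last first.
  apply: cvg_near_cst; near=> n; rewrite flat_step0// mulr_ge0_le0//.
  by rewrite leNgt.
suff : flat_step (n%:R * z) @[n --> \oo] --> expR (- (0 * z^-1)).
  by rewrite mul0r oppr0 expR0.
apply: (@cvg_trans _ (expR (- (n%:R^-1 * z^-1)) @[n --> \oo])).
  apply: near_eq_cvg; near=> n.
  rewrite /flat_step /flat mulr_gt0//; first by rewrite hornerC mul1r invfM.
  by rewrite ltr0n; near: n; exists 1%N.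
apply: (cvg_comp (fun n : nat => - (n%:R^-1 * z^-1)) expR _ (@continuous_expR R _)).
apply: cvgN; apply: cvgMl.
apply/gtr0_cvgV0; last exact: cvgr_idn.
by near=> n; rewrite ltr0n; near: n; exists 1%N.
Unshelve. all: by end_near. Qed.

End towers.

(** * Integrable and square-integrable functions *)

Section L1_L2.
Context {dsp : measure_display} {T : measurableType dsp} {R : realType}.
Variable mu : {measure set T -> \bar R}.
Implicit Types f g a : T -> R.

Definition intg f : Prop := mu.-integrable setT (EFin \o f).
Definition L2 f : Prop := measurable_fun setT f /\ intg (fun x => f x ^+ 2).

Lemma intg_measurable f : intg f -> measurable_fun setT f.
Proof. by move=> /measurable_int/measurable_EFinP. Qed.

Lemma L2_measurable f : L2 f -> measurable_fun setT f.
Proof. by case. Qed.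

Lemma intg_le f g : measurable_fun setT f -> (forall x, `|f x| <= g x) ->
  intg g -> intg f.
Proof.
move=> mf fg ig; apply: le_integrable ig => //; first exact/measurable_EFinP.
by move=> x _ /=; rewrite lee_fin (le_trans (fg x)) ?ler_norm.
Qed.

Lemma intg0 : intg (fun=> 0).
Proof. exact: integrable0. Qed.

Lemma intgD f g : intg f -> intg g -> intg (fun x => f x + g x).
Proof.
by move=> fi gi; apply: eq_integrable (integrableD measurableT fi gi).
Qed.

Lemma intgZ (k : R) f : intg f -> intg (fun x => k * f x).
Proof.
by move=> fi; apply: eq_integrable (integrableZl measurableT k fi).
Qed.

Lemma intgN f : intg f -> intg (fun x => - f x).
Proof.
by move=> fi; apply: eq_integrable (integrableN fi).
Qed.

Lemma intgB f g : intg f -> intg g -> intg (fun x => f x - g x).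
Proof. by move=> fi gi; apply: intgD => //; exact: intgN. Qed.

Lemma intg_sum n (f : 'I_n -> T -> R) : (forall i, intg (f i)) ->
  intg (fun x => \sum_(i < n) f i x).
Proof.
move=> fi; elim: n f fi => [|n IH] f fi.
  by under eq_fun do rewrite big_ord0; exact: intg0.
under eq_fun do rewrite big_ord_recl.
by apply: intgD => //; exact: IH.
Qed.

Lemma intgM_bounded (C : R) f a : measurable_fun setT a ->
  (forall x, `|a x| <= C) -> intg f -> intg (fun x => a x * f x).
Proof.
move=> ma aC fi; apply: (@intg_le _ (fun x => C * `|f x|)).
- by apply: measurable_funM => //; exact: intg_measurable.
- by move=> x; rewrite normrM ler_wpM2r.
- by apply: intgZ; exact: integrable_norm.
Qed.

Lemma RintD f g : intg f -> intg g ->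
  \int[mu]_x (f x + g x) = \int[mu]_x f x + \int[mu]_x g x.
Proof. by move=> fi gi; exact: RintegralD. Qed.

Lemma RintB f g : intg f -> intg g ->
  \int[mu]_x (f x - g x) = \int[mu]_x f x - \int[mu]_x g x.
Proof. by move=> fi gi; exact: RintegralB. Qed.

Lemma RintZ (k : R) f : intg f -> \int[mu]_x (k * f x) = k * \int[mu]_x f x.
Proof. by move=> fi; exact: RintegralZl. Qed.

Lemma eq_Rint f g : f =1 g -> \int[mu]_x f x = \int[mu]_x g x.
Proof. by move=> fg; apply: eq_Rintegral => x _. Qed.

Lemma Rint_le f g : intg f -> intg g -> (forall x, f x <= g x) ->
  \int[mu]_x f x <= \int[mu]_x g x.
Proof. by move=> fi gi fg; exact: le_Rintegral. Qed.

Lemma Rint_ge0 f : (forall x, 0 <= f x) -> 0 <= \int[mu]_x f x.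
Proof. by move=> f0; exact: Rintegral_ge0. Qed.

Lemma Rint_zero : \int[mu]_x (0 : R) = 0.
Proof. by rewrite /Rintegral integral0. Qed.

Lemma EFin_Rint f : intg f -> (\int[mu]_x f x)%:E = (\int[mu]_x (f x)%:E)%E.
Proof. by move=> fi; rewrite /Rintegral fineK//; exact: integrable_fin_num. Qed.

Lemma Rint_ae f g : measurable_fun setT f -> measurable_fun setT g ->
  ae_eq mu setT f g -> \int[mu]_x f x = \int[mu]_x g x.
Proof.
move=> mf mg fg; congr fine; apply: ae_eq_integral => //.
- exact/measurable_EFinP.
- exact/measurable_EFinP.
- by apply: filterS fg => x fgx Dx /=; rewrite fgx.
Qed.

Lemma Rint_eq0_ae f : (forall x, 0 <= f x) -> intg f -> \int[mu]_x f x = 0 ->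
  ae_eq mu setT f (cst 0).
Proof.
move=> f0 fi If0; have mf := intg_measurable fi.
have : ae_eq mu setT (EFin \o f) (cst 0%E).
  apply/(ae_eq_integral_abs mu measurableT); first exact/measurable_EFinP.
  under eq_integral => x _ do rewrite /= ger0_norm//.
  by rewrite -EFin_Rint// If0.
by apply: filterS => x fx Dx; have /eqP := fx Dx; rewrite eqe => /eqP.
Qed.

Lemma L2_mul f g : L2 f -> L2 g -> intg (fun x => f x * g x).
Proof.
move=> [mf f2] [mg g2]; apply: (@intg_le _ (fun x => f x ^+ 2 + g x ^+ 2)).
- exact: measurable_funM.
- move=> x; rewrite normrM -(real_normK (num_real (f x))).
  rewrite -(real_normK (num_real (g x))).
  have := normr_ge0 (f x); have := normr_ge0 (g x); nra.
- exact: intgD.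
Qed.

Lemma L2_le f g : measurable_fun setT f -> (forall x, `|f x| <= `|g x|) ->
  L2 g -> L2 f.
Proof.
move=> mf fg [mg g2]; split => //; apply: intg_le g2.
  exact: measurable_funX.
by move=> x; rewrite normrX -[leRHS]real_normK ?num_real// lerXn2r ?nnegrE.
Qed.

Lemma L2D f g : L2 f -> L2 g -> L2 (fun x => f x + g x).
Proof.
move=> [mf f2] [mg g2]; split; first exact: measurable_funD.
apply: (@intg_le _ (fun x => 2 * f x ^+ 2 + 2 * g x ^+ 2)).
- by apply: measurable_funX; exact: measurable_funD.
- move=> x; rewrite ger0_norm ?sqr_ge0// -subr_ge0.
  by rewrite (_ : _ - _ = (f x - g x) ^+ 2) ?sqr_ge0//; ring.
- by apply: intgD; exact: intgZ.
Qed.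

Lemma L2Z (k : R) f : L2 f -> L2 (fun x => k * f x).
Proof.
move=> [mf f2]; split; first exact: measurable_funM.
by under eq_fun do rewrite exprMn; exact: intgZ.
Qed.

Lemma L20 : L2 (fun=> 0).
Proof. by split=> //; under eq_fun do rewrite expr0n; exact: intg0. Qed.

Lemma L2N f : L2 f -> L2 (fun x => - f x).
Proof. by move=> /(L2Z (-1)); under eq_fun do rewrite mulN1r. Qed.

Lemma L2B f g : L2 f -> L2 g -> L2 (fun x => f x - g x).
Proof. by move=> lf lg; apply: L2D => //; exact: L2N. Qed.

Lemma L2M_bounded (C : R) f a : measurable_fun setT a ->
  (forall x, `|a x| <= C) -> L2 f -> L2 (fun x => a x * f x).
Proof.
move=> ma aC lf; apply: (@L2_le _ (fun x => C * f x)); last exact: L2Z.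
  by apply: measurable_funM => //; exact: L2_measurable.
move=> x; rewrite !normrM ler_wpM2r//.
exact: le_trans (aC x) (ler_norm _).
Qed.

Lemma L2_of_bounded (C : R) f : (forall x, `|f x| <= C) -> intg f -> L2 f.
Proof.
move=> fC fi; split; first exact: intg_measurable.
by under eq_fun do rewrite expr2; apply: (@intgM_bounded C f f) => //;
  exact: intg_measurable.
Qed.

Lemma poweR_sqr (x : \bar R) : (0 <= x)%E -> (x `^ 2 = x ^+ 2)%E.
Proof.
case: x => [r r0|_|//]; first by rewrite poweR_EFin powR_mulrn// EFin_expe.
by rewrite poweRyr// expe2.
Qed.

Lemma Lnorm2_sqr f : ('N[mu]_2%:E[EFin \o f] ^+ 2 = \int[mu]_x (f x ^+ 2)%:E)%E.
Proof.
have n20 : (2 : R) != 0 by [].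
have := poweR_Lnorm mu (EFin \o f) n20.
rewrite poweR_sqr ?Lnorm_ge0// => ->.
apply: eq_integral => x _ /=.
by rewrite powR_mulrn// real_normK// num_real.
Qed.

Lemma Lfun2P f : f \in Lfun mu 2%:E <-> L2 f.
Proof.
split => [lf|[mf f2]].
  split; last exact: Lfun2_integrable_sqr.
  by move: lf; rewrite inE => /andP[]; rewrite inE.
rewrite inE; apply/andP; split; first by rewrite inE.
rewrite inE /= /finite_norm ltNge leye_eq; apply/negP => /eqP Ny.
have := Lnorm2_sqr f; rewrite Ny -EFin_Rint//.
Qed.

End L1_L2.

(** * Measure and topology of the Euclidean factor *)

Section rV_topology.
Context {R : realType}.

Lemma rV_ball d (x y : 'rV[R]_d) (e : R) :
  0 < e -> (forall i, `|x ord0 i - y ord0 i| < e) -> ball x e y.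
Proof. by move=> e0 H; split => // i j; rewrite ord1; exact: H. Qed.

Lemma coord_le_norm d (x : 'rV[R]_d) i : `|x ord0 i| <= `|x|.
Proof.
rewrite [leRHS]/Num.Def.normr /= mx_normrE.
exact: (le_bigmax _ (fun ij : 'I_1 * 'I_d => `|x ij.1 ij.2|) (ord0, i)).
Qed.

Lemma measurable_rV_box d (A : 'I_d -> set R) : (forall i, measurable (A i)) ->
  measurable [set x : 'rV[R]_d | forall i, A i (x ord0 i)].
Proof.
move=> mA.
rewrite (_ : [set x | _] =
    \bigcap_(i in [set: 'I_d]) ((fun x : 'rV[R]_d => x ord0 i) @^-1` A i)).
  apply: fin_bigcap_measurable => [|i _]; first exact: finite_finset.
  by rewrite -[X in measurable X]setTI; exact: measurable_coord.
by apply/seteqP; split => [x + i _|x + i]; exact.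
Qed.

(** Every open set is a countable union of the grid cells of side 1/n that it
    contains, so the coordinatewise sigma-algebra contains the open sets. *)
Lemma open_measurable_xy d (U : set ('rV[R]_d * R)) : open U -> measurable U.
Proof.
move=> oU.
pose slab (n : nat) (k : int) : set R :=
  [set s | k%:~R <= n.+1%:R * s < k%:~R + 1].
have mslab n k : measurable (slab n k).
  rewrite (_ : slab n k = `[k%:~R / n.+1%:R, (k%:~R + 1) / n.+1%:R[%classic).
    exact: measurable_itv.
  apply/seteqP; split => s /=; rewrite in_itv/= ler_pdivrMr// ltr_pdivlMr//;
    by rewrite mulrC.
pose cell (t : nat * ('rV[int]_d * int)) : set ('rV[R]_d * R) :=
  [set x : 'rV[R]_d | forall i, slab t.1 (t.2.1 ord0 i) (x ord0 i)] `*`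
  slab t.1 t.2.2.
have mcell t : measurable (cell t).
  apply: measurableX => //.
  exact: (@measurable_rV_box d (fun i => slab t.1 (t.2.1 ord0 i))).
have slab_close n k s s' : slab n k s -> slab n k s' -> `|s - s'| < n.+1%:R^-1.
  move=> /andP[h1 h2] /andP[h3 h4].
  rewrite -(@ltr_pM2l _ n.+1%:R)// mulfV//.
  rewrite -{1}(ger0_norm (ler0n R n.+1)) -normrM mulrBr ltr_norml.
  by apply/andP; split; lra.
have -> : U = \bigcup_(t : nat * ('rV[int]_d * int))
    (if pselect (cell t `<=` U) then cell t else set0).
  apply/seteqP; split; last first.
    by move=> z [t _]; case: pselect => // tU zt; exact (tU z zt).
  move=> [x y] Uxy.
  have /nbhs_ballP[e /= e0 beU] : nbhs (x, y) U by exact: open_nbhs_nbhs.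
  pose n := Num.truncn (e^-1).
  have ne : n.+1%:R^-1 < e.
    by rewrite invf_plt ?posrE// truncnS_gt.
  exists (n, (\row_i Num.floor (n.+1%:R * x ord0 i), Num.floor (n.+1%:R * y))) => //.
  have cxy : cell (n, (\row_i Num.floor (n.+1%:R * x ord0 i),
      Num.floor (n.+1%:R * y))) (x, y).
    by split => /= [i|]; rewrite /slab /= ?mxE floor_le -[X in _ + X]/(1%:~R) -intrD floorD1_gt.
  case: pselect => // -[] z cz; apply: beU; split => /=.
    apply: rV_ball => // i; apply: lt_trans ne.
    by apply: slab_close; [exact: (cxy.1 i)|exact: (cz.1 i)].
  by apply: lt_trans ne; apply: slab_close; [exact: cxy.2|exact: cz.2].
apply: countable_bigcupT_measurable => [|t]; first exact: countableP.
by case: pselect => ?; [exact: mcell|exact: measurable0].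
Qed.

Lemma continuous_measurable_xy d (f : 'rV[R]_d * R -> R) :
  continuous f -> measurable_fun setT f.
Proof.
move=> cf; apply: (measurability _ (RGenOInfty.measurableE R)) => // _ [_ [a ->] <-].
rewrite setTI; apply: open_measurable_xy.
by apply: open_comp => // x _; exact: cf.
Qed.

Lemma continuous_measurable_rV d (f : 'rV[R]_d -> R) :
  continuous f -> measurable_fun setT f.
Proof.
move=> cf.
have -> : f = (f \o fst) \o (fun x => (x, 0 : R)) by [].
apply: measurableT_comp; last first.
  by apply/measurable_fun_pairP; split; [exact: measurable_id|exact: measurable_cst].
apply: continuous_measurable_xy => z; apply: continuous_comp; first exact: cvg_fst.
exact: cf.
Qed.

Lemma lebesgue_rV_box d (M : R) :
  (lebesgue_rV d [set x : 'rV[R]_d | forall i, -M <= x ord0 i <= M]%R < +oo)%E.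
Proof.
have mI : measurable (`[-M, M]%classic : set R) by exact: measurable_itv.
elim: d => [|d IH] /=.
  by rewrite diracE; case: (_ \in _); rewrite ltry.
rewrite /pushforward.
have -> : (@cons_rV R d) @^-1` [set x | forall i, -M <= x ord0 i <= M] =
  `[-M, M]%classic `*` [set x : 'rV[R]_d | forall i, -M <= x ord0 i <= M].
  apply/seteqP; split => [[s x]|[s x]] /=.
    rewrite in_itv /= => H; split.
      by have := H ord0; rewrite /cons_rV mxE; case: splitP => // j _; rewrite mxE.
    move=> i; have := H (lift ord0 i); rewrite /cons_rV mxE.
    by case: splitP => j; [rewrite ord1|move=> /addnI/val_inj <-].
  rewrite in_itv /= => -[Hs Hx] i; rewrite /cons_rV mxE.
  by case: splitP => j _; rewrite ?mxE.
rewrite product_measure1E//=; last first.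
  apply: (@measurable_rV_box d (fun=> `[-M, M]%classic)) => //.
rewrite lebesgue_measure_itv; apply: lte_mul_pinfty => //.
- by case: ifP => //; rewrite lte_fin lee_fin => /ltW; rewrite -subr_ge0.
- by case: ifP.
Qed.

Lemma compact_norm_ball d (M : R) : compact [set x : 'rV[R]_d | `|x| <= M].
Proof.
apply: bounded_closed_compact.
  exists M; split; [exact: num_real|move=> N MN x /= xM].
  by rewrite (le_trans xM)// ltW.
rewrite (_ : [set x | _] = (fun x : 'rV[R]_d => `|x|) @^-1` [set z | z <= M])//.
by apply: preimage_closed (@closed_le _ M) => z _; exact: norm_continuous.
Qed.

Lemma measurable_norm_ball d (M : R) : measurable [set x : 'rV[R]_d | `|x| <= M].
Proof.
rewrite -[X in measurable X]setTI.
have : measurable_fun setT (fun x : 'rV[R]_d => `|x|).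
  by apply: continuous_measurable_rV; exact: norm_continuous.
move=> /(_ measurableT [set` `]-oo, M]] (measurable_itv _)).
by rewrite set_itvE.
Qed.

Lemma lebesgue_rV_ball d (M : R) :
  (lebesgue_rV d [set x : 'rV[R]_d | (`|x| <= M)%R] < +oo)%E.
Proof.
apply: le_lt_trans (lebesgue_rV_box d M).
apply: le_measure; rewrite ?inE.
- exact: measurable_norm_ball.
- apply: (@measurable_rV_box d (fun=> [set s | -M <= s <= M])) => _.
  by have := @measurable_itv R `[-M, M]; rewrite set_itvE.
- move=> x /= xM i; rewrite -ler_norml; exact: le_trans (coord_le_norm x i) xM.
Qed.

End rV_topology.

(** * Integrals of derivatives *)

Section derive_facts.
Context {R : realType}.

Section along.
Variables (V W : normedModType R) (f : W -> R) (A : V -> W) (x v : V) (w : W).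
Hypothesis HA : forall h : R, A (h *: v + x) = h *: w + A x.

Lemma derive_along : 'D_v (f \o A) x = 'D_w f (A x).
Proof.
rewrite /derive; set g1 := fun h => _; set g2 := fun h => _.
suff -> : g1 = g2 by [].
by apply/funext => h; rewrite /g1 /g2 /= HA.
Qed.

Lemma derivable_along : derivable f (A x) w -> derivable (f \o A) x v.
Proof.
rewrite /derivable; set g1 := fun h => _; set g2 := fun h => _.
suff -> : g1 = g2 by [].
by apply/funext => h; rewrite /g1 /g2 /= HA.
Qed.

End along.

Lemma derive_eq0 (V : normedModType R) (f : V -> R) (C : set V) v x :
  open C -> (forall z, C z -> f z = 0) -> C x -> 'D_v f x = 0.
Proof.
move=> oC f0 Cx; rewrite (_ : 0 = 'D_v (cst 0 : V -> R) x); last first.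
  by rewrite derive_cst.
by apply: near_eq_derive; apply: filterS (open_nbhs_nbhs (conj oC Cx)).
Qed.

Lemma Rint_derive_itv (F : R -> R) (a b : R) : a < b ->
  (forall s, derivable F s 1) -> continuous (fun s => 'D_1 F s) ->
  (\int[lebesgue_measure]_(s in `[a, b]) ('D_1 F s)%:E = (F b - F a)%:E)%E.
Proof.
move=> ab dF cF; have cc : continuous F.
  by move=> s; apply/differentiable_continuous/derivable1_diffP.
rewrite EFinB; apply: continuous_FTC2 => //.
- by apply: continuous_subspaceT.
- split => //.
  + exact: cvg_at_right_filter (cc a).
  + exact: cvg_at_left_filter (cc b).
- by move=> s _; rewrite derive1E.
Qed.

Lemma Rint_derive_line (F : R -> R) (M : R) :
  (forall s, derivable F s 1) -> continuous (fun s => 'D_1 F s) ->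
  (forall s, M < `|s| -> F s = 0) ->
  (\int[lebesgue_measure]_s ('D_1 F s)%:E = 0)%E.
Proof.
move=> dF cF F0.
have F'0 s : M < `|s| -> 'D_1 F s = 0.
  apply: (@derive_eq0 _ F [set z | M < `|z|]) => //.
  rewrite (_ : [set z | _] = (fun z : R => `|z|) @^-1` [set z | M < z]) //.
  apply: open_comp; last exact: open_gt.
  by move=> z _; exact: norm_continuous.
pose b : R := `|M| + 1; have b0 : - b < b by rewrite gtrN// ltr_wpDl.
have Mb : M < b by rewrite ltr_pwDr// ler_norm.
transitivity (\int[lebesgue_measure]_(s in `[(- b)%R, b]) ('D_1 F s)%:E)%E.
  rewrite [RHS]integral_mkcond; apply: eq_integral => s _.
  rewrite patchE; case: ifPn => //; rewrite notin_setE /= in_itv /= => /negP.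
  by rewrite -ler_norml -ltNge => /(lt_trans Mb)/F'0 ->.
rewrite Rint_derive_itv// !F0 ?subrr// ?normrN ger0_norm//;
  exact: addr_ge0.
Qed.

End derive_facts.

Section lebesgue_rV_integration.
Context {R : realType}.

Lemma intg_bounded_support {dsp} {T : measurableType dsp}
    (mu : {measure set T -> \bar R}) (f : T -> R) (A : set T) (C : R) :
  measurable_fun setT f -> measurable A -> (mu A < +oo)%E ->
  (forall x, `|f x| <= C) -> (forall x, ~ A x -> f x = 0) -> intg mu f.
Proof.
move=> mf mA muA fC f0; rewrite /intg.
have -> : EFin \o f = (EFin \o f) \_ A.
  apply/funext => x; rewrite patchE; case: ifPn => // /negP.
  by rewrite inE => /f0 /= ->.
apply/(integrable_mkcond _ mA); apply: measurable_bounded_integrable => //.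
  exact: measurable_funTS.
exists C; split; [exact: num_real|move=> M CM x _].
by rewrite /= (le_trans (fC x))// ltW.
Qed.

Lemma continuous_bounded_support_rV d (f : 'rV[R]_d -> R) (M : R) :
  continuous f -> (forall x, M < `|x| -> f x = 0) ->
  exists2 C, 0 <= C & forall x, `|f x| <= C.
Proof.
move=> cf f0.
have cK := @compact_norm_ball R d M.
have /compact_bounded[C [_ HC]] : compact (f @` [set x : 'rV[R]_d | `|x| <= M]).
  by apply: continuous_compact => //; exact: continuous_subspaceT.
exists (`|C| + 1); first by rewrite addr_ge0.
move=> x; have [xM|/f0 ->] := leP `|x| M; last by rewrite normr0 addr_ge0.
by apply: HC; [rewrite ltr_pwDr// ler_norm|exists x].
Qed.

Lemma continuous_intg_rV d (f : 'rV[R]_d -> R) (M : R) :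
  continuous f -> (forall x, M < `|x| -> f x = 0) -> intg (lebesgue_rV d) f.
Proof.
move=> cf f0; have [C C0 HC] := continuous_bounded_support_rV cf f0.
apply: (@intg_bounded_support _ _ _ _ [set x : 'rV[R]_d | `|x| <= M] C) => //.
- exact: continuous_measurable_rV.
- exact: measurable_norm_ball.
- exact: lebesgue_rV_ball.
- by move=> x /negP; rewrite -ltNge => /f0.
Qed.

Lemma open_norm_gt (V : normedModType R) (M : R) : open [set x : V | M < `|x|].
Proof.
rewrite (_ : [set z | _] = (fun z : V => `|z|) @^-1` [set z | M < z]) //.
apply: open_comp; last exact: open_gt.
by move=> z _; exact: norm_continuous.
Qed.

Lemma cons_rV_ball d (s s' : R) (x x' : 'rV[R]_d) e :
  ball s e s' -> ball x e x' -> ball (cons_rV (s, x)) e (cons_rV (s', x')).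
Proof.
move=> bs bx; have e0 : 0 < e := le_lt_trans (normr_ge0 _) bs.
apply: rV_ball => // i; rewrite /cons_rV !mxE /=.
case: splitP => j _; rewrite ?mxE//.
by case: bx => _ /(_ ord0 j).
Qed.

Lemma continuous_cons_rV_l d (x : 'rV[R]_d) :
  continuous (fun s : R => cons_rV (s, x)).
Proof.
move=> s A /nbhs_ballP[e /= e0 eA]; apply/nbhs_ballP; exists e => // s' bs.
by apply: eA; apply: cons_rV_ball => //; exact: ballxx.
Qed.

Lemma continuous_cons_rV_r d (s : R) :
  continuous (fun x : 'rV[R]_d => cons_rV (s, x)).
Proof.
move=> x A /nbhs_ballP[e /= e0 eA]; apply/nbhs_ballP; exists e => // x' bx.
by apply: eA; apply: cons_rV_ball => //; exact: ballxx.
Qed.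

Lemma norm_cons_rV_l d (s : R) (x : 'rV[R]_d) : `|s| <= `|cons_rV (s, x)|.
Proof.
have := coord_le_norm (cons_rV (s, x)) ord0; rewrite /cons_rV mxE.
by case: splitP => // j _; rewrite mxE.
Qed.

Lemma norm_cons_rV_r d (s : R) (x : 'rV[R]_d) : `|x| <= `|cons_rV (s, x)|.
Proof.
rewrite {1}/Num.Def.normr /= mx_normrE; apply: bigmax_le => //= -[i j] _ /=.
have := coord_le_norm (cons_rV (s, x)) (lift ord0 j); rewrite /cons_rV mxE.
rewrite (ord1 i); case: splitP => k; last by move=> /addnI/val_inj <-.
by rewrite (ord1 k).
Qed.

Lemma cons_rV_line0 d (s h : R) (x : 'rV[R]_d) :
  cons_rV (h *: 1 + s, x) = h *: delta_mx ord0 ord0 + cons_rV (s, x).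
Proof.
apply/rowP => i; rewrite /cons_rV !mxE /=.
case: splitP => j ij; rewrite ?mxE ?eqxx /=.
  have -> : i = ord0 by apply/val_inj; rewrite /= ij ord1.
  by rewrite eqxx mulr1 [_%:A]mulr1.
have -> : (i == ord0) = false by apply/negbTE/eqP => i0; move: ij; rewrite i0.
by rewrite mulr0 add0r.
Qed.

Lemma cons_rV_lineS d (j : 'I_d) (s h : R) (x : 'rV[R]_d) :
  cons_rV (s, h *: delta_mx ord0 j + x) =
  h *: delta_mx ord0 (lift ord0 j) + cons_rV (s, x).
Proof.
apply/rowP => i; rewrite /cons_rV !mxE /=.
case: splitP => k ik; rewrite ?mxE ?eqxx /=.
  have -> : (i == lift ord0 j) = false.
    by apply/negbTE/eqP => i0; move: ik; rewrite i0 ord1.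
  by rewrite mulr0 add0r.
congr (_ * (_)%:R + _); rewrite -!val_eqE /= ik; by rewrite /bump /= eqn_add2l.
Qed.

Lemma measurable_cons_rV d :
  measurable_fun setT (@cons_rV R d : measurableTypeR R * 'rV[R]_d -> 'rV[R]_d.+1).
Proof.
apply: (@measurable_fun_coordP _ R d.+1) => i; rewrite /cons_rV.
under eq_fun do rewrite mxE.
case: splitP => j _.
  by under eq_fun do rewrite mxE; exact: measurable_fst.
exact: (measurableT_comp (f := fun v : 'rV[R]_d => v ord0 j)
  (@measurable_coord _ R d j) measurable_snd).
Qed.

Lemma integral_lebesgue_rVS d (f : 'rV[R]_d.+1 -> R) :
  intg (lebesgue_rV d.+1) f ->
  intg (lebesgue_measure \x lebesgue_rV d)%E (f \o @cons_rV R d) /\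
  (\int[lebesgue_rV d.+1]_x (f x)%:E =
   \int[lebesgue_measure \x lebesgue_rV d]_p (f (cons_rV p))%:E)%E.
Proof.
move=> fi; have mf := intg_measurable fi.
have mfE : measurable_fun setT (EFin \o f) by exact/measurable_EFinP.
have mc := @measurable_cons_rV d.
pose nu := measure_function_pushforward__canonical__measure_function_Measure
  (lebesgue_measure \x lebesgue_rV d)%E mc.
have E (g : 'rV[R]_d.+1 -> \bar R) :
    (\int[lebesgue_rV d.+1]_x g x = \int[nu]_x g x)%E.
  by apply: eq_measure_integral => A mA _.
have fi' : intg (lebesgue_measure \x lebesgue_rV d)%E (f \o @cons_rV R d).
  apply/integrableP; split.
    exact: (measurableT_comp mfE mc).
  have /integrableP[_] := fi; rewrite E.
  congr (_ < _)%E; apply: (ge0_integral_pushforward mc _ measurableT) => //.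
  exact: measurableT_comp.
split => //; rewrite E.
exact: (integral_pushforward mc _ _ measurableT).
Qed.

(** No flux through infinity: reduce to the fundamental theorem of calculus in
    the differentiated coordinate. *)
Lemma integral_partial_rV d (i : 'I_d) (f : 'rV[R]_d -> R) (M : R) :
  (forall x, derivable f x (delta_mx ord0 i)) ->
  continuous f -> continuous (fun x => 'D_(delta_mx ord0 i) f x) ->
  (forall x, M < `|x| -> f x = 0) ->
  (\int[lebesgue_rV d]_x ('D_(delta_mx ord0 i) f x)%:E = 0)%E.
Proof.
elim: d i f => [[]//|d IH] i f df cf cf' f0.
have f'0 x : M < `|x| -> 'D_(delta_mx ord0 i) f x = 0.
  exact: (derive_eq0 _ (@open_norm_gt _ M)).
have [i1 ->] := integral_lebesgue_rVS (continuous_intg_rV cf' f'0).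
case: (unliftP ord0 i) => [j|] ij.
- rewrite -(@integral12_prod_meas1 _ _ _ _ R lebesgue_measure (lebesgue_rV d) _ i1); apply: integral0_eq => s _.
  rewrite /fubini_F /=.
  have E x : 'D_(delta_mx ord0 i) f (cons_rV (s, x)) =
      'D_(delta_mx ord0 j) (f \o (fun x => cons_rV (s, x))) x.
    rewrite ij; symmetry; apply: derive_along => h; exact: cons_rV_lineS.
  under eq_integral => x _ do rewrite E.
  apply: IH.
  + move=> x; apply: (@derivable_along R _ _ f (fun x => cons_rV (s, x)) x _
      (delta_mx ord0 (lift ord0 j))).
      by move=> h; exact: cons_rV_lineS.
    by rewrite -ij.
  + by move=> x; apply: continuous_comp; [exact: continuous_cons_rV_r|exact: cf].
  + under eq_fun do rewrite -E.
    move=> x; apply: (@continuous_comp _ _ _ (fun x => cons_rV (s, x))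
      (fun x => 'D_(delta_mx ord0 i) f x)); [exact: continuous_cons_rV_r|exact: cf'].
  + by move=> x xM; rewrite /= f0// (lt_le_trans xM)// norm_cons_rV_r.
- rewrite -(@integral21_prod_meas1 _ _ _ _ R lebesgue_measure (lebesgue_rV d) _ i1); apply: integral0_eq => x _.
  rewrite /fubini_G /=.
  have E s : 'D_(delta_mx ord0 i) f (cons_rV (s, x)) =
      'D_1 (f \o (fun s => cons_rV (s, x))) s.
    rewrite ij; symmetry; apply: derive_along => h; exact: cons_rV_line0.
  under eq_integral => s _ do rewrite E.
  apply: (@Rint_derive_line _ _ M).
  + move=> s; apply: (@derivable_along R _ _ f (fun s => cons_rV (s, x)) s _
      (delta_mx ord0 ord0)).
      by move=> h; exact: cons_rV_line0.
    by rewrite -ij.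
  + under eq_fun do rewrite -E.
    move=> s; apply: (@continuous_comp _ _ _ (fun s => cons_rV (s, x))
      (fun x => 'D_(delta_mx ord0 i) f x)); [exact: continuous_cons_rV_l|exact: cf'].
  + by move=> s xM; rewrite /= f0// (lt_le_trans xM)// norm_cons_rV_l.
Qed.

End lebesgue_rV_integration.

(** * Test functions *)

Section torus_integration.
Context {R : realType}.
Local Notation circle := (`[0, 2 * pi[%classic : set R).

Lemma torus_setT : torus_measure [set: R] = (2 * pi)%:E.
Proof.
rewrite /torus_measure setTI lebesgue_measure_itv /= lte_fin.
by rewrite mulr_gt0 ?pi_gt0// -EFinB subr0.
Qed.

Lemma torus_setC : torus_measure (~` circle) = 0%E.
Proof. by rewrite /torus_measure setICl measure0. Qed.

Lemma measurable_circle : measurable circle.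
Proof. exact: measurable_itv. Qed.

Let idR : measurableTypeR R -> R := id.
Let midR : measurable_fun setT idR. Proof. by move=> _ Y mY; rewrite setTI. Qed.

(** The Lebesgue measure lives on a copy of R with its own measurable structure;
    the pushforward along the identity links the two. *)
Lemma ge0_integral_torus (f : R -> \bar R) : measurable_fun setT f ->
  (forall y, 0 <= f y)%E ->
  (\int[torus_measure]_y f y = \int[lebesgue_measure]_(y in circle) f y)%E.
Proof.
move=> mf f0; rewrite (@ge0_negligible_integral _ _ _ torus_measure _ (~` circle))//.
- rewrite setTD setCK.
  pose nu := measure_function_pushforward__canonical__measure_function_Measure
    (@lebesgue_measure R) midR.
  transitivity (\int[nu]_(y in circle) f y)%E.
    apply: eq_measure_integral => A mA AC.
    by rewrite /= /torus_measure /pushforward setIidl.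
  apply: (ge0_integral_pushforward midR _ measurable_circle) => //.
  exact: measurable_funTS.
- by apply: measurableC; exact: measurable_circle.
- exact: torus_setC.
Qed.

Lemma integral_torus (f : R -> \bar R) : measurable_fun setT f ->
  (\int[torus_measure]_y f y = \int[lebesgue_measure]_(y in circle) f y)%E.
Proof.
move=> mf; rewrite [LHS]integralE [RHS]integralE !ge0_integral_torus//.
- exact: measurable_funeneg.
- exact: measurable_funepos.
Qed.

End torus_integration.

Lemma continuous_pair_l {R : realType} {U W : normedModType R} (w : W) :
  continuous (fun u : U => (u, w)).
Proof.
move=> u A /nbhs_ballP[e /= e0 eA]; apply/nbhs_ballP; exists e => // u' bu.
by apply: eA; split => //; exact: ballxx.
Qed.

Lemma continuous_pair_r {R : realType} {U W : normedModType R} (u : U) :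
  continuous (fun w : W => (u, w)).
Proof.
move=> w A /nbhs_ballP[e /= e0 eA]; apply/nbhs_ballP; exists e => // w' bw.
by apply: eA; split => //; exact: ballxx.
Qed.

Section test_functions.
Context {R : realType} (d : nat).
Local Notation V := ('rV[R]_d * R)%type.
Implicit Types (phi psi : V -> R).

Lemma testP phi : test_xy phi <-> [/\ smooth phi, periodic_y phi &
  exists M, forall x y, M < `|x| -> phi (x, y) = 0].
Proof.
split => [[sp pp [K cK K0]]|[sp pp [M M0]]]; split => //.
  have [M [_ HM]] := compact_bounded cK.
  exists (M + 1) => x y Mx; apply: K0 => Kx.
  have M1 : M < M + 1 by rewrite ltrDl.
  by have /= := HM (M + 1) M1 x Kx; rewrite leNgt Mx.
exists [set x | `|x| <= M].
  exact: compact_norm_ball.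
by move=> x y /negP; rewrite -ltNge => /M0.
Qed.

Lemma periodic_int (S : Type) (f : V -> S) (k : int) x y : periodic_y f ->
  f (x, y + 2 * pi * k%:~R) = f (x, y).
Proof.
move=> pf; have pn n y' : f (x, y' + 2 * pi * n%:R) = f (x, y').
  elim: n y' => [|n IH] y'; first by rewrite mulr0 addr0.
  by rewrite -(natr1 n) mulrDr mulr1 addrA pf IH.
case: k => n; first by rewrite -pmulrn pn.
rewrite NegzE mulrNz mulrN -[in RHS](subrK (2 * pi * n.+1%:R) y).
by rewrite pn.
Qed.

Lemma test_smooth phi : test_xy phi -> smooth phi.
Proof. by case. Qed.

Lemma test_bounded phi : test_xy phi -> exists2 C, 0 <= C & forall z, `|phi z| <= C.
Proof.
move=> /testP[sp pp [M M0]].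
have cK : compact ([set x : 'rV[R]_d | `|x| <= M] `*` (`[0, 2 * pi]%classic : set R)).
  exact: (compact_setX (@compact_norm_ball R d M) (@segment_compact R 0 (2 * pi))).
have /compact_bounded[C [_ HC]] :
    compact (phi @` ([set x : 'rV[R]_d | `|x| <= M] `*` (`[0, 2 * pi]%classic : set R))).
  apply: continuous_compact => //; apply: continuous_subspaceT.
  exact: smooth_continuous sp.
exists (`|C| + 1); first by rewrite addr_ge0.
move=> [x y]; have [xM|/M0 ->] := leP `|x| M; last by rewrite normr0 addr_ge0.
have pi20 : (0 : R) < 2 * pi by rewrite mulr_gt0 ?pi_gt0.
pose k := Num.floor (y / (2 * pi)).
have := periodic_int (- k) x y pp; rewrite mulrNz mulrN => <-.
apply: HC; first by rewrite ltr_pwDr// ler_norm.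
exists (x, y - 2 * pi * k%:~R) => //; split => //=; rewrite in_itv /=.
rewrite subr_ge0 -ler_pdivlMl// mulrC floor_le /=.
rewrite lerBlDl -{2}[2 * pi]mulr1 -mulrDr -ler_pdivrMl// mulrC ltW//.
by rewrite -[X in _ + X]/(1%:~R) -intrD floorD1_gt.
Qed.

Lemma test_measurable phi : test_xy phi -> measurable_fun setT phi.
Proof.
by move=> /test_smooth/smooth_continuous; exact: continuous_measurable_xy.
Qed.

Lemma leb_xy_cyl (M : R) :
  (leb_xy d ([set x : 'rV[R]_d | (`|x| <= M)%R] `*` [set: R]) < +oo)%E.
Proof.
rewrite /leb_xy /= product_measure1E//; last exact: measurable_norm_ball.
rewrite /= torus_setT; apply: lte_mul_pinfty => //.
  rewrite ge0_fin_numE//; exact: lebesgue_rV_ball.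
by rewrite ltry.
Qed.

Lemma test_intg phi : test_xy phi -> intg (leb_xy d) phi.
Proof.
move=> tp; have [C C0 HC] := test_bounded tp; have mp := test_measurable tp.
move: tp => /testP[sp pp [M M0]].
apply: (intg_bounded_support mp _ (leb_xy_cyl M) HC).
  by apply: measurableX => //; exact: measurable_norm_ball.
by move=> [x y] /= /not_andP[/negP|//]; rewrite -ltNge => /M0.
Qed.

Lemma test_L2 phi : test_xy phi -> L2 (leb_xy d) phi.
Proof.
move=> tp; have [C C0 HC] := test_bounded tp.
by apply: (L2_of_bounded HC); exact: test_intg.
Qed.

Lemma periodic_derive phi (v : V) : periodic_y phi ->
  periodic_y (fun z => 'D_v phi z).
Proof.
move=> pp x y.
pose S (z : V) : V := (z.1, z.2 + 2 * pi).
have pS : phi \o S = phi by apply/funext => -[x' y'] /=; exact: pp.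
rewrite -[LHS](@derive_along R _ _ phi S (x, y) v v) ?pS//.
by move=> h; congr pair; rewrite /= addrA.
Qed.

Lemma test_derive phi (v : V) : test_xy phi -> test_xy (fun z => 'D_v phi z).
Proof.
move=> /testP[sp pp [M M0]]; apply/testP; split.
- exact: smooth_derive.
- exact: periodic_derive.
- exists M => x y xM.
  apply: (@derive_eq0 _ _ phi (fst @^-1` [set x : 'rV[R]_d | M < `|x|])) => //.
    apply: open_comp; last exact: open_norm_gt.
    by move=> z _; exact: cvg_fst.
  by move=> [x' y'] /= /M0.
Qed.

Lemma test_partial phi j : test_xy phi -> test_xy (partial_xy j phi).
Proof. exact: test_derive. Qed.

Lemma testM phi (a : V -> R) : smooth a -> periodic_y a -> test_xy phi ->
  test_xy (fun z => a z * phi z).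
Proof.
move=> sa pa /testP[sp pp [M M0]]; apply/testP; split.
- exact: smoothM.
- by move=> x y; rewrite pa pp.
- by exists M => x y xM; rewrite M0// mulr0.
Qed.

Lemma partialM (a : V -> R) phi j z : smooth a -> smooth phi ->
  partial_xy j (fun z => a z * phi z) z =
  a z * partial_xy j phi z + partial_xy j a z * phi z.
Proof.
move=> sa sp; rewrite /partial_xy deriveM; try exact: smooth_derivable.
by rewrite /= [phi z *: _]mulrC.
Qed.

Lemma smooth_slice_y (x : 'rV[R]_d) phi : smooth phi ->
  [/\ forall y, derivable (fun y => phi (x, y)) y 1,
      continuous (fun y => 'D_1 (fun y => phi (x, y)) y) &
      forall y, 'D_1 (fun y => phi (x, y)) y = partial_xy None phi (x, y)].
Proof.
move=> sp.
have HA y (h : R) : (x, h *: 1 + y) = h *: (0, 1) + (x, y) :> V.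
  by congr pair; rewrite /= ?scaler0 ?add0r.
have E y : 'D_1 (fun y => phi (x, y)) y = partial_xy None phi (x, y).
  exact: (@derive_along _ _ _ phi (fun y => (x, y)) y 1 (0, 1)).
split => //.
- move=> y; apply: (@derivable_along _ _ _ phi (fun y => (x, y)) y 1 (0, 1)) => //.
  exact: smooth_derivable.
- under eq_fun do rewrite E.
  move=> y; apply: (@continuous_comp _ _ _ (fun y => (x, y)) (partial_xy None phi)).
    exact: continuous_pair_r.
  exact: (smooth_continuous (smooth_derive _ sp)).
Qed.

(** There are no boundary terms: the support is compact in x, and in y the two
    ends of a period cancel. *)
Lemma integral_partial_xy phi j : test_xy phi ->
  \int[leb_xy d]_z partial_xy j phi z = 0.
Proof.
move=> tp; have tpj := test_partial j tp.
have pi20 : (0 : R) < 2 * pi by rewrite mulr_gt0 ?pi_gt0.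
have ip := test_intg tpj; have [_ pp [M M0]] := (testP phi).1 tp.
have sp := test_smooth tp.
rewrite /Rintegral -[RHS]/(fine 0%E); congr fine.
case: j tpj ip => [i|] tpj ip.
- rewrite -(@integral21_prod_meas1 _ _ _ _ R (lebesgue_rV d) torus_measure _ ip).
  apply: integral0_eq => y _; rewrite /fubini_G /=.
  have HA x (h : R) : (h *: delta_mx ord0 i + x, y) =
      h *: (delta_mx ord0 i, 0) + (x, y) :> V.
    by congr pair; rewrite /= ?scaler0 ?add0r.
  have E x : partial_xy (Some i) phi (x, y) =
      'D_(delta_mx ord0 i) (fun x => phi (x, y)) x.
    symmetry; exact: (@derive_along _ _ _ phi (fun x => (x, y)) x
      (delta_mx ord0 i) (delta_mx ord0 i, 0)).
  have cx : continuous (fun x : 'rV[R]_d => (x, y)).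
    exact: continuous_pair_l.
  under eq_integral => x _ do rewrite E.
  apply: (@integral_partial_rV _ _ _ _ M).
  + move=> x; apply: (@derivable_along _ _ _ phi (fun x => (x, y)) x
      (delta_mx ord0 i) (delta_mx ord0 i, 0)) => //.
    exact: smooth_derivable.
  + move=> x; apply: (@continuous_comp _ _ _ (fun x => (x, y)) phi).
      exact: cx.
    exact: (smooth_continuous sp).
  + under eq_fun do rewrite -E.
    move=> x; apply: (@continuous_comp _ _ _ (fun x => (x, y))
      (partial_xy (Some i) phi)); first exact: cx.
    exact: (smooth_continuous (smooth_derive _ sp)).
  + by move=> x /M0.
- rewrite -(@integral12_prod_meas1 _ _ _ _ R (lebesgue_rV d) torus_measure _ ip).
  apply: integral0_eq => x _; rewrite /fubini_F /=.
  have [dy cy E] := smooth_slice_y x sp.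
  under eq_integral => y _ do rewrite -E.
  rewrite integral_torus; last first.
    by apply/measurable_EFinP; exact: continuous_measurable_fun.
  rewrite integral_itv_bndo_bndc; last first.
    apply/measurable_EFinP; apply: measurable_funTS.
    exact: (continuous_measurable_fun cy).
  rewrite Rint_derive_itv//.
  by rewrite -{1}[2 * pi]add0r pp subrr.
Qed.

End test_functions.

(** * An integrable weight *)

Section product_weight.
Context {R : realType}.

Lemma ge0_integral_lebesgue_rVS d (f : 'rV[R]_d.+1 -> \bar R) :
  measurable_fun setT f -> (forall x, 0 <= f x)%E ->
  (\int[lebesgue_rV d.+1]_x f x =
   \int[lebesgue_measure \x lebesgue_rV d]_p f (cons_rV p))%E.
Proof.
move=> mf f0; have mc := @measurable_cons_rV R d.
pose nu := measure_function_pushforward__canonical__measure_function_Measure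
  (lebesgue_measure \x lebesgue_rV d)%E mc.
transitivity (\int[nu]_x f x)%E; first by apply: eq_measure_integral => A mA _.
exact: (ge0_integral_pushforward mc _ measurableT).
Qed.

Lemma measurable_prod_coord d (g : R -> R) : measurable_fun setT g ->
  measurable_fun setT (fun x : 'rV[R]_d => \prod_(i < d) g (x ord0 i)).
Proof.
move=> mg; elim: (index_enum _) => [|i s IH].
  by under eq_fun do rewrite big_nil; exact: measurable_cst.
under eq_fun do rewrite big_cons.
apply: measurable_funM => //.
exact: (measurableT_comp mg (measurable_coord i)).
Qed.

Lemma intg_prod_rV d (g : R -> R) : measurable_fun setT g -> (forall s, 0 <= g s) ->
  (\int[@lebesgue_measure R]_s (g s)%:E < +oo)%E ->
  (\int[lebesgue_rV d]_x (\prod_(i < d) g (x ord0 i))%:E < +oo)%E.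
Proof.
move=> mg g0 gi; elim: d => [|d IH].
  under eq_integral do rewrite big_ord0.
  by rewrite integral_cst// mul1e /= diracE; case: (_ \in _); rewrite ltry.
rewrite ge0_integral_lebesgue_rVS; last 2 first.
- apply/measurable_EFinP. exact: measurable_prod_coord.
- by move=> x; rewrite lee_fin prodr_ge0.
have E (p : measurableTypeR R * 'rV[R]_d) :
    \prod_(i < d.+1) g (cons_rV p ord0 i) = g p.1 * \prod_(i < d) g (p.2 ord0 i).
  rewrite big_ord_recl; congr (g _ * _).
    by rewrite /cons_rV mxE; case: splitP => // j _; rewrite mxE.
  apply: eq_bigr => i _; congr (g _); rewrite /cons_rV mxE.
  by case: splitP => k; [rewrite (ord1 k)|move=> /addnI/val_inj <-].
under eq_integral => p _ do rewrite E.
have mf : measurable_fun setT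
    (fun p : measurableTypeR R * 'rV[R]_d => g p.1 * \prod_(i < d) g (p.2 ord0 i)).
  apply: measurable_funM; first exact: (measurableT_comp mg measurable_fst).
  apply: (measurableT_comp (f := fun x : 'rV[R]_d => \prod_(i < d) g (x ord0 i))).
    exact: measurable_prod_coord.
  exact: measurable_snd.
rewrite (@fubini_tonelli1 _ _ _ _ R lebesgue_measure (lebesgue_rV d)); last 2 first.
- exact/measurable_EFinP.
- by move=> p; rewrite lee_fin mulr_ge0// prodr_ge0.
rewrite /fubini_F.
set C := (X in (X < _)%E) in IH.
have C0 : (0 <= C)%E by apply: integral_ge0 => x _; rewrite lee_fin prodr_ge0.
under eq_integral => s _.
  under eq_integral => x _ do rewrite /= EFinM.
  rewrite ge0_integralZl_EFin//; last 2 first.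
  - by move=> x _; rewrite lee_fin prodr_ge0.
  - by apply/measurable_EFinP; exact: measurable_prod_coord.
  over.
have Cfin : C \is a fin_num by rewrite ge0_fin_numE.
rewrite /= -/C -(fineK Cfin) ge0_integralZr//.
- have G0 : (0 <= \int[@lebesgue_measure R]_s (g s)%:E)%E.
    by apply: integral_ge0 => x _; rewrite lee_fin.
  by rewrite lte_mul_pinfty ?ge0_fin_numE// ltry.
- exact/measurable_EFinP.
- by move=> x _; rewrite lee_fin.
- by rewrite ?lee_fin fine_ge0.
Qed.

(** The Poisson-type profile 1/(1+(ts)^2): integrable, and its logarithmic
    derivative is at most t. *)
Definition profile (t s : R) : R := (1 + (t * s) ^+ 2)^-1.

Lemma profile_den_gt0 (t s : R) : 0 < 1 + (t * s) ^+ 2.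
Proof. by rewrite ltr_pwDl// sqr_ge0. Qed.

Lemma profile_gt0 (t s : R) : 0 < profile t s.
Proof. by rewrite invr_gt0 profile_den_gt0. Qed.

Lemma profile_le1 (t s : R) : profile t s <= 1.
Proof. by rewrite invf_le1 ?profile_den_gt0// lerDl sqr_ge0. Qed.

Lemma is_derive_profile (t s : R) :
  is_derive s 1 (profile t) (- (2 * t ^+ 2 * s) * profile t s ^+ 2).
Proof.
have d1 : is_derive s 1 (fun s : R => 1 + (t * s) ^+ 2) (2 * t ^+ 2 * s).
  have H : is_derive s 1 (fun s : R => t * s) t.
    apply: is_derive_eq (is_deriveZ t (is_derive_id s 1)) _.
    by rewrite -[_ *: _]/(t * 1) mulr1.
  have H2 := is_deriveD (is_derive_cst (1 : R) s 1) (is_deriveX 2 H).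
  apply: is_derive_eq H2 _; rewrite add0r -[_ *: _]/(_ * _) /=; ring.
have n0 : 1 + (t * s) ^+ 2 != 0 by rewrite gt_eqF// profile_den_gt0.
have H3 := @is_deriveV R (fun s : R => 1 + (t * s) ^+ 2) s _ _ n0 d1; apply: is_derive_eq H3 _.
by rewrite -[_ *: _]/(_ * _) /profile exprVn; ring.
Qed.

Lemma continuous_profile (t : R) : continuous (profile t).
Proof.
move=> s; apply/differentiable_continuous/derivable1_diffP.
by have [] := is_derive_profile t s.
Qed.

Lemma measurable_profile (t : R) : measurable_fun setT (profile t).
Proof. by apply: continuous_measurable_fun; exact: continuous_profile. Qed.

Lemma derive_profile_le (t s : R) : 0 <= t ->
  `|'D_1 (profile t) s| <= t * profile t s.
Proof.
move=> t0; rewrite (@derive_val _ _ _ _ _ _ _ (is_derive_profile t s)).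
rewrite [profile t s ^+ 2]expr2 mulrA normrM [X in _ * X]gtr0_norm ?profile_gt0//.
apply: ler_wpM2r; first exact/ltW/profile_gt0.
rewrite normrM normrN [X in _ * X]gtr0_norm ?profile_gt0//.
rewrite /profile ler_pdivrMr ?profile_den_gt0//.
have -> : `|2 * t ^+ 2 * s| = t * (2 * (t * `|s|)).
  by rewrite normrM ger0_norm ?mulr_ge0 ?sqr_ge0//; ring.
have : 0 <= (1 - t * `|s|) ^+ 2 by exact: sqr_ge0.
rewrite exprMn -[s ^+ 2]real_normK ?num_real// => H.
by rewrite ler_wpM2l//; nra.
Qed.

Lemma integral_profile (t : R) : 0 < t ->
  (\int[@lebesgue_measure R]_s (profile t s)%:E < +oo)%E.
Proof.
move=> t0; pose C : R := 1 + t ^- 2.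
have C0 : 0 < C by rewrite ltr_pwDl// invr_ge0 sqr_ge0.
have mp := measurable_profile; have cp := continuous_profile.
have mCp : measurable_fun setT (fun s : R => C * profile 1 s).
  by apply: measurable_funM => //; exact: mp.
(* For t = 1 the primitive is the arctangent. *)
have le1 s : profile t s <= C * profile 1 s.
  rewrite /profile mul1r ler_pdivlMr ?ltr_pwDl ?sqr_ge0//.
  rewrite mulrC ler_pdivrMr ?profile_den_gt0// /C exprMn.
  have tt : t ^+ 2 * t ^- 2 = 1 by rewrite mulfV// expf_neq0// gt_eqF.
  have : 0 <= t ^- 2 by rewrite invr_ge0 sqr_ge0.
  have : 0 <= t ^+ 2 by exact: sqr_ge0.
  have : 0 <= s ^+ 2 by exact: sqr_ge0.
  nra.
apply: (@le_lt_trans _ _ (\int[@lebesgue_measure R]_s (C * profile 1 s)%:E)%E).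
  apply: ge0_le_integral => //.
  - by move=> s _; rewrite lee_fin ltW// profile_gt0.
  - apply/measurable_EFinP. exact: mp.
  - by apply/measurable_EFinP; exact: mCp.
  - by move=> s _; rewrite lee_fin.
under eq_integral do rewrite EFinM.
rewrite ge0_integralZl_EFin//; last 3 first.
- by move=> s _; rewrite lee_fin ltW// profile_gt0.
- by apply/measurable_EFinP; exact: mp.
- exact: ltW.
rewrite ge0_symfun_integralT//.
- rewrite -set_itvcy.
  have E s : profile 1 s = (oneDsqr s)^-1 by rewrite /profile mul1r.
  under eq_integral => s _ do rewrite E.
  by rewrite integral0y_oneDsqr -!EFinM ltry.
- by move=> s; rewrite ltW// profile_gt0.
- by move=> s /=; rewrite /profile !mul1r sqrrN.
Qed.

End product_weight.

Section weight.
Context {R : realType} (d : nat).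
Local Notation V := ('rV[R]_d * R)%type.

(** A positive multiplier that makes square-integrable functions integrable, does
    not depend on y, and varies slowly for small t. *)
Definition weight (t : R) (z : V) : R := \prod_(i < d) profile t (z.1 ord0 i).

Lemma weight_gt0 t z : 0 < weight t z.
Proof. by apply: prodr_gt0 => i _; exact: profile_gt0. Qed.

Lemma weight_le1 t z : weight t z <= 1.
Proof.
suff /andP[] : 0 <= weight t z <= 1 by [].
rewrite /weight; elim/big_rec: _ => [|i x _ /andP[x0 x1]]; first by rewrite ler01 lexx.
have := profile_gt0 t (z.1 ord0 i); have := profile_le1 t (z.1 ord0 i) => p1 /ltW p0.
by rewrite mulr_ge0//= mulr_ile1.
Qed.

Lemma weight_norm t z : `|weight t z| <= 1.
Proof. by rewrite gtr0_norm ?weight_gt0// weight_le1. Qed.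

Lemma smooth_coord (i : 'I_d) : smooth (fun z : V => z.1 ord0 i).
Proof.
apply: (@smooth_affine _ _ _ (fun v : V => v.1 ord0 i)).
  move=> z; apply: (@continuous_comp _ _ _ fst (fun x : 'rV[R]_d => x ord0 i)).
    exact: cvg_fst.
  exact: coord_continuous.
by move=> x v t; rewrite /= !mxE.
Qed.

Lemma smooth_snd : smooth (fun z : V => z.2).
Proof.
apply: (@smooth_affine _ _ _ (fun v : V => v.2)) => //.
by move=> z; exact: cvg_snd.
Qed.

Lemma smooth_weight t : smooth (weight t).
Proof.
apply: smooth_prod => i; apply: smoothV.
  by move=> z; rewrite gt_eqF// profile_den_gt0.
apply: smoothD; first exact: smooth_cst.
have s1 : smooth (fun z : V => t * z.1 ord0 i).
  by apply: smoothM; [exact: smooth_cst|exact: smooth_coord].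
exact: smoothM.
Qed.

Lemma periodic_weight t : periodic_y (weight t).
Proof. by []. Qed.

Lemma measurable_weight t : measurable_fun setT (weight t).
Proof. exact: continuous_measurable_xy (smooth_continuous (smooth_weight t)). Qed.

Lemma partial_weight_y t z : partial_xy None (weight t) z = 0.
Proof.
rewrite /partial_xy -[z]add0r -[X in X + _](scale0r (direction None)).
rewrite -(@derive_along R R V (weight t) (fun h => h *: direction None + z) 0 1).
  rewrite (_ : _ \o _ = cst (weight t z)) ?derive_cst//.
  by apply/funext => h; rewrite /weight /= scaler0 add0r.
by move=> h; rewrite scale0r add0r addr0 [_ *: 1]mulr1.
Qed.

Lemma partial_weight_le t i z : 0 <= t ->
  `|partial_xy (Some i) (weight t) z| <= t * weight t z.
Proof.
move=> t0; pose c := \prod_(j < d | j != i) profile t (z.1 ord0 j).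
have c0 : 0 <= c by apply: prodr_ge0 => j _; exact/ltW/profile_gt0.
have wE : weight t z = profile t (z.1 ord0 i) * c by rewrite /weight (bigD1 i).
pose A (h : R) : V := (h - z.1 ord0 i) *: direction (Some i) + z.
have Az : A (z.1 ord0 i) = z by rewrite /A subrr scale0r add0r.
have AE h : weight t (A h) = c * profile t h.
  rewrite /weight (bigD1 i)//= mulrC; congr (_ * profile t _).
    apply: eq_bigr => j ji; congr (profile t _); rewrite !mxE eqxx/=.
    by rewrite (negbTE ji) mulr0 add0r.
  by rewrite !mxE !eqxx mulr1 subrK.
rewrite /partial_xy -Az.
rewrite -(@derive_along R R V (weight t) A (z.1 ord0 i) 1); last first.
  by move=> h; rewrite /A subrr scale0r add0r [_ *: 1]mulr1 addrK.
rewrite (_ : _ \o _ = fun h => c * profile t h); last exact/funext.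
have dp := is_derive_profile t (z.1 ord0 i).
have := is_deriveZ c dp.
move=> /(@derive_val _ _ _ _ _ _ _); rewrite -[_ *: _]/(c * _) => dE.
rewrite dE -(@derive_val _ _ _ _ _ _ _ dp).
rewrite Az wE normrM (ger0_norm c0) mulrA mulrC ler_wpM2r//.
exact: derive_profile_le.
Qed.

Lemma intg_weight t : 0 < t -> intg (leb_xy d) (weight t).
Proof.
move=> t0; apply/integrableP; split.
  apply/measurable_EFinP.  exact: measurable_weight.
under eq_integral => z _ do rewrite /= gtr0_norm ?weight_gt0//.
rewrite (@fubini_tonelli1 _ _ _ _ R (lebesgue_rV d) torus_measure); last 2 first.
- by apply/measurable_EFinP; exact: measurable_weight.
- by move=> z; rewrite lee_fin ltW// weight_gt0.
rewrite /fubini_F /weight /=.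
have mp := measurable_profile t.
under eq_integral => x _ do rewrite integral_cst//= torus_setT.
rewrite ge0_integralZr//.
- rewrite lte_mul_pinfty//.
  + by apply: integral_ge0 => x _; rewrite lee_fin prodr_ge0// => i _; exact/ltW/profile_gt0.
  + rewrite ge0_fin_numE; last first.
      by apply: integral_ge0 => x _; rewrite lee_fin prodr_ge0// => i _; exact/ltW/profile_gt0.
    apply: intg_prod_rV => //; last exact: integral_profile.
    by move=> s; exact/ltW/profile_gt0.
  + by rewrite ltry.
- by apply/measurable_EFinP; exact: measurable_prod_coord.
- by move=> x _; rewrite lee_fin prodr_ge0// => i _; exact/ltW/profile_gt0.
- by rewrite lee_fin mulr_ge0// pi_ge0.
Qed.

Lemma L2_weight t : 0 < t -> L2 (leb_xy d) (weight t).
Proof.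
by move=> t0; apply: (L2_of_bounded (weight_norm t)); exact: intg_weight.
Qed.

End weight.

(** * The fundamental lemma of the calculus of variations *)

Section box_tests.
Context {R : realType} (d : nat).
Local Notation V := ('rV[R]_d * R)%type.
Local Notation mu := (@leb_xy R d).
Implicit Types (psi : V -> R).

Lemma smooth_flat_step (f : V -> R) : smooth f -> smooth (fun z => flat_step (f z)).
Proof. exact: (smooth_comp 0 flat_towerP). Qed.

(** Dominated convergence, with |psi| as the dominating function. *)
Lemma Rint_weight_lim psi (a_ : nat -> V -> R) (a : V -> R) : intg mu psi ->
  (forall n, measurable_fun setT (a_ n)) -> (forall n x, `|a_ n x| <= 1) ->
  (forall x, a_ n x @[n --> \oo] --> a x) ->
  (forall n, \int[mu]_x (a_ n x * psi x) = 0) -> \int[mu]_x (a x * psi x) = 0.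
Proof.
move=> ip ma a1 acvg a0.
have mp := intg_measurable ip.
have maa : measurable_fun setT a.
  by apply: (measurable_fun_cvg ma) => x _; exact: acvg.
have ian n : intg mu (fun x => a_ n x * psi x) by exact: (intgM_bounded (ma n) (a1 n)).
pose f_ n x := (a_ n x * psi x)%:E; pose f x := (a x * psi x)%:E.
pose g x := `|psi x|%:E.
have mf_ n : measurable_fun setT (f_ n).
  by apply/measurable_EFinP; exact: intg_measurable (ian n).
have mf : measurable_fun setT f.
  by apply/measurable_EFinP; exact: measurable_funM.
have f_f : {ae mu, forall x, setT x -> f_ ^~ x @ \oo --> f x}.
  apply: aeW => x _; apply: cvg_EFin; first by apply: nearW.
  by apply: cvgMl; exact: acvg.
have ig : mu.-integrable setT g by exact: integrable_norm.
have f_g : {ae mu, forall x n, setT x -> `|f_ n x|%E <= g x}%E.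
  apply: aeW => x n _; rewrite /f_ /g /= lee_fin normrM -[leRHS]mul1r.
  exact: ler_wpM2r.
have [_ _] := dominated_convergence measurableT mf_ mf f_f ig f_g.
have -> : [sequence \int[mu]_x f_ n x]_n%E = (fun=> 0%E).
  by apply/funext => n /=; rewrite -(EFin_Rint (ian n)) a0.
move=> /cvg_lim => /(_ (@ereal_hausdorff _)).
by rewrite lim_cst// /Rintegral => <-.
Qed.

(** The products of a function of y and a function of x among the test
    functions. They suffice to determine an integrable function, and they allow
    an antiderivative in y. *)
Definition product_test : set (V -> R) := [set phi |
  exists (b : R -> R) (eta : 'rV[R]_d -> R),
    [/\ smooth (fun z : V => b z.2), forall y, b (y + 2 * pi) = b y,
        forall y, `|b y| <= 1,
        test_xy (fun z : V => eta z.1) & phi = (fun z => b z.2 * eta z.1)]].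

Lemma product_test_test phi : product_test phi -> test_xy phi.
Proof. by move=> [b [eta [sb pb _ te ->]]]; apply: testM => // x y; exact: pb. Qed.

Definition box (a b : 'I_d -> R) (al be : R) : set V :=
  [set z : V | (forall i, a i < z.1 ord0 i < b i) /\ al < z.2 < be].

(** On one period, sin((y-al)/2) sin((be-y)/2) is positive exactly between al
    and be, while as a function on the line it is periodic. *)
Definition arc_bump (al be y : R) : R := sin ((y - al) / 2) * sin ((be - y) / 2).

Definition box_bump (a b : 'I_d -> R) (x : 'rV[R]_d) : R :=
  \prod_(i < d) (flat_step (x ord0 i - a i) * flat_step (b i - x ord0 i)).

Lemma sin_smooth (f : V -> R) : smooth f -> smooth (fun z => sin (f z)).
Proof.
move=> sf.
have -> : (fun z => sin (f z)) = (cos_tower 0 \o (fun z => f z + - (pi / 2))).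
  apply/funext => z /=; rewrite cos_tower0 cosB cos_pihalf sin_pihalf; ring.
apply: (smooth_comp 0 (@cos_towerP R)); apply: smoothD => //; exact: smooth_cst.
Qed.

Lemma cos_smooth (f : V -> R) : smooth f -> smooth (fun z => cos (f z)).
Proof.
move=> sf.
have -> : (fun z => cos (f z)) = (cos_tower 0 \o f).
  by apply/funext => z /=; rewrite cos_tower0.
exact: (smooth_comp 0 (@cos_towerP R)).
Qed.

Lemma smoothZ (k : R) (f : V -> R) : smooth f -> smooth (fun z => k * f z).
Proof. by move=> sf; apply: smoothM => //; exact: smooth_cst. Qed.

Lemma smooth_arc_bump al be : smooth (fun z : V => arc_bump al be z.2).
Proof.
apply: smoothM; apply: sin_smooth.
  under eq_fun do rewrite mulrC; apply: smoothZ; apply: smoothD.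
    exact: smooth_snd.
  exact: smooth_cst.
under eq_fun do rewrite mulrC -[_ - _]addrC -mulN1r; apply: smoothZ; apply: smoothD.
  by apply: smoothZ; exact: smooth_snd.
exact: smooth_cst.
Qed.

Lemma periodic_arc_bump al be y : arc_bump al be (y + 2 * pi) = arc_bump al be y.
Proof.
rewrite /arc_bump.
have -> : (y + 2 * pi - al) / 2 = (y - al) / 2 + pi by field.
have -> : (be - (y + 2 * pi)) / 2 = (be - y) / 2 - pi by field.
by rewrite sinDpi sinB cospi sinpi; ring.
Qed.

Lemma test_box_bump (k : R) a b : test_xy (fun z : V => flat_step (k * box_bump a b z.1)).
Proof.
apply/testP; split.
- apply: smooth_flat_step; apply: smoothZ.
  apply: smooth_prod => i; apply: smoothM; apply: smooth_flat_step.
    by apply: smoothD; [exact: smooth_coord|exact: smooth_cst].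
  under eq_fun do rewrite addrC -mulN1r; apply: smoothD; last exact: smooth_cst.
  by apply: smoothZ; exact: smooth_coord.
- by [].
- exists (\sum_(i < d) (`|a i| + `|b i|)) => x y xM.
  have [i Hi] : exists i, `|a i| + `|b i| < `|x ord0 i|.
    apply: contrapT => /forallNP H; move: xM; apply/negP; rewrite -leNgt.
    rewrite [leLHS]/Num.Def.normr /= mx_normrE; apply: bigmax_le => /=.
      by apply: sumr_ge0 => i _; rewrite addr_ge0.
    move=> [i j] _ /=; rewrite (ord1 i) (bigD1 j)//=.
    have /negP := H j; rewrite -leNgt => /le_trans; apply.
    by rewrite lerDl; apply: sumr_ge0 => k' _; rewrite addr_ge0.
  rewrite /= [box_bump _ _ _](_ : _ = 0) ?mulr0 ?flat_step0//.
  rewrite /box_bump (bigD1 i)//=.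
  have [x0|x0] := leP 0 (x ord0 i).
    rewrite (@flat_step0 _ (b i - x ord0 i)) ?mulr0 ?mul0r// subr_le0.
    move: Hi; rewrite (ger0_norm x0) => Hi; apply: le_trans (ler_norm _) _.
    by apply: le_trans (ltW Hi); rewrite lerDr.
  rewrite (@flat_step0 _ (x ord0 i - a i)) ?mul0r// subr_le0.
  move: Hi; rewrite (ltr0_norm x0) => Hi.
  have := ler_norm (- a i); rewrite normrN; have := normr_ge0 (b i); lra.
Qed.

Lemma arc_bump_gt0 al be y : 0 <= al -> al < be -> be <= 2 * pi ->
  0 <= y < 2 * pi -> (0 < arc_bump al be y) = (al < y < be).
Proof.
move=> al0 ab be2 /andP[y0 y2]; rewrite /arc_bump.
have spos (s : R) : 0 < s < 2 * pi -> 0 < sin (s / 2).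
  by move=> /andP[s0 s2]; apply: sin_gt0_pi; lra.
have snpos (s : R) : - (2 * pi) <= s <= 0 -> sin (s / 2) <= 0.
  move=> /andP[s0 s2]; rewrite -[s]opprK mulNr sinN oppr_le0.
  by apply: sin_ge0_pi; lra.
have [aly|yal] := ltP al y; have [ybe|bey] := ltP y be => /=.
- by rewrite mulr_gt0// spos//; lra.
- apply/negbTE; rewrite -leNgt mulr_ge0_le0//.
    by apply/ltW/spos; lra.
  by apply: snpos; lra.
- apply/negbTE; rewrite -leNgt mulr_le0_ge0//.
    by apply: snpos; lra.
  have [->|yn] := eqVneq y 0; last first.
    apply/ltW/spos; have : 0 < y by rewrite lt_neqAle eq_sym yn.
    lra.
  by apply: sin_ge0_pi; lra.
- by exfalso; lra.
Qed.

Lemma box_bump_gt0 a b x : (0 < box_bump a b x) <-> forall i, a i < x ord0 i < b i.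
Proof.
split => [P0 i|H]; last first.
  by apply: prodr_gt0 => i _; have /andP[? ?] := H i;
    rewrite mulr_gt0// flat_step_gt0 subr_gt0.
apply: contraLR P0; rewrite negb_and -!leNgt /box_bump (bigD1 i)//=.
move=> /orP[h|h].
  by rewrite (@flat_step0 _ (x ord0 i - a i)) ?subr_le0// !mul0r.
by rewrite (@flat_step0 _ (b i - x ord0 i)) ?subr_le0// mulr0 mul0r.
Qed.

Lemma ae_period (P : V -> Prop) :
  (forall x y, 0 < y < 2 * pi -> P (x, y)) -> {ae mu, forall z, P z}.
Proof.
move=> HP; exists ([set: 'rV[R]_d] `*` (~` `]0, 2 * pi[%classic)).
have m0 : measurable (~` `]0 : R, 2 * pi[%classic).
  by apply: measurableC; exact: measurable_itv.
split.
- exact: measurableX.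
- rewrite /leb_xy /= product_measure1E//= /torus_measure.
  rewrite (_ : ~` _ `&` _ = [set 0]) ?lebesgue_measure_set1 ?mule0//.
  apply/seteqP; split => y /=; rewrite !in_itv /=; last first.
    by move=> ->; rewrite ltxx lexx mulr_gt0 ?pi_gt0.
  move=> [H /andP[y0 y2]]; apply/eqP; apply: contrapT => yn; apply: H.
  by rewrite y2 andbT lt_neqAle y0 andbT eq_sym; apply/negP.
- move=> [x y] /= nP; split => //; rewrite in_itv /= => y02.
  by apply: nP; exact: HP.
Qed.

Lemma measurable_box a b al be : measurable (box a b al be).
Proof.
rewrite (_ : box a b al be =
  [set x : 'rV[R]_d | forall i, `]a i, b i[%classic (x ord0 i)] `*` `]al, be[%classic).
  apply: measurableX; last exact: measurable_itv.
  apply: (@measurable_rV_box R d (fun i => `]a i, b i[%classic)) => i.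
  exact: measurable_itv.
by apply/seteqP; split => -[x y] /=; rewrite in_itv /= => -[H ?]; split => // i;
  have := H i; rewrite in_itv.
Qed.

Lemma boxI a b al be a' b' al' be' :
  box a b al be `&` box a' b' al' be' =
  box (fun i => Num.max (a i) (a' i)) (fun i => Num.min (b i) (b' i))
    (Num.max al al') (Num.min be be').
Proof.
apply/seteqP; split => -[x y] /=.
  move=> [[H1 /andP[h1 h2]] [H2 /andP[h3 h4]]]; split => [i|].
    have /andP[? ?] := H1 i; have /andP[? ?] := H2 i.
    by rewrite gt_max lt_min; apply/andP; split; apply/andP.
  by rewrite gt_max lt_min h1 h2 h3 h4.
rewrite /box /= gt_max lt_min => -[H /andP[/andP[? ?] /andP[? ?]]].
split; (split; last by apply/andP; split) => i; have := H i;
  by rewrite gt_max lt_min => /andP[/andP[? ?] /andP[? ?]]; apply/andP.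
Qed.

(** The bounded pointwise limits of product tests include the indicators of
    boxes, up to the null set y = 0. *)
Lemma Rint_box psi a b al be : intg mu psi ->
  (forall phi, product_test phi -> \int[mu]_z (psi z * phi z) = 0) ->
  \int[mu]_z (\1_(box a b al be) z * psi z) = 0.
Proof.
move=> ip H; have mp := intg_measurable ip.
pose al' := Num.max al 0; pose be' := Num.min be (2 * pi).
have mbox := measurable_box a b al be.
have m1 : measurable_fun setT (fun z => \1_(box a b al be) z * psi z).
  by apply: measurable_funM => //; exact: measurable_indic.
have boxE x y : 0 < y < 2 * pi ->
    box a b al be (x, y) <-> box a b al' be' (x, y).
  by move=> /andP[h1 h2]; rewrite /box /= /al' /be' gt_max lt_min h1 h2 !andbT.
have [ab|ba] := ltP al' be'; last first.
  rewrite -[RHS](@Rint_zero _ _ _ mu); apply: Rint_ae => //.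
  apply: ae_period => x y y02 _; rewrite indicE memNset ?mul0r//.
  by move=> /(boxE _ _ y02)[_ /andP[h1 h2]]; have := lt_trans h1 h2; rewrite ltNge ba.
pose bump (n : nat) (z : V) : R :=
  flat_step (n%:R * arc_bump al' be' z.2) * flat_step (n%:R * box_bump a b z.1).
have tb n : product_test (bump n).
  exists (fun y => flat_step (n%:R * arc_bump al' be' y)),
    (fun x => flat_step (n%:R * box_bump a b x)); split => //.
  - by apply: smooth_flat_step; apply: smoothZ; exact: smooth_arc_bump.
  - by move=> y; rewrite periodic_arc_bump.
  - by move=> y; rewrite ger0_norm ?flat_step_ge0// flat_step_le1.
  - exact: test_box_bump.
have mb n : measurable_fun setT (bump n).
  exact: test_measurable (product_test_test (tb n)).
pose lim (z : V) : R := (if 0 < arc_bump al' be' z.2 then 1 else 0) *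
  (if 0 < box_bump a b z.1 then 1 else 0).
have blim z : bump n z @[n --> \oo] --> lim z.
  by apply: cvgM; exact: cvg_flat_step.
rewrite -[RHS](Rint_weight_lim (a_ := bump) (a := lim) ip mb _ blim); last 2 first.
- move=> n z; rewrite ger0_norm ?mulr_ge0 ?flat_step_ge0//.
  by rewrite mulr_ile1 ?flat_step_ge0 ?flat_step_le1.
- by move=> n; rewrite -(H _ (tb n)); apply: eq_Rint => z; rewrite mulrC.
apply: Rint_ae => //.
  apply: measurable_funM => //.
  by apply: (measurable_fun_cvg mb) => z _; exact: blim.
apply: ae_period => x y y02 _; congr (_ * _).
rewrite /lim /= arc_bump_gt0 ?le_max ?ge_min ?lexx ?orbT//; last first.
  by move: y02 => /andP[/ltW -> ->].
rewrite indicE; case: ifPn => h1; last first.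
  rewrite mul0r memNset// => /(boxE _ _ y02)[_]; exact/negP.
rewrite mul1r; case: ifPn => [/box_bump_gt0 h2|h2].
  by rewrite mem_set//; apply/(boxE _ _ y02).
by rewrite memNset// => /(boxE _ _ y02)[/box_bump_gt0 h _]; rewrite h in h2.
Qed.

Definition boxes : set (set V) := [set A | exists a b al be, A = box a b al be].

(** The half-spaces bounded by a coordinate hyperplane are countable unions of
    boxes. *)
Lemma measurable_boxes (A : set V) : measurable A -> <<s boxes >> A.
Proof.
pose V' := g_sigma_algebraType boxes.
suff : measurable_fun [set: V'] (fun z : V' => (z : V)).
  by move=> mid mA; have := mid measurableT A mA; rewrite setTI.
have Hn (y : R) : exists n : nat, `|y| < n%:R.
  by exists (Num.truncn `|y|).+1; rewrite truncnS_gt.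
have mgen (f : V -> R) : (forall r, exists F : nat -> set V,
    (forall n, boxes (F n)) /\ [set z | r < f z] = \bigcup_n F n) ->
    measurable_fun [set: V'] (f : V' -> R).
  move=> Hf; apply: (measurability _ (RGenOInfty.measurableE R)) => // _ [_ [r ->] <-].
  rewrite setTI; have [F [bF FE]] := Hf r.
  rewrite (_ : _ @^-1` _ = \bigcup_n F n).
    by apply: (@bigcupT_measurable _ V') => n; exact: sub_sigma_algebra.
  by rewrite -FE; apply/seteqP; split => z /=; rewrite in_itv /= andbT.
apply/measurable_fun_pairP; split.
  apply: (@measurable_fun_coordP _ R d) => i; apply: mgen => r.
  exists (fun n => box (fun j => if j == i then r else - n%:R) (fun=> n%:R) (- n%:R) n%:R).
  split; first by move=> n; do 4 eexists.
  apply/seteqP; split => -[x y] /=; last first.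
    by move=> [n _ [/(_ i) + _]] /=; rewrite eqxx => /andP[].
  move=> rx; have [n Hn'] := Hn (`|x| + `|y|).
  rewrite ger0_norm ?addr_ge0// in Hn'.
  exists n => //; split => /= [j|].
    have := coord_le_norm x j => xj.
    have : `|x ord0 j| < n%:R by apply: le_lt_trans Hn'; rewrite ler_wpDr.
    by rewrite ltr_norml => /andP[h ->]; case: eqP => [->|//]; rewrite ?rx ?h.
  by rewrite -ltr_norml; apply: le_lt_trans Hn'; rewrite ler_wpDl.
apply: mgen => r.
exists (fun n => box (fun=> - n%:R) (fun=> n%:R) r n%:R).
split; first by move=> n; do 4 eexists.
apply/seteqP; split => -[x y] /=; last by move=> [n _ [_ /andP[]]].
move=> ry; have [n Hn'] := Hn (`|x| + `|y|).
rewrite ger0_norm ?addr_ge0// in Hn'.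
exists n => //; split => /= [j|].
  have := coord_le_norm x j => xj.
  rewrite -ltr_norml; apply: (le_lt_trans xj); apply: le_lt_trans Hn'.
  by rewrite lerDl.
rewrite ry /=; apply: le_lt_trans (ler_norm _) _.
by apply: le_lt_trans Hn'; rewrite lerDr.
Qed.

(** The fundamental lemma of the calculus of variations for integrable
    functions: boxes form a pi-system generating the Borel sets, and the sets on
    which psi has integral zero form a lambda-system. *)
Lemma fundamental_lemma_L1 psi : intg mu psi ->
  (forall phi, product_test phi -> \int[mu]_z (psi z * phi z) = 0) ->
  ae_eq mu setT psi (cst 0).
Proof.
move=> ip H; have mp := intg_measurable ip.
pose D := [set A : set V | measurable A /\ \int[mu]_z (\1_A z * psi z) = 0].
have m1 (A : set V) : measurable A -> measurable_fun setT (\1_A : V -> R).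
  exact: measurable_indic.
have b1 (A : set V) z : `|\1_A z : R| <= 1 by rewrite indicE; case: (_ \in _); rewrite ?normr1 ?normr0.
have i1 (A : set V) : measurable A -> intg mu (fun z => \1_A z * psi z).
  by move=> mA; apply: (intgM_bounded (m1 _ mA) (b1 A)).
have Dlim (F : nat -> set V) : nondecreasing_seq F ->
    (forall n, measurable (F n)) -> (forall n, \int[mu]_z (\1_(F n) z * psi z) = 0) ->
    \int[mu]_z (\1_(\bigcup_n F n) z * psi z) = 0.
  move=> ndF mF F0; apply: (Rint_weight_lim (a_ := fun n => \1_(F n))) => //.
  move=> z; apply: cvg_near_cst.
  have [[N _ FNz]|nF] := pselect ((\bigcup_n F n) z).
    exists N => // n /= Nn; rewrite !indicE !mem_set//; first by exists N.
    by move/subsetPset: (ndF _ _ Nn); apply.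
  by apply: nearW => n; rewrite !indicE !memNset// => Fz; apply: nF; exists n.
have GD : boxes `<=` D.
  move=> _ [a [b [al [be ->]]]]; split; first exact: measurable_box.
  exact: Rint_box.
have lD : lambda_system setT D.
  split => //.
  - split => //; pose F n : set V := box (fun=> - n%:R) (fun=> n%:R) (- n%:R) n%:R.
    have FT : \bigcup_n F n = setT.
      apply/seteqP; split => // -[x y] _.
      have Hn : `|x| + `|y| < (Num.truncn (`|x| + `|y|)).+1%:R by rewrite truncnS_gt.
      exists (Num.truncn (`|x| + `|y|)).+1 => //; split => /= [j|]; rewrite -ltr_norml.
        apply: (le_lt_trans (coord_le_norm x j)); apply: le_lt_trans Hn.
        by rewrite lerDl.
      by apply: le_lt_trans Hn; rewrite lerDr.
    rewrite -[X in \1_X]FT; apply: Dlim => [n m nm|n|n]; [|exact: measurable_box|exact: Rint_box].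
    have nm' : n%:R <= m%:R :> R by rewrite ler_nat.
    apply/subsetPset => -[x y] [/= h1 /andP[h2 h3]]; split => /= [j|].
      have /andP[? ?] := h1 j; lra.
    lra.
  - move=> A B BA [mA A0] [mB B0]; split; first exact: measurableD.
    have E z : \1_(A `\` B) z * psi z = \1_A z * psi z - \1_B z * psi z.
      rewrite -mulrBl; congr (_ * _); rewrite !indicE in_setD.
      case: (boolP (z \in B)) => zB; last by rewrite andbT subr0.
      by rewrite andbF mem_set ?subrr//; apply: BA; exact: set_mem.
    by under eq_Rint => z do rewrite E; rewrite RintB ?A0 ?B0 ?subrr//; exact: i1.
  - move=> F ndF FD; split; first by apply: bigcupT_measurable => n; have [] := FD n.
    by apply: Dlim => // n; have [] := FD n.
have IG : setI_closed boxes.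
  move=> _ _ [a [b [al [be ->]]]] [a' [b' [al' [be' ->]]]].
  by rewrite boxI; do 4 eexists.
have sub := lambda_system_subset IG lD GD (fun _ _ => @subsetT _ _).
have : ae_eq mu setT (EFin \o psi) (cst 0%E).
  apply: integral_ae_eq => // E _ mE.
  have [_ E0] := sub _ (measurable_boxes mE).
  rewrite integral0 integral_mkcond.
  transitivity (\int[mu]_z (\1_E z * psi z)%:E)%E.
    apply: eq_integral => z _; rewrite patchE indicE.
    by case: (z \in E); rewrite ?mul1r ?mul0r.
  by rewrite -(EFin_Rint (i1 _ mE)) E0.
by apply: filterS => x fx Dx; have /eqP := fx Dx; rewrite eqe => /eqP.
Qed.

(** The weight reduces the square-integrable case to the integrable one, because
    it is positive and maps test functions to test functions. *)
Lemma fundamental_lemma psi : L2 mu psi ->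
  (forall phi, test_xy phi -> \int[mu]_z (psi z * phi z) = 0) ->
  ae_eq mu setT psi (cst 0).
Proof.
move=> lp H; have l1 := L2_weight d (@ltr01 R).
have iw : intg mu (fun z => psi z * weight 1 z) by exact: L2_mul.
have := fundamental_lemma_L1 iw _.
have Hw phi : test_xy phi -> \int[mu]_z (psi z * weight 1 z * phi z) = 0.
  move=> tp; rewrite -[RHS](H (fun z => weight 1 z * phi z)).
    by apply: eq_Rint => z; rewrite mulrA.
  by apply: testM => //; exact: smooth_weight.
move=> /(_ (fun phi tp => Hw phi (product_test_test tp))); apply: filterS => z Hz Dz; have /eqP := Hz Dz.
by rewrite mulf_eq0 (gt_eqF (weight_gt0 _ _)) orbF => /eqP.
Qed.

End box_tests.

(** * Weak gradients *)

Section real_gradient.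
Context {R : realType} (d : nat).
Local Notation V := ('rV[R]_d * R)%type.
Local Notation mu := (@leb_xy R d).
Local Notation wd := (is_weak_deriv mu (@test_xy R d) (@partial_xy R d)).
Implicit Types (f g a : V -> R) (G : option 'I_d -> V -> R).

(** Elements of H^1 together with one explicit choice of their weak derivatives. *)
Definition has_gradient f G : Prop :=
  L2 mu f /\ forall j, L2 mu (G j) /\ wd j f (G j).

(** The weak derivatives in the functionals are selected by a choice operator;
    uniqueness lets any explicit weak derivative stand for the selected one. *)
Lemma weak_deriv_unique j f g h : L2 mu g -> L2 mu h -> wd j f g -> wd j f h ->
  ae_eq mu setT g h.
Proof.
move=> lg lh dg dh.
have : ae_eq mu setT (fun z => g z - h z) (cst 0).
  apply: fundamental_lemma; first exact: L2B.
  move=> phi tp; have lp := test_L2 tp.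
  under eq_Rint => z do rewrite mulrBl.
  rewrite RintB; [|exact: L2_mul|exact: L2_mul].
  by apply/eqP; rewrite subr_eq0 -eqr_opp -dg// -dh.
by apply: filterS => z Hz Dz; apply/eqP; rewrite -subr_eq0; apply/eqP/Hz.
Qed.

Lemma has_gradientD f f' G G' : has_gradient f G -> has_gradient f' G' ->
  has_gradient (fun z => f z + f' z) (fun j z => G j z + G' j z).
Proof.
move=> [lf df] [lf' df']; split=> [|j]; first exact: L2D.
have [lg wg] := df j; have [lg' wg'] := df' j.
split; first exact: L2D.
move=> phi tp; have lp := test_L2 tp; have lp' := test_L2 (test_partial j tp).
under eq_Rint => z do rewrite mulrDl.
under [in RHS]eq_Rint => z do rewrite mulrDl.
rewrite !RintD ?wg ?wg'// ?opprD//; exact: L2_mul.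
Qed.

(** Leibniz rule against a smooth multiplier, obtained by moving the multiplier
    onto the test function. *)
Lemma has_gradientM (C : R) f G a : smooth a -> periodic_y a ->
  (forall z, `|a z| <= C) -> (forall j z, `|partial_xy j a z| <= C) ->
  has_gradient f G ->
  has_gradient (fun z => a z * f z) (fun j z => a z * G j z + partial_xy j a z * f z).
Proof.
move=> sa pa aC aC' [lf df].
have ma : measurable_fun setT a.
  exact: continuous_measurable_xy (smooth_continuous sa).
have ma' j : measurable_fun setT (partial_xy j a).
  exact: continuous_measurable_xy (smooth_continuous (smooth_derive _ sa)).
split=> [|j]; first exact: (L2M_bounded ma aC lf).
have [lg wg] := df j.
have l1 := L2M_bounded ma aC lg; have l2 := L2M_bounded (ma' j) (aC' j) lf.
split; first exact: L2D.
move=> phi tp; have tap := testM sa pa tp.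
have lp := test_L2 tp; have lp' := test_L2 (test_partial j tp).
have := wg _ tap.
under eq_Rint => z do rewrite (partialM j z sa (test_smooth tp)) mulrDr.
rewrite RintD; last 2 first.
- by apply: L2_mul => //; apply: (L2M_bounded ma aC lp').
- by apply: L2_mul => //; apply: (L2M_bounded (ma' j) (aC' j) lp).
move=> E.
under [in RHS]eq_Rint => z do rewrite mulrDl.
rewrite RintD; [|exact: L2_mul|exact: L2_mul].
rewrite opprD.
have -> : \int[mu]_z (a z * G j z * phi z) = \int[mu]_z (G j z * (a z * phi z)).
  by apply: eq_Rint => z; rewrite mulrCA mulrA.
rewrite -E.
have -> : \int[mu]_z (a z * f z * partial_xy j phi z) =
    \int[mu]_z (f z * (a z * partial_xy j phi z)).
  by apply: eq_Rint => z; rewrite mulrCA mulrA.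
have -> : \int[mu]_z (partial_xy j a z * f z * phi z) =
    \int[mu]_z (f z * (partial_xy j a z * phi z)).
  by apply: eq_Rint => z; rewrite mulrCA mulrA.
by rewrite addrK.
Qed.

Lemma L2_partial_weight t j : 0 < t -> L2 mu (partial_xy j (weight t)).
Proof.
move=> t0; apply: (@L2_le _ _ _ _ _ (fun z => t * weight t z)).
- apply: continuous_measurable_xy.
  exact: (smooth_continuous (smooth_derive _ (smooth_weight d t))).
- move=> z; rewrite [leRHS]ger0_norm; last first.
    by rewrite mulr_ge0 ?ltW// weight_gt0.
  case: j => [i|]; first exact/partial_weight_le/ltW.
  by rewrite partial_weight_y normr0 mulr_ge0 ?ltW// weight_gt0.
- exact/L2Z/L2_weight.
Qed.

Lemma has_gradient_weight t : 0 < t ->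
  has_gradient (weight t) (fun j => partial_xy j (weight t)).
Proof.
move=> t0; have lw := L2_weight d t0; split=> // j.
have lw' := L2_partial_weight j t0; split => // phi tp.
have sw := smooth_weight d t.
have tap := testM sw (@periodic_weight _ _ t) tp.
have lp := test_L2 tp; have lp' := test_L2 (test_partial j tp).
apply/eqP; rewrite -addr_eq0 -RintD; [|exact: L2_mul|exact: L2_mul].
rewrite -[X in _ == X](integral_partial_xy j tap); apply/eqP/eq_Rint => z.
by rewrite (partialM j z sw (test_smooth tp)).
Qed.

Lemma has_gradient_H1 f G : has_gradient f G -> H1_real mu (@test_xy R d) (@partial_xy R d) f.
Proof.
move=> [lf df]; split; first exact/Lfun2P.
by move=> j; have [lg wg] := df j; exists (G j) => //; exact/Lfun2P.
Qed.

Lemma has_gradient_weak_deriv f : H1_real mu (@test_xy R d) (@partial_xy R d) f ->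
  has_gradient f (fun j => weak_deriv mu (@test_xy R d) (@partial_xy R d) j f).
Proof.
move=> [/Lfun2P lf df]; split => // j.
have [g lg wg] := df j; rewrite /weak_deriv.
have := @xgetPex _ (cst 0) [set g | g \in Lfun mu 2%:E /\ wd j f g].
case; first by exists g.
by move=> /Lfun2P.
Qed.

Lemma weak_deriv_ae f G j : has_gradient f G ->
  L2 mu (weak_deriv mu (@test_xy R d) (@partial_xy R d) j f) /\
  ae_eq mu setT (weak_deriv mu (@test_xy R d) (@partial_xy R d) j f) (G j).
Proof.
move=> gf; have [_ /(_ j)[l1 w1]] := has_gradient_weak_deriv (has_gradient_H1 gf).
have [_ /(_ j)[l2 w2]] := gf.
by split => //; exact: (weak_deriv_unique l1 l2 w1 w2).
Qed.

End real_gradient.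

(** * The functionals of a complex field *)

Section fields.
Context {R : realType} (d : nat).
Local Notation V := ('rV[R]_d * R)%type.
Local Notation mu := (@leb_xy R d).
Implicit Types (u v a : V -> R[i]) (du dv da : option 'I_d -> V -> R[i]).

(** The squared modulus, as a polynomial. *)
Definition sq (w : R[i]) : R := complex.Re w ^+ 2 + complex.Im w ^+ 2.

(** The inner product of the real plane C. *)
Definition dotC (w w' : R[i]) : R :=
  complex.Re w * complex.Re w' + complex.Im w * complex.Im w'.

Lemma sq_ge0 w : 0 <= sq w.
Proof. by rewrite addr_ge0 ?sqr_ge0. Qed.

Lemma sqM w w' : sq (w * w') = sq w * sq w'.
Proof. by case: w => a b; case: w' => c e; rewrite /sq /=; ring. Qed.

Lemma sqD w w' : sq (w + w') = sq w + 2 * dotC w w' + sq w'.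
Proof. by case: w => a b; case: w' => c e; rewrite /sq /dotC /=; ring. Qed.

Lemma sqB w w' : sq (w - w') = sq w - 2 * dotC w w' + sq w'.
Proof. by case: w => a b; case: w' => c e; rewrite /sq /dotC /=; ring. Qed.

Definition field_gradient u du : Prop :=
  [/\ periodic_y u,
   has_gradient (fun z => complex.Re (u z)) (fun j z => complex.Re (du j z)) &
   has_gradient (fun z => complex.Im (u z)) (fun j z => complex.Im (du j z))].

Definition L2C u : Prop :=
  L2 mu (fun z => complex.Re (u z)) /\ L2 mu (fun z => complex.Im (u z)).

Lemma field_gradient_L2C u du : field_gradient u du -> L2C u.
Proof. by move=> [_ [? _] [? _]]. Qed.

Lemma field_gradient_dL2C u du j : field_gradient u du -> L2C (du j).
Proof. by move=> [_ [_ /(_ j)[? _]] [_ /(_ j)[? _]]]. Qed.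

Lemma intg_sq u : L2C u -> intg mu (fun z => sq (u z)).
Proof. by move=> [[_ ?] [_ ?]]; exact: intgD. Qed.

Lemma intg_dotC u v : L2C u -> L2C v -> intg mu (fun z => dotC (u z) (v z)).
Proof. by move=> [? ?] [? ?]; apply: intgD; exact: L2_mul. Qed.

Lemma measurable_sq u : L2C u -> measurable_fun setT (fun z => sq (u z)).
Proof. by move=> /intg_sq; exact: intg_measurable. Qed.

Lemma field_gradientD u v du dv : field_gradient u du -> field_gradient v dv ->
  field_gradient (fun z => u z + v z) (fun j z => du j z + dv j z).
Proof.
move=> [pu ru iu] [pv rv iv]; split.
- by move=> x y; rewrite pu pv.
- have := has_gradientD ru rv; congr has_gradient.
    by apply/funext => z; case: (u z) => ? ?; case: (v z).
  by apply/funext => j; apply/funext => z; case: (du j z) => ? ?; case: (dv j z).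
- have := has_gradientD iu iv; congr has_gradient.
    by apply/funext => z; case: (u z) => ? ?; case: (v z).
  by apply/funext => j; apply/funext => z; case: (du j z) => ? ?; case: (dv j z).
Qed.

Lemma field_gradientM (C : R) (a1 a2 : V -> R) u du :
  smooth a1 -> smooth a2 -> periodic_y a1 -> periodic_y a2 ->
  (forall z, `|a1 z| <= C) -> (forall z, `|a2 z| <= C) ->
  (forall j z, `|partial_xy j a1 z| <= C) -> (forall j z, `|partial_xy j a2 z| <= C) ->
  field_gradient u du ->
  field_gradient (fun z => (a1 z +i* a2 z)%C * u z)
    (fun j z => (a1 z +i* a2 z)%C * du j z +
      (partial_xy j a1 z +i* partial_xy j a2 z)%C * u z).
Proof.
move=> s1 s2 p1 p2 b1 b2 b1' b2' [pu ru iu].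
have N (f : V -> R) (G : option 'I_d -> V -> R) : has_gradient f G ->
    has_gradient (fun z => -1 * f z) (fun j z => -1 * G j z).
  move=> h; have := @has_gradientM R d 1 f G (fun=> -1) (smooth_cst _) _ _ _ h.
  have D0 j z : partial_xy j (fun=> -1 : R) z = 0 by exact: derive_cst.
  have -> : (fun j z => -1 * G j z + partial_xy j (fun=> -1) z * f z) =
      (fun j z => -1 * G j z).
    by apply/funext => j; apply/funext => z; rewrite D0 mul0r addr0.
  apply => //.
  - by move=> z; rewrite normrN normr1.
  - by move=> j z; rewrite D0 normr0.
split.
- by move=> x y; rewrite p1 p2 pu.
- have := has_gradientD (has_gradientM s1 p1 b1 b1' ru)
    (N _ _ (has_gradientM s2 p2 b2 b2' iu)).
  congr has_gradient.
    by apply/funext => z; case: (u z) => ? ? /=; ring.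
  apply/funext => j; apply/funext => z.
  by case: (u z) => ? ?; case: (du j z) => ? ? /=; ring.
- have := has_gradientD (has_gradientM s1 p1 b1 b1' iu) (has_gradientM s2 p2 b2 b2' ru).
  congr has_gradient.
    by apply/funext => z; case: (u z) => ? ? /=; ring.
  apply/funext => j; apply/funext => z.
  by case: (u z) => ? ?; case: (du j z) => ? ? /=; ring.
Qed.

Lemma field_gradientZ (c : R[i]) u du : field_gradient u du ->
  field_gradient (fun z => c * u z) (fun j z => c * du j z).
Proof.
case: c => c1 c2 fu.
have D0 (c : R) j z : partial_xy j (fun=> c) z = 0 :> R by exact: derive_cst.
have := @field_gradientM (`|c1| + `|c2|) (fun=> c1) (fun=> c2) u du
  (smooth_cst _) (smooth_cst _) _ _ _ _ _ _ fu.
rewrite (_ : (fun j z => _ + _) = (fun j z => (c1 +i* c2)%C * du j z)).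
  apply => //.
  - by move=> z; rewrite lerDl.
  - by move=> z; rewrite lerDr.
  - by move=> j z; rewrite D0 normr0 addr_ge0.
  - by move=> j z; rewrite D0 normr0 addr_ge0.
apply/funext => j; apply/funext => z; rewrite !D0.
by rewrite -[(0 +i* 0)%C]/(0 : R[i]) mul0r addr0.
Qed.

Definition Mass u : R := \int[mu]_z sq (u z).
Definition KinX du : R := \int[mu]_z (\sum_(i < d) sq (du (Some i) z)).
Definition KinY du : R := \int[mu]_z sq (du None z).
(** The integral of |u|^(2q). *)
Definition Pot (q : R) u : R := \int[mu]_z (sq (u z) `^ q).
Definition Pot_finite (q : R) u : Prop := intg mu (fun z => sq (u z) `^ q).

Lemma intg_kinX u du : field_gradient u du ->
  intg mu (fun z => \sum_(i < d) sq (du (Some i) z)).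
Proof.
by move=> fu; apply: intg_sum => i; apply: intg_sq; exact: field_gradient_dL2C fu.
Qed.

Lemma modulus_sqr u z : modulus u z ^+ 2 = sq (u z).
Proof.
rewrite /modulus /ComplexField.Normc.normc; case: (u z) => a b.
by rewrite sqr_sqrtr// addr_ge0 ?sqr_ge0.
Qed.

Lemma modulus_powR u z (p : R) : modulus u z `^ p = sq (u z) `^ (p / 2).
Proof.
rewrite /modulus /ComplexField.Normc.normc /sq; case: (u z) => a b /=.
by rewrite -powR12_sqrt ?addr_ge0 ?sqr_ge0// -powRrM mulrC.
Qed.

Lemma modulus_ge0 u z : 0 <= modulus u z.
Proof. by rewrite /modulus /ComplexField.Normc.normc; case: (u z) => ? ?; exact: sqrtr_ge0. Qed.

Lemma mass_Mass u : L2C u -> mass u = (Mass u)%:E.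
Proof.
move=> lu; rewrite /mass /norm_xy Lnorm2_sqr (EFin_Rint (intg_sq lu)).
by apply: eq_integral => z _; rewrite modulus_sqr.
Qed.

Lemma norm_powR (p : R) u : 0 < p ->
  (norm_xy p (modulus u) `^ p = \int[mu]_z (sq (u z) `^ (p / 2))%:E)%E.
Proof.
move=> p0; rewrite /norm_xy (@poweR_Lnorm _ _ _ mu (EFin \o modulus u) p (lt0r_neq0 p0)).
apply: eq_integral => z _ /=.
by rewrite ger0_norm ?modulus_ge0// modulus_powR.
Qed.

Lemma weak_dxy_ae u du j : field_gradient u du ->
  L2C (weak_dxy j u) /\ ae_eq mu setT (fun z => sq (weak_dxy j u z)) (fun z => sq (du j z)).
Proof.
move=> [_ ru iu].
have [l1 e1] := weak_deriv_ae j ru; have [l2 e2] := weak_deriv_ae j iu.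
split; first exact: (conj l1 l2).
apply: filterS2 e1 e2 => z h1 h2 Dz; rewrite /sq /weak_dxy /weak_derivC /=.
by rewrite h1// h2.
Qed.

Lemma grad_x_norm u du : field_gradient u du ->
  (norm_xy 2 (grad_x u) ^+ 2 = (KinX du)%:E)%E.
Proof.
move=> fu; rewrite /norm_xy Lnorm2_sqr (EFin_Rint (intg_kinX fu)).
have E z : grad_x u z ^+ 2 = \sum_(i < d) sq (weak_dxy (Some i) u z).
  rewrite /grad_x sqr_sqrtr; last by apply: sumr_ge0 => i _; exact: sqr_ge0.
  by apply: eq_bigr => i _; rewrite modulus_sqr.
under eq_integral do rewrite E.
have H i := weak_dxy_ae (Some i) fu.
apply: ae_eq_integral => //.
- apply/measurable_EFinP/intg_measurable/intg_sum => i; exact/intg_sq/(H i).1.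
- by apply/measurable_EFinP; exact: intg_measurable (intg_kinX fu).
- have : {ae mu, forall z i, sq (weak_dxy (Some i) u z) = sq (du (Some i) z)}.
    apply: filter_forall => i; have [_] := H i.
    by apply: filterS => z Hz; exact: Hz.
  by apply: filterS => z Hz Dz; congr (_%:E); apply: eq_bigr => i _.
Qed.

Lemma big_option (F : option 'I_d -> R) :
  \sum_(j : option 'I_d) F j = F None + \sum_(i < d) F (Some i).
Proof.
rewrite (bigD1 None)//=; congr (_ + _).
rewrite (reindex_omap Some id) => [|[i|]]//=.
by apply: eq_bigl => i; rewrite eqxx.
Qed.

Lemma grad_xy_norm u du : field_gradient u du ->
  (norm_xy 2 (grad_xy u) ^+ 2 = (KinY du + KinX du)%:E)%E.
Proof.
move=> fu; have i1 := intg_kinX fu.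
have i0 := intg_sq (field_gradient_dL2C None fu).
rewrite /norm_xy Lnorm2_sqr -RintD// (EFin_Rint (intgD i0 i1)).
(* From here on only the almost everywhere values of the weak derivatives matter. *)
have [W HW] : exists W, forall j, weak_dxy j u = W j.
  by exists (fun j => weak_dxy j u).
have H i : L2C (W i) /\
    ae_eq mu setT (fun z => sq (W i z)) (fun z => sq (du i z)).
  by rewrite -HW; exact: weak_dxy_ae.
have E z : grad_xy u z ^+ 2 = sq (W None z) + \sum_(i < d) sq (W (Some i) z).
  rewrite /grad_xy sqr_sqrtr; last by apply: sumr_ge0 => i _; exact: sqr_ge0.
  rewrite (eq_bigr (fun j => sq (W j z))) ?big_option//.
  by move=> j _; rewrite modulus_sqr HW.
under eq_integral do rewrite E.
apply: ae_eq_integral => //.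
- apply/measurable_EFinP/intg_measurable/intgD; first exact/intg_sq/(H None).1.
  by apply/intg_sum => i; exact/intg_sq/(H (Some i)).1.
- by apply/measurable_EFinP; exact: intg_measurable (intgD i0 i1).
- have : {ae mu, forall z i, sq (W i z) = sq (du i z)}.
    apply: filter_forall => i; have [_] := H i.
    by apply: filterS => z Hz; exact: Hz.
  apply: filterS => z Hz Dz.
  rewrite (Hz None) (eq_bigr (fun i => sq (du (Some i) z)))// => i _.
Qed.

End fields.

Section critical_functionals.
Context {R : realType} (d : nat) (d_gt0 : (0 < d)%N).
Local Notation V := ('rV[R]_d * R)%type.
Local Notation mu := (@leb_xy R d).
Implicit Types (u : V -> R[i]) (du : option 'I_d -> V -> R[i]).

Let al : R := 4 / d%:R.
(** Half of alpha + 2 at alpha = 4/d. *)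
Definition crit_q : R := 1 + 2 / d%:R.
(** The coefficient alpha d / (2 (alpha + 2)) of the virial at alpha = 4/d. *)
Definition crit_kappa : R := crit_q^-1.

Let dR : 0 < d%:R :> R. Proof. by rewrite ltr0n. Qed.
Let dR0 : d%:R != 0 :> R. Proof. by rewrite gt_eqF. Qed.

Lemma crit_q_gt1 : 1 < crit_q.
Proof. by rewrite ltrDl divr_gt0. Qed.

Lemma crit_kappa_gt0 : 0 < crit_kappa.
Proof. by rewrite invr_gt0 (lt_trans _ crit_q_gt1). Qed.

Let al2 : (al + 2) / 2 = crit_q.
Proof. by rewrite /al /crit_q; field. Qed.

Let al20 : 0 < al + 2.
Proof. by rewrite addr_gt0// divr_gt0. Qed.

Let kapE : al * d%:R / (2 * (al + 2)) = crit_kappa.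
Proof.
rewrite /crit_kappa -al2 invf_div {1}/al divfK//.
have := al20; move: (al + 2) => a a0; have an0 : a != 0 by rewrite gt_eqF.
by field.
Qed.

Lemma energy_field u du : field_gradient u du -> Pot_finite crit_q u ->
  energy al u = (2^-1 * (KinY du + KinX du) - 2^-1 * crit_kappa * Pot crit_q u)%:E.
Proof.
move=> fu pu; rewrite /energy (grad_xy_norm fu) norm_powR// al2 -(EFin_Rint pu).
rewrite -!EFinM -EFinB; congr (_ - _ * _)%:E.
by rewrite /crit_kappa -al2 invf_div mulrA mulVf// mul1r.
Qed.

Lemma virial_field u du : field_gradient u du -> Pot_finite crit_q u ->
  virial al u = (KinX du - crit_kappa * Pot crit_q u)%:E.
Proof.
move=> fu pu; rewrite /virial (grad_x_norm fu) norm_powR// al2 -(EFin_Rint pu).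
by rewrite kapE -EFinM -EFinB.
Qed.

(** At the mass-critical power the energy of a state of zero virial is half its
    transverse kinetic energy. *)
Lemma m_c_le u du c : field_gradient u du -> Pot_finite crit_q u -> Mass u = c ->
  KinX du = crit_kappa * Pot crit_q u -> (m_c d al c <= (KinY du / 2)%:E)%E.
Proof.
move=> fu pu Mu Ku; apply: ereal_inf_lbound; exists u; last first.
  rewrite (energy_field fu pu); congr (_%:E); rewrite Ku; lra.
split.
- have [py ru iu] := fu; split => //.
  by split; [exact: has_gradient_H1 ru|exact: has_gradient_H1 iu].
- by rewrite (mass_Mass (field_gradient_L2C fu)) Mu.
- by rewrite (virial_field fu pu) Ku subrr.
Qed.

(** The vanishing of the virial forces the potential energy of a competitor to
    be finite. *)
Lemma m_c_lt c (x : R) : (m_c d al c < x%:E)%E ->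
  exists u du, [/\ field_gradient u du, Pot_finite crit_q u, Mass u = c,
    KinX du = crit_kappa * Pot crit_q u & KinY du < 2 * x].
Proof.
move=> /ereal_inf_lt[_ [u [[py [ru iu]] Mu Vu] <-]] Eu.
have fu : field_gradient u (fun j => weak_dxy j u).
  by split => //; exact: has_gradient_weak_deriv.
have lu := field_gradient_L2C fu.
have pu : Pot_finite crit_q u.
  apply/integrableP; split.
    apply/measurable_EFinP.
    exact: (measurableT_comp (measurable_powR crit_q) (measurable_sq lu)).
  under eq_integral => z _ do rewrite /= ger0_norm ?powR_ge0//.
  move: Vu; rewrite /virial (grad_x_norm fu) norm_powR// al2 kapE.
  have : (0 <= \int[mu]_z (sq (u z) `^ crit_q)%:E)%E.
    by apply: integral_ge0 => z _; rewrite lee_fin powR_ge0.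
  case: (\int[mu]_z (sq (u z) `^ crit_q)%:E)%E => [r _ _|_|//]; first by rewrite ltry.
  by rewrite gt0_muley// lte_fin crit_kappa_gt0.
exists u, (fun j => weak_dxy j u); split => //.
- by move: Mu; rewrite (mass_Mass lu) => -[].
- by move: Vu; rewrite (virial_field fu pu) => -[/eqP]; rewrite subr_eq0 => /eqP.
- move: Vu Eu; rewrite (virial_field fu pu) (energy_field fu pu) lte_fin => -[/eqP].
  rewrite subr_eq0 => /eqP ->; lra.
Qed.

End critical_functionals.

(** * Convexity of powers *)

Section strict_convexity.
Context {R : realType}.

(** From ln r >= 1 - 1/r at r = sqrt s. The square root on the left turns strict
    convexity of the power q into strict concavity of the square root, which is
    explicit. *)
Lemma powR_ge_sqrt (q s : R) : 1 <= q -> 0 <= s ->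
  s + (q - 1) * (2 * (s - Num.sqrt s)) <= s `^ q.
Proof.
move=> q1; rewrite le_eqVlt => /predU1P[<-|s0].
  by rewrite sqrtr0 subr0 mulr0 mulr0 addr0 powR_ge0.
have r0 : 0 < Num.sqrt s by rewrite sqrtr_gt0.
have rs : Num.sqrt s ^+ 2 = s by rewrite sqr_sqrtr// ltW.
have sq1 : s `^ q = s * s `^ (q - 1).
  by rewrite mulr_powRB1 ?ltW// (lt_le_trans ltr01).
have lns : 2 - 2 / Num.sqrt s <= ln s.
  rewrite -{2}rs lnXn//.
  have : ln (Num.sqrt s)^-1 <= (Num.sqrt s)^-1 - 1.
    have := @le_ln1Dx R ((Num.sqrt s)^-1 - 1); rewrite addrCA subrr addr0; apply.
    have : 0 < (Num.sqrt s)^-1 by rewrite invr_gt0.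
    lra.
  by rewrite lnV ?posrE//; lra.
have st : 1 + (q - 1) * (2 - 2 / Num.sqrt s) <= s `^ (q - 1).
  rewrite /powR gt_eqF//; apply: le_trans (expR_ge1Dx _).
  by rewrite lerD2l ler_wpM2l// subr_ge0.
rewrite sq1; apply: le_trans (ler_wpM2l (ltW s0) st).
have -> : s * (1 + (q - 1) * (2 - 2 / Num.sqrt s)) =
    s + (q - 1) * (2 * (s - s / Num.sqrt s)) by ring.
by rewrite (_ : s / Num.sqrt s = Num.sqrt s)// -{1}rs expr2 mulfK ?gt_eqF.
Qed.

(** Quantitative strict convexity at 1: add up powR_ge_sqrt at 1 + z and 1 - z and
    compute (sqrt (1 + z) + sqrt (1 - z))^2. *)
Lemma powR_strict_convex (q z : R) : 1 <= q -> `|z| <= 1 ->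
  2 + (q - 1) / 2 * z ^+ 2 <= (1 + z) `^ q + (1 - z) `^ q.
Proof.
move=> q1; rewrite ler_norml => /andP[zl zr].
have h1 : 0 <= 1 + z by lra.
have h2 : 0 <= 1 - z by lra.
have := lerD (powR_ge_sqrt q1 h1) (powR_ge_sqrt q1 h2); apply: le_trans.
set P := Num.sqrt (1 + z); set Q := Num.sqrt (1 - z).
have P0 : 0 <= P := sqrtr_ge0 _; have Q0 : 0 <= Q := sqrtr_ge0 _.
have PP : P ^+ 2 = 1 + z by rewrite sqr_sqrtr.
have QQ : Q ^+ 2 = 1 - z by rewrite sqr_sqrtr.
have PQ : P + Q <= 2 - z ^+ 2 / 4.
  have zz : z ^+ 2 = 1 - (P * Q) ^+ 2 by rewrite exprMn PP QQ; ring.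
  have z21 : z ^+ 2 <= 1 by rewrite zz lerBlDr lerDl sqr_ge0.
  have r0 : 0 <= 2 - z ^+ 2 / 4 by lra.
  rewrite -(@ler_pXn2r _ 2)// ?nnegrE ?addr_ge0//.
  have -> : (P + Q) ^+ 2 = 2 + 2 * (P * Q).
    by rewrite sqrrD PP QQ; ring.
  have c2 : 0 <= (1 - P * Q) ^+ 2 by exact: sqr_ge0.
  have c4 : 0 <= (z ^+ 2) ^+ 2 by exact: sqr_ge0.
  have -> : (2 - z ^+ 2 / 4) ^+ 2 = 4 - z ^+ 2 + (z ^+ 2) ^+ 2 / 16 by field.
  have : 1 - 2 * (P * Q) + (P * Q) ^+ 2 = (1 - P * Q) ^+ 2 by ring.
  lra.
have q0 : 0 <= q - 1 by lra.
have : (q - 1) * (z ^+ 2 / 4) <= (q - 1) * (2 - P - Q) by apply: ler_wpM2l => //; lra.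
have -> : (q - 1) * (2 * (1 + z - P)) = 2 * ((q - 1) * (1 + z - P)) by ring.
have -> : (q - 1) * (2 * (1 - z - Q)) = 2 * ((q - 1) * (1 - z - Q)) by ring.
have -> : (q - 1) / 2 * z ^+ 2 = 2 * ((q - 1) * (z ^+ 2 / 4)) by field.
have -> : (q - 1) * (2 - P - Q) = (q - 1) * (1 + z - P) + (q - 1) * (1 - z - Q) by ring.
lra.
Qed.

(** Rescaling powR_strict_convex to the midpoint of X and Y. *)
Lemma powR_midpoint (q X Y m : R) : 1 <= q -> 0 <= X -> 0 <= Y -> 0 <= m ->
  2 * m <= X + Y -> 2 * m `^ q <= X `^ q + Y `^ q.
Proof.
move=> q1 X0 Y0 m0 mXY; have q0 : 0 <= q by rewrite (le_trans ler01).
pose c := (X + Y) / 2; have mc : m <= c by rewrite /c; lra.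
apply: (@le_trans _ _ (2 * c `^ q)).
  by rewrite ler_wpM2l// ge0_ler_powR// nnegrE// (le_trans m0).
have [c0|c0] := leP c 0.
  have -> : c = 0 by apply/eqP; rewrite eq_le c0 (le_trans m0).
  by rewrite powR0 ?mulr0 ?addr_ge0 ?powR_ge0// gt_eqF// (lt_le_trans ltr01).
pose z := (X - Y) / (2 * c).
have c20 : 0 < 2 * c by rewrite mulr_gt0.
have XE : X = c * (1 + z).
  have cn0 : c != 0 by rewrite gt_eqF.
  have -> : c * (1 + z) = c + (X - Y) / 2 by rewrite /z; field.
  rewrite /c; lra.
have YE : Y = c * (1 - z).
  have : X + Y = 2 * c by rewrite /c; field.
  by rewrite {1}XE => ?; lra.
have z1 : `|z| <= 1.
  have h1 : 0 <= 1 + z by rewrite -(pmulr_rge0 _ c0) -XE.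
  have h2 : 0 <= 1 - z by rewrite -(pmulr_rge0 _ c0) -YE.
  by rewrite ler_norml; lra.
have h1 : 0 <= 1 + z by move: z1; rewrite ler_norml; lra.
have h2 : 0 <= 1 - z by move: z1; rewrite ler_norml; lra.
have -> : X `^ q + Y `^ q = ((1 + z) `^ q + (1 - z) `^ q) * c `^ q.
  rewrite [in LHS]XE [in LHS]YE (powRM _ (ltW c0) h1) (powRM _ (ltW c0) h2); ring.
rewrite ler_wpM2r ?powR_ge0//.
apply: le_trans (powR_strict_convex q1 z1); rewrite lerDl.
by rewrite mulr_ge0 ?sqr_ge0// divr_ge0// subr_ge0.
Qed.

Lemma quadratic_root (a b c : R) : 0 < a -> c <= 0 ->
  exists x, a * x ^+ 2 + 2 * b * x + c = 0.
Proof.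
move=> a0 c0; have D0 : 0 <= b ^+ 2 - a * c.
  by rewrite subr_ge0 (le_trans _ (sqr_ge0 b))// pmulr_rle0.
exists ((Num.sqrt (b ^+ 2 - a * c) - b) / a).
have := sqr_sqrtr D0; move: (Num.sqrt _) => r rE.
have an0 : a != 0 by rewrite gt_eqF.
have -> : a * ((r - b) / a) ^+ 2 + 2 * b * ((r - b) / a) + c =
  (r ^+ 2 - b ^+ 2 + a * c) / a by field.
rewrite rE (_ : b ^+ 2 - a * c - b ^+ 2 + a * c = 0) ?mul0r//; ring.
Qed.

Lemma ereal_between (x y : \bar R) : (x < y)%E -> exists r : R, (x < r%:E < y)%E.
Proof.
case: x => [x||]; case: y => [y||] //=.
- rewrite lte_fin => xy; exists ((x + y) / 2); rewrite !lte_fin; lra.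
- by move=> _; exists (x + 1); rewrite lte_fin ltry ltrDl ltr01.
- by move=> _; exists (y - 1); rewrite lte_fin ltNyr gtrDl ltrN10.
- by move=> _; exists 0; rewrite ltry ltNyr.
Qed.

End strict_convexity.

(** * States of negative virial *)

Section multipliers.
Context {R : realType} (d : nat) (d_gt0 : (0 < d)%N).
Local Notation V := ('rV[R]_d * R)%type.
Local Notation mu := (@leb_xy R d).
Local Notation q := (@crit_q R d).
Local Notation kap := (@crit_kappa R d).
Implicit Types (u v : V -> R[i]) (du dv : option 'I_d -> V -> R[i]).

Lemma partial_cos (l : V -> R) j z (c : R) : smooth l -> partial_xy j l z = c ->
  partial_xy j (fun z => cos (l z)) z = - sin (l z) * c.
Proof.
move=> sl <-; have dl : is_derive z (direction j) l (partial_xy j l z).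
  by apply: derivableP; exact: smooth_derivable.
exact: (@derive_val _ _ _ _ _ _ _ (is_derive_comp1 (is_derive_cos (l z)) dl)).
Qed.

Lemma partial_sin (l : V -> R) j z (c : R) : smooth l -> partial_xy j l z = c ->
  partial_xy j (fun z => sin (l z)) z = cos (l z) * c.
Proof.
move=> sl <-; have dl : is_derive z (direction j) l (partial_xy j l z).
  by apply: derivableP; exact: smooth_derivable.
exact: (@derive_val _ _ _ _ _ _ _ (is_derive_comp1 (is_derive_sin (l z)) dl)).
Qed.

Lemma partial_snd j z : partial_xy j (fun z : V => z.2) z = (j == None)%:R.
Proof.
rewrite /partial_xy (@derive_val _ _ _ _ _ _ _ (@is_derive_affine R V _ (fun w : V => w.2) _ _ _)).
  by case: j.
by [].
Qed.

Lemma partial_coord (xi : R) i0 j z :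
  partial_xy j (fun z : V => xi * z.1 ord0 i0) z = (if j == Some i0 then xi else 0).
Proof.
rewrite /partial_xy (@derive_val _ _ _ _ _ _ _
  (@is_derive_affine R V _ (fun w : V => xi * w.1 ord0 i0) _ _ _)).
  by case: j => [i|] /=; rewrite mxE ?mulr0// eqxx /= eq_sym; case: eqP => [->|];
    rewrite ?eqxx ?mulr1 ?mulr0//; case: eqP => // -[].
by move=> x v t; rewrite /= !mxE mulrDr mulrCA.
Qed.

Lemma norm_cos_le1 (x : R) : `|cos x| <= 1.
Proof. by rewrite ler_norml cos_geN1 cos_le1. Qed.

Lemma norm_sin_le1 (x : R) : `|sin x| <= 1.
Proof. by rewrite ler_norml sin_geN1 sin_le1. Qed.

(** A plane wave in x raises the longitudinal kinetic energy by any prescribed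
    amount and leaves the mass, the potential energy and the transverse kinetic
    energy alone; hence states of negative virial are admissible competitors. *)
Lemma m_c_le_virial u du c : 0 < c -> field_gradient u du -> Pot_finite q u ->
  Mass u = c -> KinX du <= kap * Pot q u -> (m_c d (4 / d%:R) c <= (KinY du / 2)%:E)%E.
Proof.
move=> c0 fu pu Mu Ku; pose i0 : 'I_d := Ordinal d_gt0.
have lu := field_gradient_L2C fu.
have li j := field_gradient_dL2C j fu.
pose J z := dotC (du (Some i0) z) ('i%C * u z).
have iJ : intg mu J.
  apply: intg_dotC; first exact: li.
  have /field_gradient_L2C := field_gradientZ ('i%C) fu; exact.
(* The virial of e^{i xi x_1} u is a quadratic polynomial in xi with leading
   coefficient c > 0 and a nonpositive value at 0, so it has a root. *)
have [xi xiE] := @quadratic_root R c (\int[mu]_z J z) (KinX du - kap * Pot q u) c0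
  ltac:(by rewrite subr_le0).
pose l (z : V) := xi * z.1 ord0 i0.
have sl : smooth l by apply: smoothZ; exact: smooth_coord.
pose lj j := (if j == Some i0 then xi else 0) : R.
have dl j z : partial_xy j l z = lj j by exact: partial_coord.
have lj_le j : `|lj j| <= 1 + `|xi|.
  by rewrite /lj; case: ifP => _; rewrite ?normr0 ?addr_ge0// lerDr.
have dc j z := partial_cos sl (dl j z); have ds j z := partial_sin sl (dl j z).
have fv := @field_gradientM R d (1 + `|xi|) (fun z => cos (l z)) (fun z => sin (l z))
  u du (cos_smooth sl) (sin_smooth sl) (fun _ _ => erefl) (fun _ _ => erefl)
  _ _ _ _ fu.
set v := (fun z => _ * u z) in fv; set dv := (fun j z => _ + _) in fv.
have {}fv : field_gradient v dv.
  apply: fv.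
  - by move=> z; rewrite (le_trans (norm_cos_le1 _))// lerDl.
  - by move=> z; rewrite (le_trans (norm_sin_le1 _))// lerDl.
  - move=> j z; rewrite dc normrM normrN -[leRHS]mul1r.
    by apply: ler_pM => //; exact: norm_sin_le1.
  - move=> j z; rewrite ds normrM -[leRHS]mul1r.
    by apply: ler_pM => //; exact: norm_cos_le1.
have e1 z : sq (cos (l z) +i* sin (l z))%C = 1 by rewrite /sq /= cos2Dsin2.
have sv z : sq (v z) = sq (u z) by rewrite /v sqM e1 mul1r.
have sdv j z : sq (dv j z) =
    sq (du j z) + 2 * lj j * dotC (du j z) ('i%C * u z) + lj j ^+ 2 * sq (u z).
  have -> : dv j z = (cos (l z) +i* sin (l z))%C *
      (du j z + (lj j)%:C%C * ('i%C * u z)).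
    rewrite /dv dc ds; case: (du j z) => ? ?; case: (u z) => ? ?.
    by apply/eqP; rewrite eq_complex /=; apply/andP; split; apply/eqP; ring.
  rewrite sqM e1 mul1r; case: (du j z) => ? ?; case: (u z) => ? ?.
  by rewrite /sq /dotC /=; ring.
have pv : Pot_finite q v by rewrite /Pot_finite; under eq_fun do rewrite sv.
have Pv : Pot q v = Pot q u by apply: eq_Rint => z; rewrite sv.
have Mv : Mass v = c by rewrite -Mu; apply: eq_Rint => z; rewrite sv.
have KYv : KinY dv = KinY du.
  by apply: eq_Rint => z; rewrite sdv /lj /=; ring.
have KXv : KinX dv = KinX du + (2 * xi * \int[mu]_z J z + xi ^+ 2 * Mass u).
  have iM := intg_sq lu.
  have iJ2 := intgZ (2 * xi) iJ; have iM2 := intgZ (xi ^+ 2) iM.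
  rewrite /KinX /Mass -(RintZ (2 * xi) iJ) -(RintZ (xi ^+ 2) iM) -(RintD iJ2 iM2).
  rewrite -(RintD (intg_kinX fu) (intgD iJ2 iM2)).
  apply: eq_Rint => z; set E := 2 * xi * J z + xi ^+ 2 * sq (u z).
  transitivity (\sum_(i < d) (sq (du (Some i) z) + (if i == i0 then E else 0))).
    apply: eq_bigr => i _; rewrite sdv /lj.
    have -> : (Some i == Some i0) = (i == i0) by [].
    by case: eqP => [->|_]; rewrite /E /J; ring.
  by rewrite big_split /= -big_mkcond /= big_pred1_eq.
rewrite -KYv; apply: (m_c_le d_gt0 fv pv Mv).
rewrite KXv Pv Mu; apply/eqP; rewrite -subr_eq0 -xiE; apply/eqP; ring.
Qed.

End multipliers.

(** * Monotonicity *)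

Lemma virial_sum_le {R : realType} (X1 X2 Q1 Q2 SK sl kp PP : R) :
  X1 + X2 <= 2 * SK + 2 * sl -> 2 * PP <= Q1 + Q2 -> 0 <= kp ->
  sl = kp * PP - SK -> (X1 - kp * Q1) + (X2 - kp * Q2) <= 0.
Proof. by move=> hX hQ kp0 slE; have := ler_wpM2l kp0 hQ; move: hX; rewrite slE; lra. Qed.

Section monotonicity.
Context {R : realType} (d : nat) (d_gt0 : (0 < d)%N).
Local Notation V := ('rV[R]_d * R)%type.
Local Notation mu := (@leb_xy R d).
Local Notation q := (@crit_q R d).
Local Notation kap := (@crit_kappa R d).
Implicit Types (u v : V -> R[i]) (du dv : option 'I_d -> V -> R[i]).

Let q1 : 1 < q. Proof. exact: crit_q_gt1. Qed.
Let q0 : 0 < q. Proof. exact: lt_trans ltr01 q1. Qed.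

Lemma Pot_gt0 u : L2C u -> Pot_finite q u -> 0 < Mass u -> 0 < Pot q u.
Proof.
move=> lu pu Mu.
have P0 : 0 <= Pot q u by apply: Rint_ge0 => z; exact: powR_ge0.
rewrite lt_neqAle P0 andbT eq_sym; apply: contraTneq Mu => Pu.
have := Rint_eq0_ae (fun z => powR_ge0 (sq (u z)) q) pu Pu => H.
rewrite -leNgt le_eqVlt; apply/orP; left; apply/eqP.
rewrite -[RHS](@Rint_zero _ _ _ mu); apply: Rint_ae => //.
  exact: measurable_sq.
by apply: filterS H => z Hz Dz; exact: powR_eq0_eq0 (Hz Dz).
Qed.

Lemma Pot_finite_dom u v w : L2C w -> Pot_finite q u -> Pot_finite q v ->
  (forall z, sq (w z) <= 2 * sq (u z) + 2 * sq (v z)) -> Pot_finite q w.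
Proof.
move=> lw pu pv H.
apply: (@intg_le _ _ _ _ _ (fun z => 4 `^ q * (sq (u z) `^ q + sq (v z) `^ q))).
- exact: (measurableT_comp (measurable_powR q) (measurable_sq lw)).
- move=> z; rewrite ger0_norm ?powR_ge0//.
  have u0 := sq_ge0 (u z); have v0 := sq_ge0 (v z); have w0 := sq_ge0 (w z).
  have key X Y : 0 <= X -> X <= Y -> sq (w z) <= 4 * Y -> sq (w z) `^ q <= 4 `^ q * Y `^ q.
    move=> X0 XY wY; have Y0 : 0 <= Y := le_trans X0 XY.
    by rewrite -powRM// ge0_ler_powR// ?nnegrE ?mulr_ge0// ltW.
  have [uv|vu] := leP (sq (u z)) (sq (v z)).
    apply: le_trans (key _ _ u0 uv _) _; first by have := H z; lra.
    by rewrite ler_wpM2l ?powR_ge0// lerDr powR_ge0.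
  apply: le_trans (key _ _ v0 (ltW vu) _) _; first by have := H z; lra.
  by rewrite ler_wpM2l ?powR_ge0// lerDl powR_ge0.
- by apply: intgZ; exact: intgD.
Qed.

Lemma sqC (c : R) : sq (c +i* 0)%C = c ^+ 2.
Proof. by rewrite /sq /= expr0n addr0. Qed.

Definition weightC (t : R) (z : V) : R[i] := (weight t z +i* 0)%C.
Definition dweightC (t : R) (j : option 'I_d) (z : V) : R[i] :=
  (partial_xy j (weight t) z +i* 0)%C.

Lemma field_gradient_weight t : 0 < t -> field_gradient (weightC t) (dweightC t).
Proof.
move=> t0; split => //; first exact: has_gradient_weight.
split => [|j]; first exact: L20.
split; first exact: L20.
move=> phi _; under eq_Rint => z do rewrite mul0r.
by under [in RHS]eq_Rint => z do rewrite mul0r; rewrite Rint_zero oppr0.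
Qed.

Lemma Mass_weight_gt0 u t : 0 < t -> L2C u -> 0 < Mass u -> 0 < Mass (weightC t).
Proof.
move=> t0 lu Mu.
have lw := field_gradient_L2C (field_gradient_weight t0).
have M0 : 0 <= Mass (weightC t) by apply: Rint_ge0 => z; exact: sq_ge0.
rewrite lt_neqAle M0 andbT eq_sym; apply: contraTneq Mu => Mw.
have H := Rint_eq0_ae (fun z => sq_ge0 (weightC t z)) (intg_sq lw) Mw.
rewrite -leNgt le_eqVlt; apply/orP; left; apply/eqP.
rewrite -[RHS](@Rint_zero _ _ _ mu); apply: Rint_ae => //.
  exact: measurable_sq.
apply: filterS H => z Hz Dz; have /eqP := Hz Dz.
by rewrite sqC sqrf_eq0 gt_eqF// weight_gt0.
Qed.

Lemma KinX_weight t : 0 < t -> KinX (dweightC t) <= d%:R * t ^+ 2 * Mass (weightC t).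
Proof.
move=> t0; have fw := field_gradient_weight t0.
have iw := intg_sq (field_gradient_L2C fw).
rewrite /Mass -RintZ//; apply: Rint_le.
- exact: intg_kinX fw.
- exact: intgZ.
- move=> z.
  have -> : d%:R * t ^+ 2 * sq (weightC t z) = \sum_(i < d) t ^+ 2 * sq (weightC t z).
    by rewrite sumr_const card_ord -mulrA mulr_natl.
  apply: ler_sum => i _; rewrite !sqC -exprMn -real_normK ?num_real//.
  apply: lerXn2r; rewrite ?nnegrE//; last exact: partial_weight_le (ltW t0).
  by rewrite mulr_ge0 ?ltW// weight_gt0.
Qed.

Lemma Pot_finite_weight t : 0 < t -> Pot_finite q (weightC t).
Proof.
move=> t0; have lw := field_gradient_L2C (field_gradient_weight t0).
apply: intg_le (intg_sq lw).
  exact: (measurableT_comp (measurable_powR q) (measurable_sq lw)).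
move=> z; rewrite ger0_norm ?powR_ge0// sqC; apply: ge1r_powR; last exact: ltW.
by rewrite exprn_gt0 ?weight_gt0//= expr_le1// ?weight_le1// ltW// weight_gt0.
Qed.

Lemma Pot_finiteZ (c : R[i]) u : Pot_finite q u -> Pot_finite q (fun z => c * u z).
Proof.
move=> pu; rewrite /Pot_finite.
under eq_fun => z do rewrite sqM powRM ?sq_ge0//.
exact: intgZ.
Qed.

Lemma PotZ (c : R[i]) u : Pot_finite q u ->
  Pot q (fun z => c * u z) = sq c `^ q * Pot q u.
Proof.
move=> pu; rewrite /Pot -RintZ//; apply: eq_Rint => z.
by rewrite sqM powRM ?sq_ge0.
Qed.

Lemma MassZ (c : R[i]) u : L2C u -> Mass (fun z => c * u z) = sq c * Mass u.
Proof.
by move=> lu; rewrite /Mass -RintZ; [apply: eq_Rint => z; rewrite sqM|exact: intg_sq].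
Qed.

Lemma KinXZ (c : R[i]) u du : field_gradient u du ->
  KinX (fun j z => c * du j z) = sq c * KinX du.
Proof.
move=> fu; rewrite /KinX -RintZ; last exact: intg_kinX fu.
apply: eq_Rint => z; rewrite mulr_sumr; apply: eq_bigr => i _; exact: sqM.
Qed.

Lemma KinYZ (c : R[i]) u du : field_gradient u du ->
  KinY (fun j z => c * du j z) = sq c * KinY du.
Proof.
move=> fu; rewrite /KinY -RintZ; last exact: intg_sq (field_gradient_dL2C None fu).
by apply: eq_Rint => z; exact: sqM.
Qed.

(** Enlarging the mass: amplify u slightly, which makes its virial negative, and
    supply the missing mass by a y-independent, very flat field W orthogonal to
    u. The flat part costs no transverse kinetic energy. By the parallelogram
    identity and convexity of the power q, one of su + W, su - W still has
    nonpositive virial. *)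
Lemma m_c_nonincreasing (a b : R) : 0 < b -> b < a ->
  (m_c d (4 / d%:R) a <= m_c d (4 / d%:R) b)%E.
Proof.
move=> b0 ba; rewrite leNgt; apply/negP => /ereal_between[x /andP[bx xa]].
have [u [du [fu pu Mu Ku Yu]]] := m_c_lt d_gt0 bx.
have lu := field_gradient_L2C fu.
have Mu0 : 0 < Mass u by rewrite Mu.
have Pu0 := Pot_gt0 lu pu Mu0.
have Y0 : 0 <= KinY du by apply: Rint_ge0 => z; exact: sq_ge0.
(* |u|^2 is amplified by a factor S so close to 1 that neither the mass a nor the
   bound on the transverse kinetic energy is exceeded. *)
have [S [S1 Sb SY]] : exists S : R, [/\ 1 < S, S * b < a & S * KinY du < 2 * x].
  pose e := Num.min ((a - b) / (2 * b)) ((2 * x - KinY du) / (2 * (KinY du + 1))).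
  have e0 : 0 < e.
    by rewrite lt_min !divr_gt0 ?subr_gt0// mulr_gt0// ltr_wpDl.
  have e1 : e * (2 * b) <= a - b.
    by rewrite -ler_pdivlMr ?mulr_gt0// ge_min lexx.
  have e2 : e * (2 * (KinY du + 1)) <= 2 * x - KinY du.
    by rewrite -ler_pdivlMr ?mulr_gt0 ?ltr_wpDl// ge_min lexx orbT.
  exists (1 + e); split; first by rewrite ltrDl.
  - have : 0 < e * b by rewrite mulr_gt0.
    by rewrite mulrDl mul1r; lra.
  - have : 0 <= e * KinY du by rewrite mulr_ge0// ltW.
    by rewrite mulrDl mul1r; lra.
have S0 : 0 < S := lt_trans ltr01 S1.
pose p := a - S * b; have p0 : 0 < p by rewrite subr_gt0.
have SqS : S < S `^ q.
  rewrite -(mulr_powRB1 (ltW S0) q0) ltr_pMr//.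
  by have := gt0_ltr_powR (_ : 0 < q - 1) _ _ S1; rewrite powR1; apply;
    rewrite ?nnegrE ?subr_gt0// ltW.
(* Amplification multiplies KinX by S but Pot by S `^ q. The slack in the virial
   is what the kinetic energy of W may use, and t is chosen accordingly. *)
pose slack := kap * (S `^ q - S) * Pot q u.
have slack0 : 0 < slack by rewrite !mulr_gt0 ?crit_kappa_gt0// subr_gt0.
have dp0 : 0 < d%:R * p by rewrite mulr_gt0// ltr0n.
pose t := Num.sqrt (slack / (d%:R * p)).
have t0 : 0 < t by rewrite sqrtr_gt0 divr_gt0.
have tE : d%:R * t ^+ 2 * p = slack.
  rewrite sqr_sqrtr; last by rewrite divr_ge0// ltW.
  by rewrite mulrAC mulrC divfK// gt_eqF.
have fw := field_gradient_weight t0; have lw := field_gradient_L2C fw.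
have Mw0 := Mass_weight_gt0 t0 lu Mu0.
(* A phase for W that makes it orthogonal to u in the real inner product. *)
pose al := \int[mu]_z (weight t z * complex.Re (u z)).
pose be := \int[mu]_z (weight t z * complex.Im (u z)).
have [z1 [z2 [z0 zE]]] : exists z1 z2 : R, 0 < z1 ^+ 2 + z2 ^+ 2 /\ z1 * al + z2 * be = 0.
  have [a0|an0] := eqVneq al 0.
    by exists 1, 0; rewrite a0 expr1n expr0n addr0; split => //; ring.
  exists (- be), al; split; last by ring.
  by rewrite ltr_wpDl ?sqr_ge0// lt_neqAle sqr_ge0 eq_sym sqrf_eq0 an0.
pose k := Num.sqrt (p / ((z1 ^+ 2 + z2 ^+ 2) * Mass (weightC t))).
have kE : k ^+ 2 * (z1 ^+ 2 + z2 ^+ 2) * Mass (weightC t) = p.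
  rewrite sqr_sqrtr; last by rewrite divr_ge0 ?mulr_ge0// ltW.
  by rewrite -mulrA divfK// gt_eqF// mulr_gt0.
pose s : R[i] := (Num.sqrt S +i* 0)%C.
have sqs : sq s = S by rewrite sqC sqr_sqrtr// ltW.
pose c (sg : R) : R[i] := (sg * (k * z1) +i* (sg * (k * z2)))%C.
have fsu := field_gradientZ s fu.
have fc sg := field_gradientZ (c sg) fw.
have fv sg := field_gradientD fsu (fc sg).
have lsu := field_gradient_L2C fsu.
have sqc sg : sg ^+ 2 = 1 -> sq (c sg) = k ^+ 2 * (z1 ^+ 2 + z2 ^+ 2).
  move=> sg1; rewrite /sq /=.
  have -> : (sg * (k * z1)) ^+ 2 + (sg * (k * z2)) ^+ 2 =
    sg ^+ 2 * (k ^+ 2 * (z1 ^+ 2 + z2 ^+ 2)) by ring.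
  by rewrite sg1 mul1r.
have pv sg : Pot_finite q (fun z => s * u z + c sg * weightC t z).
  apply: (Pot_finite_dom (field_gradient_L2C (fv sg)) (Pot_finiteZ s pu)
    (Pot_finiteZ (c sg) (Pot_finite_weight t0))) => z.
  have := sq_ge0 (s * u z - c sg * weightC t z); rewrite sqB sqD; lra.
have Mv sg : sg ^+ 2 = 1 -> Mass (fun z => s * u z + c sg * weightC t z) = a.
  move=> sg1; have lcw := field_gradient_L2C (fc sg).
  have i1 := intg_sq lsu; have i2 := intg_sq lcw; have i3 := intg_dotC lsu lcw.
  rewrite /Mass; under eq_Rint => z do rewrite sqD.
  rewrite (RintD (intgD i1 (intgZ 2 i3)) i2) (RintD i1 (intgZ 2 i3)) (RintZ 2 i3).
  rewrite -!/(Mass _) (MassZ _ lu) (MassZ _ lw) sqs sqc// kE Mu.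
  suff -> : \int[mu]_z dotC (s * u z) (c sg * weightC t z) = 0.
    by rewrite mulr0 addr0 /p addrC subrK.
  have iR : intg mu (fun z => weight t z * complex.Re (u z)).
    by apply: L2_mul; [exact: L2_weight|exact: lu.1].
  have iI : intg mu (fun z => weight t z * complex.Im (u z)).
    by apply: L2_mul; [exact: L2_weight|exact: lu.2].
  transitivity (\int[mu]_z (Num.sqrt S * sg * k * (z1 * (weight t z * complex.Re (u z)) +
      z2 * (weight t z * complex.Im (u z))))).
    apply: eq_Rint => z; rewrite /dotC; case: (u z) => ur ui /=; ring.
  rewrite (RintZ _ (intgD (intgZ z1 iR) (intgZ z2 iI))).
  by rewrite (RintD (intgZ z1 iR) (intgZ z2 iI)) !RintZ// zE mulr0.
have Yv sg : KinY (fun j z => s * du j z + c sg * dweightC t j z) = S * KinY du.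
  rewrite -sqs -(KinYZ s fu); apply: eq_Rint => z.
  rewrite /dweightC partial_weight_y; congr sq.
  by rewrite -[(0 +i* 0)%C]/(0 : R[i]) mulr0 addr0.
have [Kv KvE] : exists Kv : R -> R, forall sg, Kv sg =
    KinX (fun j z => s * du j z + c sg * dweightC t j z) -
    kap * Pot q (fun z => s * u z + c sg * weightC t z).
  by exists (fun sg => KinX (fun j z => s * du j z + c sg * dweightC t j z) -
    kap * Pot q (fun z => s * u z + c sg * weightC t z)).
have cN z : c (-1) * z = - (c 1 * z).
  by rewrite /c; case: z => ? ?; apply/eqP; rewrite eq_complex /=;
    apply/andP; split; apply/eqP; ring.
have Ksum : Kv 1 + Kv (-1) <= 0.
  have X2 : KinX (fun j z => s * du j z + c 1 * dweightC t j z) +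
      KinX (fun j z => s * du j z + c (-1) * dweightC t j z) <=
      2 * (S * KinX du) + 2 * slack.
    have iX1 := intgZ 2 (intg_kinX fsu); have iX2 := intgZ 2 (intg_kinX (fc 1)).
    have -> : KinX (fun j z => s * du j z + c 1 * dweightC t j z) +
        KinX (fun j z => s * du j z + c (-1) * dweightC t j z) =
        2 * KinX (fun j z => s * du j z) + 2 * KinX (fun j z => c 1 * dweightC t j z).
      rewrite /KinX -(RintD (intg_kinX (fv 1)) (intg_kinX (fv (-1)))).
      rewrite -(RintZ 2 (intg_kinX fsu)) -(RintZ 2 (intg_kinX (fc 1))) -(RintD iX1 iX2).
      apply: eq_Rint => z; rewrite !mulr_sumr -!big_split /=; apply: eq_bigr => i _.
      by rewrite cN sqB sqD; ring.
    rewrite (KinXZ s fu) sqs (KinXZ (c 1) fw) sqc ?expr1n//.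
    have := KinX_weight t0; set m := k ^+ 2 * _; have m0 : 0 <= m.
      by rewrite mulr_ge0 ?sqr_ge0// ltW.
    move=> /(ler_wpM2l m0).
    have -> : m * (d%:R * t ^+ 2 * Mass (weightC t)) = d%:R * t ^+ 2 * (m * Mass (weightC t)) by ring.
    by rewrite kE tE; lra.
  have P2 : 2 * (S `^ q * Pot q u) <= Pot q (fun z => s * u z + c 1 * weightC t z) +
      Pot q (fun z => s * u z + c (-1) * weightC t z).
    rewrite -{1}sqs -(PotZ s pu) /Pot -(RintZ 2 (Pot_finiteZ s pu)) -(RintD (pv 1) (pv (-1))).
    apply: Rint_le.
    - exact: (intgZ 2 (Pot_finiteZ s pu)).
    - exact: (intgD (pv 1) (pv (-1))).
    - move=> z; apply: powR_midpoint; rewrite ?sq_ge0 ?(ltW q1)//.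
      rewrite cN sqB sqD; have := sq_ge0 (c 1 * weightC t z); lra.
  have kp0 : 0 <= kap by rewrite ltW// crit_kappa_gt0.
  have slE : slack = kap * (S `^ q * Pot q u) - S * KinX du by rewrite /slack Ku; ring.
  rewrite !KvE.
  exact (virial_sum_le X2 P2 kp0 slE).
have [sg sg1 Ks] : exists2 sg : R, sg ^+ 2 = 1 & Kv sg <= 0.
  have [h|h] := leP (Kv 1) 0; first by exists 1; rewrite ?expr1n.
  exists (-1); first by rewrite sqrrN expr1n.
  by rewrite -(lerD2l (Kv 1)) addr0 (le_trans Ksum)// ltW.
have a0 : 0 < a := lt_trans b0 ba.
have := m_c_le_virial d_gt0 a0 (fv sg) (pv sg) (Mv sg sg1).
rewrite -subr_le0 -KvE => /(_ Ks); rewrite Yv leNgt => /negP; apply.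
apply: lt_trans xa; by rewrite lte_fin ltr_pdivrMr// [x * 2]mulrC.
Qed.

End monotonicity.

(** * Primitives on the circle *)

Section primitive.
Context {R : realType}.
Local Notation leb := (@lebesgue_measure R).

Lemma continuous_itv_intg (f : R -> R) (a b : R) : continuous f ->
  leb.-integrable `[a, b] (EFin \o f).
Proof.
move=> cf; apply: continuous_compact_integrable; first exact: segment_compact.
exact: continuous_subspaceT.
Qed.

Lemma Rint_itv_chain (f : R -> R) (m n x : R) : continuous f -> m <= n -> n <= x ->
  \int[leb]_(t in `[m, x]) f t - \int[leb]_(t in `[m, n]) f t = \int[leb]_(t in `[n, x]) f t.
Proof.
move=> cf mn nx; rewrite Rintegral_itvB ?bnd_simp//; last exact: continuous_itv_intg.
rewrite Rintegral_itv_obnd_cbnd//.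
apply: integrableS (continuous_itv_intg n x cf) => //.
exact: subset_itv_oc_cc.
Qed.

(** Integrate from a point far to the left and normalise at 0: moving the starting
    point further away then changes nothing, so the local primitives agree. *)
Lemma continuous_primitive (f : R -> R) : continuous f ->
  exists F : R -> R, forall x : R, is_derive x (1 : R) F (f x).
Proof.
move=> cf.
pose K n x := \int[leb]_(t in `[(- n), x]) f t - \int[leb]_(t in `[(- n), 0]) f t.
have KE m n x : 0 <= n -> n <= m -> - n <= x -> K m x = K n x.
  move=> n0 nm nx; rewrite /K.
  rewrite -(Rint_itv_chain (m := - m) cf _ nx) ?lerN2// -(Rint_itv_chain (m := - m) (n := - n) (x := 0) cf) ?lerN2// ?oppr_le0//.
  by rewrite opprB addrA addrNK.
have dK (n x : R) : - n < x -> is_derive x (1 : R) (K n) (f x).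
  move=> nx; have x1 : x < x + 1 by rewrite ltrDl.
  have [dF F'] := continuous_FTC1_closed x1 (continuous_itv_intg (- n) (x + 1) cf) nx (cf x).
  rewrite derive1E in F'.
  have := is_deriveB (DeriveDef dF F') (is_derive_cst (\int[leb]_(t in `[(- n), 0]) f t) x (1 : R)).
  by rewrite subr0; apply.
exists (fun x => K (`|x| + 1) x) => x.
have xN : - (`|x| + 2) < x by have := ler_norm (- x); rewrite normrN; lra.
have nE : \forall y \near x, K (`|x| + 2) y = K (`|y| + 1) y.
  near=> y; apply: KE.
  - by rewrite addr_ge0.
  - suff : `|y| <= `|x| + 1 by lra.
    rewrite -lerBlDl; apply: le_trans (lerB_dist _ _) _.
    near: y; apply: filterS (nbhsx_ballx x 1 ltr01) => y /=.
    by rewrite /ball /= distrC => /ltW.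
  - by have := ler_norm (- y); rewrite normrN; lra.
have [dK1 dK2] := dK _ _ xN.
split; first exact: (near_eq_derivable nE).
by rewrite -(near_eq_derive _ nE).
Unshelve. all: by end_near. Qed.

End primitive.

Section periodic_primitive.
Context {R : realType} (d : nat).
Local Notation V := ('rV[R]_d * R)%type.

Lemma continuous_lift_y (b : R -> R) : smooth (fun z : V => b z.2) -> continuous b.
Proof.
move=> sb y; apply: (@continuous_comp _ _ _ (fun y : R => ((0, y) : V)) (fun z : V => b z.2)).
  exact: continuous_pair_r.
exact: (smooth_continuous sb).
Qed.

Lemma smooth_lift_y (beta b : R -> R) : (forall y : R, is_derive y (1 : R) beta (b y)) ->
  smooth (fun z : V => b z.2) -> smooth (fun z : V => beta z.2).
Proof.
move=> db sb k; apply: (@CkW _ _ k); apply: Ck_of_derive.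
- move=> z; apply: (@continuous_comp _ _ _ snd beta); first exact: cvg_snd.
  by apply/differentiable_continuous/derivable1_diffP; have [] := db z.2.
- move=> v.
  exists (fun z => b z.2 * v.2); first by apply: CkM; [exact: sb|exact: Ck_cst].
  move=> z; apply: (@is_derive_comp1 R V beta snd) => //.
  exact: (@is_derive_affine _ _ _ (fun w : V => w.2)).
Qed.

(** Subtracting the mean of b makes the primitive periodic. *)
Lemma periodic_primitive (b : R -> R) :
  smooth (fun z : V => b z.2) -> (forall y, b (y + 2 * pi) = b y) ->
  exists (beta : R -> R) (m : R), [/\ smooth (fun z : V => beta z.2),
    forall y, beta (y + 2 * pi) = beta y, beta 0 = 0 &
    forall y : R, is_derive y (1 : R) beta (b y - m)].
Proof.
move=> sb pb; have [B dB] := continuous_primitive (continuous_lift_y sb).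
have pi0 : 2 * pi != 0 :> R by rewrite mulf_neq0// gt_eqF ?pi_gt0.
pose m := (B (2 * pi) - B 0) / (2 * pi).
pose beta y := B y - m * y - B 0.
have db (y : R) : is_derive y (1 : R) beta (b y - m).
  rewrite /beta; apply: is_derive_eq; by rewrite subr0 /= ?scaler1; ring.
exists beta, m; split => //.
- apply: (smooth_lift_y db); apply: smoothD => //; exact: smooth_cst.
- move=> y; apply/eqP; rewrite -subr_eq0; apply/eqP.
  have dc (x : R) : is_derive x (1 : R) (fun y => beta (y + 2 * pi) - beta y) 0.
    have dsh : is_derive x (1 : R) (fun y => y + 2 * pi) 1.
      by apply: is_derive_eq; rewrite addr0.
    have := is_deriveB (@is_derive_comp1 R R beta _ x 1 _ _ (db (x + 2 * pi)) dsh) (db x).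
    by rewrite pb mulr1 subrr; apply.
  rewrite (is_derive_0_is_cst y 0 dc) add0r /beta /m; rewrite divfK//; ring.
- by rewrite /beta; ring.
Qed.

End periodic_primitive.

(** * Recovering a function from its transverse derivative *)

Section circle_kernel.
Context {R : realType}.
Local Notation tau := (@torus_measure R).
Implicit Types (f g b beta : R -> R).

Lemma torus_intg_bounded (C : R) f : measurable_fun setT f -> (forall y, `|f y| <= C) ->
  intg tau f.
Proof.
move=> mf fC; apply: (@intg_le _ _ _ _ _ (fun=> C)) => //.
apply/integrableP; split; first by apply/measurable_EFinP.
rewrite integral_cst//= torus_setT -EFinM; exact: ltry.
Qed.

Lemma torus_ae (P : R -> Prop) : (forall y, 0 <= y < 2 * pi -> P y) -> {ae tau, forall y, P y}.
Proof.
move=> HP; exists (~` `[0, 2 * pi[%classic); split.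
- by apply: measurableC; exact: measurable_itv.
- exact: torus_setC.
- by move=> y /= nP; rewrite in_itv /= => /HP.
Qed.

(** For s in a period this is 1_{s < y} - 1 + s / (2 pi), the kernel that recovers
    a periodic function of mean zero from its derivative. The clamp keeps it
    bounded for all s. *)
Definition circle_kernel (y s : R) : R :=
  (s < y)%R%:R - 1 + Num.max 0 (Num.min 1 (s / (2 * pi))).

Lemma circle_kernel_le1 y s : `|circle_kernel y s| <= 1.
Proof.
rewrite /circle_kernel; set c := Num.max _ _.
have c0 : 0 <= c by rewrite le_max lexx.
have c1 : c <= 1 by rewrite ge_max ler01 ge_min lexx.
by rewrite ler_norml; case: (s < y)%R => /=; lra.
Qed.

Lemma circle_kernelE y s : 0 <= s < 2 * pi ->
  circle_kernel y s = (s < y)%R%:R - 1 + s / (2 * pi).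
Proof.
move=> /andP[s0 s2]; have p0 : 0 < 2 * pi :> R by rewrite mulr_gt0 ?pi_gt0.
by rewrite /circle_kernel min_r ?max_r// ?divr_ge0 ?(ltW p0)// ler_pdivrMr// mul1r ltW.
Qed.

Lemma measurable_after {dsp} {T : measurableType dsp} (p q : T -> R) :
  measurable_fun setT p -> measurable_fun setT q ->
  measurable_fun setT (fun t => (q t < p t)%R%:R : R).
Proof.
move=> mp mq.
rewrite (_ : (fun t => _) = (fun b : bool => b%:R) \o (fun t => (q t < p t)%R)) //.
by apply: measurableT_comp => //; exact: measurable_fun_ltr.
Qed.

Lemma measurable_circle_kernel {dsp} {T : measurableType dsp} (p q : T -> R) :
  measurable_fun setT p -> measurable_fun setT q ->
  measurable_fun setT (fun t => circle_kernel (p t) (q t)).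
Proof.
move=> mp mq; apply: measurable_funD; first apply: measurable_funB => //.
  exact: measurable_after.
apply: measurable_maxr => //; apply: measurable_minr => //.
exact: measurable_funM.
Qed.

Lemma integral_primitive (B b : R -> R) (s t : R) : s < t -> continuous b ->
  (forall y : R, is_derive y (1 : R) B (b y)) ->
  (\int[lebesgue_measure]_(y in `[s, t[) (b y)%:E = (B t - B s)%:E)%E.
Proof.
move=> st cb dB.
have D : (fun y => 'D_1 B y) = b.
  by apply/funext => y; rewrite (@derive_val _ _ _ _ _ _ _ (dB y)).
have mb : measurable_fun setT b by exact: continuous_measurable_fun.
rewrite integral_itv_bndo_bndc; last by apply/measurable_EFinP; exact: measurable_funTS.
rewrite -(@Rint_derive_itv R B s t st); last 2 first.
- by move=> y; have [] := dB y.
- by rewrite D.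
by apply: eq_integral => y _; rewrite -(congr1 (fun h => h y) D).
Qed.

Lemma integral_torus_after (B b : R -> R) (s : R) : 0 <= s < 2 * pi -> continuous b ->
  (forall y : R, is_derive y (1 : R) B (b y)) ->
  (\int[tau]_y ((s < y)%R%:R * b y)%:E = (B (2 * pi) - B s)%:E)%E.
Proof.
move=> /andP[s0 s2] cb dB.
have mb : measurable_fun setT b by exact: continuous_measurable_fun.
rewrite -(integral_primitive s2 cb dB) integral_torus; last first.
  apply/measurable_EFinP; apply: measurable_funM => //.
  exact: measurable_after.
rewrite -[RHS]integral_itv_obnd_cbnd; last first.
  by apply/measurable_EFinP; exact: measurable_funTS.
rewrite [LHS]integral_mkcond [RHS]integral_mkcond; apply: eq_integral => y _.
rewrite !patchE !mem_setE !in_itv /=.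
case: (ltP s y) => sy /=; last by rewrite mul0r; case: ifP.
by rewrite (le_trans s0 (ltW sy)) /= mul1r.
Qed.

Lemma intg_snd {dsp} {T : measurableType dsp} (m1 : {sigma_finite_measure set T -> \bar R})
    (a : R -> R) : (m1 setT < +oo)%E -> intg tau a -> intg (m1 \x tau)%E (fun p => a p.2).
Proof.
move=> m1oo /integrableP[ma ia].
have ma2 : measurable_fun setT (fun p : T * R => (EFin \o a) p.2).
  exact: measurableT_comp.
apply/integrableP; split => //.
rewrite (@fubini_tonelli1 _ _ _ _ R m1 tau)//; last exact: measurableT_comp.
rewrite /fubini_F /= integral_cst//.
by rewrite lte_mul_pinfty// ?integral_ge0// ge0_fin_numE// integral_ge0.
Qed.

Let torus_fin : (tau setT < +oo)%E. Proof. by rewrite torus_setT ltry. Qed.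

Lemma intg_kernel_slice f g y : intg tau f -> intg tau g ->
  intg tau (fun s => f s / (2 * pi) + circle_kernel y s * g s).
Proof.
move=> jf jg; apply: intgD.
  by under eq_fun do rewrite mulrC; exact: intgZ.
apply: (@intgM_bounded _ _ _ _ 1 _ (circle_kernel y)) => //.
- exact: measurable_circle_kernel.
- exact: circle_kernel_le1.
Qed.

(** Fubini's theorem moves the kernel onto the factor b, where integrating it
    produces minus the periodic primitive of b. *)
Lemma integral_circle_kernel f g b beta (m : R) : intg tau f -> intg tau g ->
  continuous b -> (forall y, `|b y| <= 1) ->
  (forall y : R, is_derive y (1 : R) beta (b y - m)) -> beta 0 = 0 -> beta (2 * pi) = 0 ->
  (\int[tau]_y (b y * \int[tau]_s (f s / (2 * pi) + circle_kernel y s * g s))%:E =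
   \int[tau]_s (m * f s - beta s * g s)%:E)%E.
Proof.
move=> jf jg cb b1 dbeta beta0 betap.
have p0 : 0 < 2 * pi :> R by rewrite mulr_gt0 ?pi_gt0.
have mb : measurable_fun setT b by exact: continuous_measurable_fun.
have mbeta : measurable_fun setT beta.
  apply: continuous_measurable_fun => y.
  by apply/differentiable_continuous/derivable1_diffP; have [] := dbeta y.
have mf := intg_measurable jf; have mg := intg_measurable jg.
pose H (p : R * R) := b p.1 * (f p.2 / (2 * pi) + circle_kernel p.1 p.2 * g p.2).
have mH : measurable_fun setT H.
  apply: measurable_funM; first exact: measurableT_comp.
  apply: measurable_funD.
    by apply: measurable_funM => //; exact: measurableT_comp.
  apply: measurable_funM; last exact: measurableT_comp.
  exact: measurable_circle_kernel.
have jH : intg (tau \x tau)%E H.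
  apply: (@intg_le _ _ _ _ _ (fun p => `|f p.2| / (2 * pi) + `|g p.2|)) => //.
    move=> [y s] /=; rewrite normrM -[leRHS]mul1r ler_pM//.
    apply: le_trans (ler_normD _ _) _; rewrite !normrM [`|_^-1|]ger0_norm ?invr_ge0 ?(ltW p0)//.
    rewrite lerD2l -[leRHS]mul1r ler_pM// circle_kernel_le1//.
  have j1 := @intg_snd _ _ tau (fun s => `|f s|) torus_fin (integrable_norm jf).
  have j2 := @intg_snd _ _ tau (fun s => `|g s|) torus_fin (integrable_norm jg).
  have := intgD (intgZ (2 * pi)^-1 j1) j2; congr intg.
  by apply/funext => p; rewrite mulrC.
transitivity (\int[tau]_y \int[tau]_s (H (y, s))%:E)%E.
  apply: eq_integral => y _; have js := intg_kernel_slice y jf jg.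
  rewrite -(RintZ _ js) EFin_Rint//; exact: intgZ.
rewrite [LHS](@integral12_prod_meas1 _ _ _ _ R tau tau _ jH).
rewrite -(@integral21_prod_meas1 _ _ _ _ R tau tau _ jH).
apply: ae_eq_integral => //.
- exact: (@measurable_fubini_G _ _ _ _ R tau tau _ jH).
- apply/measurable_EFinP; apply: measurable_funB; exact: measurable_funM.
apply: torus_ae => s s02 _; rewrite /fubini_G /H /=.
pose B (y : R) := beta y + m * y.
have dB (y : R) : is_derive y (1 : R) B (b y).
  by apply: is_derive_eq; rewrite /= ?scaler1; ring.
have jb : intg tau b by exact: torus_intg_bounded b1.
have jsb : intg tau (fun y => (s < y)%R%:R * b y).
  apply: (@torus_intg_bounded 1).
    by apply: measurable_funM => //; exact: measurable_after.
  by move=> y; case: (s < y)%R; rewrite ?mul1r ?mul0r ?normr0.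
have E y : b y * (f s / (2 * pi) + circle_kernel y s * g s) =
    (f s / (2 * pi) + (s / (2 * pi) - 1) * g s) * b y + g s * ((s < y)%R%:R * b y).
  by rewrite circle_kernelE//; ring.
under eq_integral => y _ do rewrite E.
have jb1 := intgZ (f s / (2 * pi) + (s / (2 * pi) - 1) * g s) jb.
have jb2 := intgZ (g s) jsb.
rewrite -(EFin_Rint (intgD jb1 jb2)) (RintD jb1 jb2) (RintZ _ jb) (RintZ _ jsb); congr (_%:E).
have -> : \int[tau]_y ((s < y)%R%:R * b y) = B (2 * pi) - B s.
  by have := EFin_Rint jsb; rewrite (integral_torus_after s02 cb dB) => -[].
have -> : \int[tau]_y b y = B (2 * pi) - B 0.
  have := EFin_Rint jb; rewrite integral_torus; last exact/measurable_EFinP.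
  by rewrite (integral_primitive p0 cb dB) => -[].
rewrite /B beta0 betap; have := lt0r_neq0 p0; move: (2 * pi) => P P0; by field.
Qed.

End circle_kernel.

Section slice_representation.
Context {R : realType} (d : nat).
Local Notation V := ('rV[R]_d * R)%type.
Local Notation mu := (@leb_xy R d).
Local Notation tau := (@torus_measure R).
Implicit Types (f g : V -> R).

Lemma measurable_xs_prod (f : V -> R) : measurable_fun setT f ->
  measurable_fun setT (fun p : V * R => f (p.1.1, p.2)).
Proof.
move=> mf; apply: (measurableT_comp mf); apply/measurable_fun_pairP; split.
  exact: (measurableT_comp measurable_fst measurable_fst).
exact: measurable_snd.
Qed.

Lemma measurable_slice (x : 'rV[R]_d) (f : V -> R) : measurable_fun setT f ->
  measurable_fun setT (fun s => f (x, s)).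
Proof. by move=> mf; exact: (measurableT_comp mf (pair1_measurable x)). Qed.

Lemma measurable_slice_integral (k : V -> \bar R) : measurable_fun setT k ->
  (forall z, 0 <= k z)%E -> measurable_fun setT (fun x => \int[tau]_s k (x, s))%E.
Proof. by move=> mk k0; exact: measurable_fun_fubini_tonelli_F. Qed.

(** The integral over the slices {x} x T does not depend on y, so over a band
    R^d x Z it picks up the length of Z. *)
Lemma integral_band (k : V -> \bar R) (Z : set R) : measurable Z ->
  measurable_fun setT k -> (forall z, 0 <= k z)%E ->
  (\int[mu]_z ((\1_Z z.2)%:E * \int[tau]_s k (z.1, s)) = tau Z * \int[mu]_z k z)%E.
Proof.
move=> mZ mk k0; have mK := measurable_slice_integral mk k0.
have K0 x : (0 <= \int[tau]_s k (x, s))%E by apply: integral_ge0.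
rewrite (@fubini_tonelli1 _ _ _ _ R (lebesgue_rV d) tau (fun z => _ * _)%E); last 2 first.
- apply: emeasurable_funM; last exact: (measurableT_comp mK).
  by apply/measurable_EFinP; apply: measurableT_comp => //; exact: measurable_indic.
- by move=> z; rewrite mule_ge0// lee_fin.
rewrite (@fubini_tonelli1 _ _ _ _ R (lebesgue_rV d) tau k)//.
rewrite -(ge0_integralZl (lebesgue_rV d) measurableT mK)//.
apply: eq_integral => x _; rewrite /fubini_F /=.
under eq_integral => y _ do rewrite muleC.
rewrite ge0_integralZl//; last first.
  by apply/measurable_EFinP; exact: measurable_indic.
by rewrite integral_indic// setIT muleC.
Qed.

Definition slice_bound f g (x : 'rV[R]_d) : \bar R :=
  (\int[tau]_s (`|f (x, s)| / (2 * pi) + `|g (x, s)|)%:E)%E.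

(** The mean of f over the slice plus the function of mean zero with derivative g,
    whenever the slices of f and g are integrable and g has mean zero. *)
Definition slice_repr f g (z : V) : R :=
  \int[tau]_s (f (z.1, s) / (2 * pi) + circle_kernel z.2 s * g (z.1, s)).

Lemma measurable_slice_repr f g : measurable_fun setT f -> measurable_fun setT g ->
  measurable_fun setT (slice_repr f g).
Proof.
move=> mf mg.
pose H (p : V * R) := (f (p.1.1, p.2) / (2 * pi) + circle_kernel p.1.2 p.2 * g (p.1.1, p.2))%:E.
have mH : measurable_fun setT H.
  apply/measurable_EFinP; apply: measurable_funD.
    by apply: measurable_funM => //; exact: measurable_xs_prod.
  apply: measurable_funM; last exact: measurable_xs_prod.
  apply: measurable_circle_kernel => //.
  exact: (measurableT_comp measurable_snd measurable_fst).
have -> : slice_repr f g = fun z => fine (\int[tau]_s H^\+ (z, s) - \int[tau]_s H^\- (z, s))%E.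
  apply/funext => -[x y]; rewrite /slice_repr /Rintegral integralE; congr fine.
  by congr (_ - _)%E; apply: eq_integral => s _; rewrite ?funeposE ?funenegE.
apply: (measurableT_comp (@fine_measurable R setT measurableT)).
apply: emeasurable_funB.
- by apply: (@measurable_fun_fubini_tonelli_F _ _ _ _ R tau H^\+)%E => //; exact: measurable_funepos.
- by apply: (@measurable_fun_fubini_tonelli_F _ _ _ _ R tau H^\-)%E => //; exact: measurable_funeneg.
Qed.

Lemma slice_repr_le f g z : measurable_fun setT f -> measurable_fun setT g ->
  (`|slice_repr f g z|%:E <= slice_bound f g z.1)%E.
Proof.
case: z => x y mf mg; rewrite /slice_repr /=.
have slice := measurable_slice x.
have p0 : 0 < 2 * pi :> R by rewrite mulr_gt0 ?pi_gt0.
set k := fun s => `|f (x, s)| / (2 * pi) + `|g (x, s)|.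
have k0 s : 0 <= k s by rewrite addr_ge0 ?divr_ge0// ltW.
have mk : measurable_fun setT k.
  apply: measurable_funD; last by apply: measurableT_comp => //; exact: slice.
  by apply: measurable_funM => //; apply: measurableT_comp => //; exact: slice.
have [koo|] := ltP (slice_bound f g x) +oo%E; last first.
  by rewrite leye_eq => /eqP ->; rewrite leey.
have jk : intg tau k.
  apply/integrableP; split; first exact/measurable_EFinP.
  by under eq_integral => s _ do rewrite /= ger0_norm//.
set H := fun s => _.
have Hk s : `|H s| <= k s.
  apply: le_trans (ler_normD _ _) _.
  rewrite !normrM [`|_^-1|]ger0_norm ?invr_ge0 ?(ltW p0)//.
  by rewrite lerD2l -[leRHS]mul1r ler_pM// circle_kernel_le1.
have jH : intg tau H.
  apply: intg_le Hk jk; apply: measurable_funD.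
    by apply: measurable_funM => //; exact: slice.
  apply: measurable_funM; last exact: slice.
  exact: measurable_circle_kernel.
rewrite /slice_bound -(EFin_Rint jk) lee_fin.
apply: le_trans (le_normr_Rintegral measurableT jH) _.
apply: Rint_le => //; exact: integrable_norm.
Qed.

Lemma measurable_slice_density f g : measurable_fun setT f -> measurable_fun setT g ->
  measurable_fun setT (fun z => `|f z| / (2 * pi) + `|g z|).
Proof.
move=> mf mg; apply: measurable_funD; last exact: measurableT_comp.
by apply: measurable_funM => //; exact: measurableT_comp.
Qed.

Lemma slice_density_ge0 f g z : 0 <= `|f z| / (2 * pi) + `|g z|.
Proof. by rewrite addr_ge0 ?divr_ge0 ?mulr_ge0 ?pi_ge0. Qed.

Lemma intg_slice_repr f g : intg mu f -> intg mu g -> intg mu (slice_repr f g).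
Proof.
move=> jf jg; have mf := intg_measurable jf; have mg := intg_measurable jg.
have mF := measurable_slice_repr mf mg.
have mk := measurable_slice_density mf mg.
have k0 (z : V) : (0 <= (`|f z| / (2 * pi) + `|g z|)%:E)%E by rewrite lee_fin slice_density_ge0.
have mke : measurable_fun setT (fun z : V => (`|f z| / (2 * pi) + `|g z|)%:E).
  exact/measurable_EFinP.
have jk : intg mu (fun z => `|f z| / (2 * pi) + `|g z|).
  have := intgD (intgZ (2 * pi)^-1 (integrable_norm jf)) (integrable_norm jg).
  by congr intg; apply/funext => z; rewrite mulrC.
apply/integrableP; split; first exact/measurable_EFinP.
have := integral_band (Z := setT) measurableT mke k0.
move=> B; apply: (@le_lt_trans _ _ (\int[mu]_z ((\1_setT z.2)%:E * slice_bound f g z.1)))%E.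
  apply: ge0_le_integral => //.
  - by apply: measurableT_comp => //; exact/measurable_EFinP.
  - apply: emeasurable_funM.
      apply/measurable_EFinP; apply: measurableT_comp => //; exact: measurable_indic.
    have mK := measurable_slice_integral mke k0.
    exact: (measurableT_comp mK).
  - by move=> z _; rewrite indicT mul1e; exact: slice_repr_le.
rewrite B torus_setT -(EFin_Rint jk) -EFinM; exact: ltry.
Qed.

Lemma partial_y_product (beta db : R -> R) (eta : 'rV[R]_d -> R) z :
  (forall y : R, is_derive y (1 : R) beta (db y)) ->
  smooth (fun z : V => beta z.2) -> smooth (fun z : V => eta z.1) ->
  partial_xy None (fun z : V => beta z.2 * eta z.1) z = db z.2 * eta z.1.
Proof.
case: z => x y dbeta sb se.
have [_ _ <-] := smooth_slice_y x (smoothM sb se); rewrite /=.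
have D : is_derive y (1 : R) (fun y => beta y * eta x) (db y * eta x).
  under eq_fun do rewrite mulrC; rewrite mulrC; exact: is_deriveZ.
by rewrite (@derive_val _ _ _ _ _ _ _ D).
Qed.

(** Tested against b(y) eta(x), the kernel produces minus the periodic primitive
    beta of b, and testing the weak derivative g against beta(y) eta(x) gives back
    f. *)
Lemma slice_representation f g : intg mu f -> intg mu g ->
  is_weak_deriv mu (@test_xy R d) (@partial_xy R d) None f g ->
  ae_eq mu setT f (slice_repr f g).
Proof.
move=> jf jg wfg; have jF := intg_slice_repr jf jg.
have mf := intg_measurable jf; have mg := intg_measurable jg.
suff : ae_eq mu setT (fun z => f z - slice_repr f g z) (cst 0).
  by apply: filterS => z Hz Dz; apply/eqP; rewrite -subr_eq0; apply/eqP/Hz.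
apply: fundamental_lemma_L1; first exact: intgB.
move=> phi pphi; have tphi := product_test_test pphi.
have [C C0 phiC] := test_bounded tphi; have mphi := test_measurable tphi.
have jphi (h : V -> R) : intg mu h -> intg mu (fun z => h z * phi z).
  by move=> jh; under eq_fun do rewrite mulrC; exact: (intgM_bounded mphi phiC).
under eq_Rint => z do rewrite mulrBl.
rewrite RintB; [|exact: jphi|exact: jphi]; apply/eqP; rewrite subr_eq0 eq_sym; apply/eqP.
have [b [eta [sb pb b1 te phiE]]] := pphi.
have [beta [m [sbeta pbeta beta0 dbeta]]] := periodic_primitive sb pb.
have betap : beta (2 * pi) = 0 by have := pbeta 0; rewrite add0r beta0.
have se := test_smooth te.
have tb : test_xy (fun z : V => beta z.2 * eta z.1) by apply: testM => // x y; exact: pbeta.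
have [C1 C10 etaC] := test_bounded te; have meta := test_measurable te.
have [C2 C20 bC] := test_bounded tb; have mbeta := test_measurable tb.
have jfe : intg mu (fun z => eta z.1 * f z) by exact: (intgM_bounded meta etaC).
have jgb : intg mu (fun z => beta z.2 * eta z.1 * g z) by exact: (intgM_bounded mbeta bC).
transitivity (\int[mu]_z (m * (eta z.1 * f z) - beta z.2 * eta z.1 * g z)).
  have jL := jphi _ jF; have jR := intgB (intgZ m jfe) jgb.
  rewrite /Rintegral; congr fine.
  rewrite -(@integral12_prod_meas1 _ _ _ _ R (lebesgue_rV d) tau _ jL).
  rewrite -(@integral12_prod_meas1 _ _ _ _ R (lebesgue_rV d) tau _ jR).
  apply: ae_eq_integral => //.
  - exact: (@measurable_fubini_F _ _ _ _ R (lebesgue_rV d) tau _ jL).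
  - exact: (@measurable_fubini_F _ _ _ _ R (lebesgue_rV d) tau _ jR).
  have af := @ae_integrable1 _ _ _ _ R (lebesgue_rV d) tau _ jf.
  have ag := @ae_integrable1 _ _ _ _ R (lebesgue_rV d) tau _ jg.
  apply: filterS2 af ag => x jfx jgx _; rewrite /fubini_F /=.
  have jfx' := intgZ (eta x) jfx; have jgx' := intgZ (eta x) jgx.
  have := integral_circle_kernel jfx' jgx' (continuous_lift_y sb) b1 dbeta beta0 betap.
  move=> E; transitivity (\int[tau]_s (m * (eta x * f (x, s)) - beta s * (eta x * g (x, s)))%:E)%E.
    rewrite -E; apply: eq_integral => y _; congr (_%:E).
    rewrite phiE /slice_repr /= mulrCA; congr (_ * _).
    rewrite mulrC -RintZ; last exact: intg_kernel_slice.
    by apply: eq_Rint => s; ring.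
  by apply: eq_integral => s _; congr (_%:E); ring.
rewrite RintB// ?RintZ//; last exact: intgZ.
have := wfg _ tb.
under eq_Rint => z do rewrite (partial_y_product z dbeta sbeta se).
have -> : \int[mu]_z (g z * (beta z.2 * eta z.1)) = \int[mu]_z (beta z.2 * eta z.1 * g z).
  by apply: eq_Rint => z; rewrite mulrC.
move=> <-; rewrite -RintZ// -RintD; last 2 first.
- exact: intgZ.
- have := intgB (jphi _ jf) (intgZ m jfe); congr intg; apply/funext => z; rewrite phiE; ring.
by apply: eq_Rint => z; rewrite phiE; ring.
Qed.

End slice_representation.

(** * No concentration in the transverse direction *)

Section nonconcentration.
Context {R : realType} (d : nat).
Local Notation V := ('rV[R]_d * R)%type.
Local Notation mu := (@leb_xy R d).
Local Notation tau := (@torus_measure R).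

Lemma torus_cauchy_schwarz (a : R -> R) : L2 tau a -> intg tau a ->
  (\int[tau]_s a s) ^+ 2 <= 2 * pi * \int[tau]_s (a s ^+ 2).
Proof.
move=> [ma ja2] ja; have p0 : 0 < 2 * pi :> R by rewrite mulr_gt0 ?pi_gt0.
have j1 (C : R) : intg tau (fun=> C) by apply: (@torus_intg_bounded _ `|C|).
set I := \int[tau]_s a s; pose c := I / (2 * pi).
have : 0 <= \int[tau]_s (a s - c) ^+ 2 by apply: Rint_ge0 => s; exact: sqr_ge0.
have E s : (a s - c) ^+ 2 = a s ^+ 2 - 2 * c * a s + c ^+ 2 by ring.
under eq_Rint => s do rewrite E.
rewrite RintD//; last by apply: intgB => //; exact: intgZ.
rewrite RintB//; last exact: intgZ.
rewrite RintZ// -/I.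
have -> : \int[tau]_s (c ^+ 2 : R) = 2 * pi * c ^+ 2.
  by rewrite /Rintegral integral_cst//= torus_setT /= mulrC.
have IE : I = c * (2 * pi) by rewrite /c divfK// gt_eqF.
rewrite IE; move: (\int[tau]_s _) => J H.
have -> : (c * (2 * pi)) ^+ 2 = 2 * pi * (2 * pi * c ^+ 2) by ring.
rewrite ler_pM2l//; move: H; set P := 2 * pi in p0 *; nra.
Qed.

Lemma sqrD_le_half (p a b : R) : 0 <= p -> p <= a -> 0 <= b ->
  (p + b) ^+ 2 <= 2 * (a ^+ 2 + b ^+ 2).
Proof. by move=> p0 pa b0; have := sqr_ge0 (a - b); nra. Qed.

(** The embedding of H^1 of the circle into the bounded functions, on almost every
    slice. The weight makes f and its derivative integrable and cancels at the
    end, being constant on slices. *)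
Lemma slice_sup_bound (f : V -> R) G : has_gradient f G ->
  {ae mu, forall z, ((f z ^+ 2)%:E <=
    (4 * pi)%:E * \int[tau]_s (f (z.1, s) ^+ 2 + G None (z.1, s) ^+ 2)%:E)%E}.
Proof.
move=> hf; have [lf df] := hf; have [lg wg] := df None.
have mf := L2_measurable lf; have mg := L2_measurable lg.
have l1 := L2_weight d (@ltr01 R).
have Cw (j : option 'I_d) (z : V) : `|partial_xy j (weight 1) z| <= 1.
  case: j => [i|]; last by rewrite partial_weight_y normr0.
  by apply: le_trans (partial_weight_le i z ler01) _; rewrite mul1r weight_le1.
have [_ /(_ None)[_ wwg]] := has_gradientM (smooth_weight d 1) (@periodic_weight _ _ 1)
  (weight_norm 1) Cw hf.
have jf : intg mu (fun z => weight 1 z * f z) by exact: L2_mul.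
have jg : intg mu (fun z => weight 1 z * G None z) by exact: L2_mul.
have wE : (fun z => weight 1 z * G None z + partial_xy None (weight 1) z * f z) =
    (fun z => weight 1 z * G None z).
  by apply/funext => z; rewrite partial_weight_y mul0r addr0.
rewrite wE in wwg.
apply: filterS (slice_representation jf jg wwg) => -[x y] /(_ Logic.I) fE /=.
have slice := measurable_slice x.
pose a s := `|f (x, s)| / (2 * pi) + `|G None (x, s)|.
have p0 : 0 < 2 * pi :> R by rewrite mulr_gt0 ?pi_gt0.
have a0 s : 0 <= a s by rewrite addr_ge0 ?divr_ge0// ltW.
have ma : measurable_fun setT a.
  apply: measurable_funD; last by apply: measurableT_comp => //; exact: slice.
  by apply: measurable_funM => //; apply: measurableT_comp => //; exact: slice.
have fa : (`|f (x, y)|%:E <= \int[tau]_s (a s)%:E)%E.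
  have := @slice_repr_le _ _ _ _ (x, y) (intg_measurable jf) (intg_measurable jg).
  rewrite -fE /slice_bound /= normrM (ger0_norm (ltW (weight_gt0 1 _))).
  set w := weight 1 (x, y); have w0 : 0 < w by exact: weight_gt0.
  have E s : (`|weight 1 (x, s) * f (x, s)| / (2 * pi) +
      `|weight 1 (x, s) * G None (x, s)|)%:E = (w%:E * (a s)%:E)%E.
    rewrite -[weight 1 (x, s)]/w !normrM (gtr0_norm w0) -EFinM /a; congr (_%:E); ring.
  under eq_integral => s _ do rewrite E.
  rewrite ge0_integralZl//; last 3 first.
  - exact/measurable_EFinP.
  - by move=> s _; rewrite lee_fin.
  - by rewrite lee_fin ltW.
  by rewrite EFinM lee_pmul2l.
have [koo|] := ltP (\int[tau]_s (f (x, s) ^+ 2 + G None (x, s) ^+ 2)%:E)%E +oo%E; last first.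
  by rewrite leye_eq => /eqP ->; rewrite gt0_muley ?leey// lte_fin mulr_gt0 ?pi_gt0.
have k0 s : 0 <= f (x, s) ^+ 2 + G None (x, s) ^+ 2 by rewrite addr_ge0 ?sqr_ge0.
have mk : measurable_fun setT (fun s => f (x, s) ^+ 2 + G None (x, s) ^+ 2).
  by apply: measurable_funD; apply: measurable_funX; exact: slice.
have jk : intg tau (fun s => f (x, s) ^+ 2 + G None (x, s) ^+ 2).
  apply/integrableP; split; first exact/measurable_EFinP.
  by under eq_integral => s _ do rewrite /= ger0_norm//.
have ak s : a s ^+ 2 <= 2 * (f (x, s) ^+ 2 + G None (x, s) ^+ 2).
  have q1 : `|f (x, s)| / (2 * pi) <= `|f (x, s)|.
    rewrite ler_pdivrMr// ler_peMr//; have := @pi_ge2 R; lra.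
  have q0 : 0 <= `|f (x, s)| / (2 * pi) by rewrite divr_ge0// ltW.
  rewrite /a -(real_normK (num_real (f (x, s)))) -(real_normK (num_real (G None (x, s)))).
  exact: sqrD_le_half.
have ja2 : intg tau (fun s => a s ^+ 2).
  apply: intg_le (intgZ 2 jk); first exact: measurable_funX.
  by move=> s; rewrite ger0_norm ?sqr_ge0.
have ja : intg tau a.
  have j1 : intg tau (fun=> 1) by apply: (@torus_intg_bounded _ 1) => // _; rewrite normr1.
  apply: intg_le (intgD j1 ja2) => // s.
  rewrite (ger0_norm (a0 s)); have := a0 s; move: (a s) => t; nra.
move: fa; rewrite -(EFin_Rint ja) -(EFin_Rint jk) -EFinM !lee_fin => fa.
rewrite -(real_normK (num_real (f (x, y)))).
apply: (@le_trans _ _ ((\int[tau]_s a s) ^+ 2)).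
  by rewrite ler_sqr ?nnegrE// (le_trans _ fa).
apply: le_trans (torus_cauchy_schwarz (conj ma ja2) ja) _.
have := Rint_le ja2 (intgZ 2 jk) ak; rewrite (RintZ _ jk).
by rewrite -(ler_pM2l p0) => /le_trans; apply; rewrite mulrA (_ : 2 * pi * 2 = 4 * pi)//; ring.
Qed.

Lemma measurable_band (Z : set R) : measurable Z ->
  measurable_fun setT (fun z : V => \1_Z z.2 : R).
Proof. by move=> mZ; apply: measurableT_comp => //; exact: measurable_indic. Qed.

Lemma intg_band (Z : set R) (u : V -> R[i]) : measurable Z -> L2C u ->
  intg mu (fun z => \1_Z z.2 * sq (u z)).
Proof.
move=> mZ /intg_sq; apply: (intgM_bounded (C := 1) (measurable_band mZ)) => z.
by rewrite indicE; case: (_ \in _); rewrite ?normr1 ?normr0.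
Qed.

(** The slice bound integrated over R^d x Z. *)
Lemma mass_band u du (Z : set R) (l : R) : field_gradient u du -> measurable Z ->
  (tau Z <= l%:E)%E ->
  \int[mu]_z (\1_Z z.2 * sq (u z)) <= 4 * pi * l * (Mass u + KinY du).
Proof.
move=> fu mZ Zl; have lu := field_gradient_L2C fu; have ldu := field_gradient_dL2C None fu.
have [_ ru iu] := fu; have p4 : 0 < 4 * pi :> R by rewrite mulr_gt0 ?pi_gt0.
have ju := intg_sq lu; have jdu := intg_sq ldu; have jK := intgD ju jdu.
have mK : measurable_fun setT (fun z => (sq (u z) + sq (du None z))%:E).
  by apply/measurable_EFinP; exact: intg_measurable jK.
have K0 z : (0 <= (sq (u z) + sq (du None z))%:E)%E by rewrite lee_fin addr_ge0 ?sq_ge0.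
have mZz := measurable_band mZ; have jZ := intg_band mZ lu.
have KK : {ae mu, forall z, ((sq (u z))%:E <=
    (4 * pi)%:E * \int[tau]_s (sq (u (z.1, s)) + sq (du None (z.1, s)))%:E)%E}.
  apply: filterS2 (slice_sup_bound ru) (slice_sup_bound iu) => -[x y] /= h1 h2.
  have slice (h : V -> R) : measurable_fun setT h ->
      measurable_fun setT (fun s => (h (x, s))%:E).
    by move=> mh; apply/measurable_EFinP; exact: measurable_slice.
  rewrite {1}/sq EFinD; apply: le_trans (leeD h1 h2) _.
  rewrite -ge0_muleDr; last 2 first.
  - by apply: integral_ge0 => s _; rewrite lee_fin addr_ge0 ?sqr_ge0.
  - by apply: integral_ge0 => s _; rewrite lee_fin addr_ge0 ?sqr_ge0.
  have mm f G : @has_gradient R d f G -> measurable_fun setT (fun z => f z ^+ 2 + G None z ^+ 2).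
    move=> [[mf _] /(_ None)[[mg _] _]].
    by apply: measurable_funD; exact: measurable_funX.
  rewrite -ge0_integralD//; last 4 first.
  - by move=> s _; rewrite lee_fin addr_ge0 ?sqr_ge0.
  - exact: (slice _ (mm _ _ ru)).
  - by move=> s _; rewrite lee_fin addr_ge0 ?sqr_ge0.
  - exact: (slice _ (mm _ _ iu)).
  apply: lee_wpmul2l; first by rewrite lee_fin ltW.
  rewrite le_eqVlt; apply/orP; left; apply/eqP; apply: eq_integral => s _.
  by rewrite -EFinD /sq; congr (_%:E); ring.
have l0 : 0 <= l by rewrite -lee_fin (le_trans _ Zl).
rewrite -lee_fin (EFin_Rint jZ) /Mass /KinY -(RintD ju jdu) EFinM (EFin_Rint jK).
apply: (@le_trans _ _ (\int[mu]_z ((4 * pi)%:E * ((\1_Z z.2)%:E *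
    \int[tau]_s (sq (u (z.1, s)) + sq (du None (z.1, s)))%:E)))%E).
  apply: ae_ge0_le_integral => //.
  - by move=> z _; rewrite lee_fin mulr_ge0 ?sq_ge0.
  - by apply/measurable_EFinP; exact: intg_measurable jZ.
  - move=> z _; apply: mule_ge0; first by rewrite lee_fin ltW.
    apply: mule_ge0; first by rewrite lee_fin.
    by apply: integral_ge0 => s _; exact: K0.
  - apply: measurable_funeM; apply: emeasurable_funM; first exact/measurable_EFinP.
    exact: (measurableT_comp (measurable_slice_integral mK K0)).
  - apply: filterS KK => z Hz _; rewrite EFinM muleCA.
    by apply: lee_wpmul2l; rewrite ?lee_fin.
rewrite ge0_integralZl//; last 3 first.
- apply: emeasurable_funM; first exact/measurable_EFinP.
  exact: (measurableT_comp (measurable_slice_integral mK K0)).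
- move=> z _; apply: mule_ge0; first by rewrite lee_fin.
  by apply: integral_ge0 => s _; exact: K0.
- by rewrite lee_fin ltW.
rewrite (integral_band mZ mK K0) [(4 * pi * l)%:E]EFinM -[leRHS]muleA.
apply: lee_wpmul2l; first by rewrite lee_fin ltW.
apply: lee_wpmul2r => //.
by apply: integral_ge0 => z _; exact: K0.
Qed.

Lemma cos_gt_arc (rho t : R) : 0 < rho <= pi -> - (2 * pi) < t < 2 * pi ->
  cos rho < cos t -> `|t| < rho \/ 2 * pi - rho < `|t|.
Proof.
move=> /andP[r0 rp] /andP[t1 t2]; have -> : cos t = cos `|t| by rewrite cos_norm.
have tp : 0 <= `|t| < 2 * pi by rewrite normr_ge0 /= ltr_norml t1.
move: {t1 t2} `|t| tp => s /andP[s0 s2] crs.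
have [|rs] := ltP s rho; [by left|right].
have rc : rho \in `[0, pi] by rewrite in_itv /= (ltW r0).
have [sp|ps] := leP s pi.
  have sc : s \in `[0, pi] by rewrite in_itv /= s0.
  by move: crs; rewrite (ltr_cos sc rc) => /(le_lt_trans rs); rewrite ltxx.
have sE : cos s = cos (2 * pi - s).
  by rewrite mulr_natl cosB cos2pi sin2pi mul1r mul0r addr0.
have sc : 2 * pi - s \in `[0, pi] by rewrite in_itv /=; lra.
by move: crs; rewrite sE (ltr_cos sc rc); lra.
Qed.

(** A set of angles whose points are pairwise close on the circle lies, as a
    subset of [0, 2 pi), in one arc around any of its points, i.e. in three
    intervals because of the wrap-around. *)
Lemma torus_arc (Z : set R) (rho : R) : measurable Z -> 0 < rho <= pi ->
  (forall y y', Z y -> Z y' -> cos rho < cos (y - y')) ->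
  (tau Z <= (6 * rho)%:E)%E.
Proof.
move=> mZ rr HZ; have r0 : 0 < rho by case/andP: rr.
have [[y0 [Zy0 y02]]|nZ] := pselect (exists y, Z y /\ 0 <= y < 2 * pi); last first.
  rewrite (_ : tau Z = 0%E) ?lee_fin ?mulr_ge0 ?ltW// /torus_measure.
  rewrite (_ : Z `&` _ = set0) ?measure0//; apply/seteqP; split => // y [Zy] /=.
  by rewrite in_itv /= => yc; apply: nZ; exists y.
pose I (k : R) : set (measurableTypeR R) := `](y0 + k - rho), (y0 + k + rho)[%classic.
have mI k : measurable (I k) by exact: measurable_itv.
have lI k : lebesgue_measure (I k) = (2 * rho)%:E.
  rewrite lebesgue_measure_itv /= lte_fin ifT; last by lra.
  by rewrite -EFinB; congr (_%:E); ring.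
apply: (@le_trans _ _ (lebesgue_measure (I 0 `|` I (2 * pi) `|` I (- (2 * pi))))).
  apply: le_measure; rewrite ?inE.
  - by apply: measurableI; [exact: mZ|exact: measurable_itv].
  - by apply: measurableU => //; apply: measurableU.
  move=> y [Zy] /=; rewrite in_itv /= => y2.
  have := HZ _ _ Zy Zy0; move=> /(cos_gt_arc rr)[].
  - lra.
  - by rewrite ltr_norml => ?; left; left; rewrite /I /= in_itv /=; lra.
  - have [yy|yy] := leP 0 (y - y0); rewrite ?(ger0_norm yy) ?(ltr0_norm yy) => h.
      by left; right; rewrite /I /= in_itv /=; lra.
    by right; rewrite /I /= in_itv /=; lra.
have U := @measureU2 _ _ _ (@lebesgue_measure R).
apply: le_trans (U _ _ _ (mI _)) _; first exact: measurableU.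
apply: le_trans (leeD2r _ (U _ _ (mI _) (mI _))) _.
by rewrite /= !lI -!EFinD lee_fin; lra.
Qed.

(** The mass in a band is at most a constant times its length, so at least half of
    it sits at angles at a definite distance from a given point (m1, m2) of the
    plane. *)
Lemma nonconcentration (c B : R) : 0 < c -> 0 <= B ->
  exists2 e : R, 0 < e & forall u du (m1 m2 : R), field_gradient u du ->
    c <= Mass u -> KinY du <= B ->
    e * Mass u <= \int[mu]_z (((cos z.2 - m1) ^+ 2 + (sin z.2 - m2) ^+ 2) * sq (u z)).
Proof.
move=> c0 B0; have p2 : 2 <= pi :> R by exact: pi_ge2.
have p0 : 0 < pi :> R by exact: pi_gt0.
have cB : 0 < c + B by lra.
(* The angles at squared distance less than r2 from (m1, m2) form a set of measure
   at most 6 rho; with this rho, mass_band leaves at most half of the mass there. *)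
pose rho := c / (48 * pi * (c + B)).
have den0 : 0 < 48 * pi * (c + B) by rewrite !mulr_gt0.
have r0 : 0 < rho by rewrite divr_gt0.
have r1 : rho <= 1.
  rewrite ler_pdivrMr// mul1r; apply: (@le_trans _ _ (1 * (c + B))); first by rewrite mul1r; lra.
  by rewrite ler_pM2r//; lra.
have rr : 0 < rho <= pi by rewrite r0 /=; lra.
pose r2 := (1 - cos rho) / 2.
have r20 : 0 < r2.
  rewrite divr_gt0// subr_gt0 -(@cos0 R) ltr_cos ?in_itv /= ?lexx//; lra.
exists (r2 / 2) => [|u du m1 m2 fu cM YB]; first exact: divr_gt0.
pose D (y : R) := (cos y - m1) ^+ 2 + (sin y - m2) ^+ 2.
have D0 y : 0 <= D y by rewrite addr_ge0 ?sqr_ge0.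
have mD : measurable_fun setT D.
  apply: measurable_funD; apply: measurable_funX; apply: measurable_funB => //.
    by apply: continuous_measurable_fun => y; exact: continuous_cos.
  by apply: continuous_measurable_fun => y; exact: continuous_sin.
pose Z := [set y | D y < r2].
have mZ : measurable Z.
  have := mD measurableT `]-oo, r2[%classic (measurable_itv _).
  by rewrite setTI; congr measurable; apply/seteqP; split => y /=; rewrite in_itv.
have HZ y y' : Z y -> Z y' -> cos rho < cos (y - y').
  rewrite /Z /= /r2 cosB => h h'.
  have := cos2Dsin2 y; have := cos2Dsin2 y'.
  move: h h'; rewrite /D; move: (cos y) (sin y) (cos y') (sin y') (cos rho).
  clear => a b a' b' k h h' e e'.
  have := sqr_ge0 (a + a' - 2 * m1); have := sqr_ge0 (b + b' - 2 * m2); nra.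
have tZ := torus_arc mZ rr HZ.
have band := mass_band fu mZ tZ.
have ju := intg_sq (field_gradient_L2C fu).
have mDz : measurable_fun setT (fun z : V => D z.2) by exact: measurableT_comp.
have DC (z : V) : `|D z.2| <= (1 + `|m1|) ^+ 2 + (1 + `|m2|) ^+ 2.
  rewrite ger0_norm// /D -(real_normK (num_real (cos z.2 - m1))) -(real_normK (num_real (sin z.2 - m2))).
  rewrite lerD// ler_sqr ?nnegrE ?addr_ge0//.
    by apply: le_trans (ler_normB _ _) _; rewrite lerD2r cos_max.
  by apply: le_trans (ler_normB _ _) _; rewrite lerD2r sin_max.
have jD : intg mu (fun z => D z.2 * sq (u z)) by exact: (intgM_bounded mDz DC).
have jZ := intg_band mZ (field_gradient_L2C fu).
have H (z : V) : r2 * (sq (u z) - \1_Z z.2 * sq (u z)) <= D z.2 * sq (u z).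
  have s0 := sq_ge0 (u z); rewrite indicE; case: (boolP (z.2 \in Z)) => [_|zZ].
    by rewrite mul1r subrr mulr0 mulr_ge0.
  rewrite mul0r subr0 ler_wpM2r// leNgt; apply/negP => h.
  by move: zZ; rewrite notin_setE.
have := Rint_le (intgZ r2 (intgB ju jZ)) jD H.
rewrite (RintZ _ (intgB ju jZ)) (RintB ju jZ); apply: le_trans.
rewrite -mulrA ler_pM2l//.
have half : 4 * pi * (6 * rho) * (Mass u + KinY du) <= Mass u / 2.
  have M0 : 0 < Mass u by apply: lt_le_trans cM.
  apply: (@le_trans _ _ (4 * pi * (6 * rho) * (Mass u + B))).
    apply: ler_wpM2l; last by rewrite lerD2l.
    by apply: mulr_ge0; apply: mulr_ge0 => //; exact: ltW.
  have -> : 4 * pi * (6 * rho) * (Mass u + B) = (c * (Mass u + B) / (c + B)) / 2.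
    have cBn : c + B != 0 by rewrite gt_eqF.
    have pin : pi != 0 :> R by rewrite gt_eqF.
    by rewrite /rho; move: pi pin cBn {M0} => P Pn cBn; field; rewrite cBn Pn.
  rewrite ler_pM2r ?invr_gt0// ler_pdivrMr//.
  move: cM B0 M0; move: (Mass u) => M; clear => *; nra.
move: band half; rewrite /Mass; lra.
Qed.

End nonconcentration.

(** * Trigonometric modulation *)

Section modulation.
Context {R : realType} (d : nat).
Local Notation V := ('rV[R]_d * R)%type.
Local Notation mu := (@leb_xy R d).
Implicit Types (u v : V -> R[i]) (du dv : option 'I_d -> V -> R[i]).

(** Spectral factorisation: 1 + sg (cos t - m) = |a + b e^{it}|^2. *)
Lemma modulation_coefs (sg m : R) : 0 < sg -> sg <= 1 / 4 -> `|m| <= 1 ->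
  exists a b : R, [/\ a ^+ 2 + b ^+ 2 = 1 - sg * m, 2 * a * b = sg & b ^+ 2 <= sg ^+ 2].
Proof.
rewrite ler_norml => s0 s4 /andP[m1 m2].
have h1 : sg * m <= sg by rewrite ler_piMr// ltW.
have h2 : - sg <= sg * m by rewrite -mulrN1 ler_pM2l.
have e1 : 0 <= 1 - sg * m + sg by lra.
have e2 : 1 / 4 <= 1 - sg * m - sg by lra.
have e3 : 0 <= 1 - sg * m - sg by lra.
have [A A0 AA] : exists2 A, 0 <= A & A ^+ 2 = 1 - sg * m - sg.
  by exists (Num.sqrt (1 - sg * m - sg)); rewrite ?sqr_sqrtr.
have [B B0 BB] : exists2 B, 0 <= B & B ^+ 2 = 1 - sg * m + sg.
  by exists (Num.sqrt (1 - sg * m + sg)); rewrite ?sqr_sqrtr.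
have AA2 : 1 / 2 <= A.
  rewrite leNgt; apply/negP => A2; have : A ^+ 2 < 1 / 4 by nra.
  lra.
have BB2 : 1 / 2 <= B.
  rewrite leNgt; apply/negP => B2; have : B ^+ 2 < 1 / 4 by nra.
  lra.
exists ((B + A) / 2), ((B - A) / 2); split; first by lra.
- have -> : 2 * ((B + A) / 2) * ((B - A) / 2) = (B ^+ 2 - A ^+ 2) / 2 by field.
  lra.
have ab : (B - A) * (B + A) = 2 * sg by lra.
have b0 : 0 <= B - A.
  rewrite -(pmulr_lge0 _ (x := B + A)); first by rewrite ab; lra.
  lra.
have b1 : B - A <= 2 * sg by nra.
by nra.
Qed.

Lemma sqD_le (e : R) w w' : 0 < e -> sq (w + w') <= (1 + e) * sq w + (1 + e^-1) * sq w'.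
Proof.
move=> e0; case: w => x y; case: w' => x' y'; rewrite /sq /=.
have en : e != 0 by rewrite gt_eqF.
have := sqr_ge0 (e * x - x'); have := sqr_ge0 (e * y - y') => h1 h2.
have ei : 0 < e^-1 by rewrite invr_gt0.
have : 0 <= e^-1 * ((e * x - x') ^+ 2 + (e * y - y') ^+ 2).
  by rewrite mulr_ge0 ?addr_ge0// ltW.
have -> : e^-1 * ((e * x - x') ^+ 2 + (e * y - y') ^+ 2) =
  e * (x ^+ 2 + y ^+ 2) - 2 * (x * x' + y * y') + e^-1 * (x' ^+ 2 + y' ^+ 2) by field.
lra.
Qed.

(** The function cos (y - t), where (p1, p2) = (cos t, sin t). *)
Definition tilt (p1 p2 y : R) : R := p1 * cos y + p2 * sin y.

Lemma tilt_sqr_le1 p1 p2 y : p1 ^+ 2 + p2 ^+ 2 = 1 -> tilt p1 p2 y ^+ 2 <= 1.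
Proof.
rewrite /tilt; have := cos2Dsin2 y; move: (cos y) (sin y) => C S e p.
have <- : (p1 ^+ 2 + p2 ^+ 2) * (C ^+ 2 + S ^+ 2) = 1 by rewrite e p mulr1.
have := sqr_ge0 (p1 * S - p2 * C); nra.
Qed.

Lemma tilt_norm_le1 p1 p2 y : p1 ^+ 2 + p2 ^+ 2 = 1 -> `|tilt p1 p2 y| <= 1.
Proof. by move=> /(tilt_sqr_le1 y); rewrite -[X in X <= _](real_normK (num_real _)) expr_le1. Qed.

(** Multiply u by a + b e^{i (y - t)} with the coefficients of modulation_coefs.
    Derivatives in x only see the modulus of this factor, and its derivative in y
    has modulus |b| <= sg. *)
Lemma field_gradient_modulation u du (sg p1 p2 m : R) : field_gradient u du ->
  0 < sg -> sg <= 1 / 4 -> p1 ^+ 2 + p2 ^+ 2 = 1 -> `|m| <= 1 ->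
  exists v dv, [/\ field_gradient v dv,
    forall z, sq (v z) = (1 + sg * (tilt p1 p2 z.2 - m)) * sq (u z),
    forall i z, sq (dv (Some i) z) = (1 + sg * (tilt p1 p2 z.2 - m)) * sq (du (Some i) z) &
    KinY dv <= (1 + 4 * sg) * KinY du + 2 * sg * Mass u].
Proof.
move=> fu s0 s4 p12 m1; have [a [b [ab1 ab2 b2]]] := modulation_coefs s0 s4 m1.
pose h (z : V) := tilt p1 p2 z.2; pose k (z : V) := p1 * sin z.2 - p2 * cos z.2.
pose g1 z := a + b * h z; pose g2 z := b * k z.
have sc : smooth (fun z : V => cos z.2) by apply: cos_smooth; exact: smooth_snd.
have ss : smooth (fun z : V => sin z.2) by apply: sin_smooth; exact: smooth_snd.
have sh : smooth h by apply: smoothD; exact: smoothZ.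
have sk : smooth k.
  by apply: smoothD; [exact: smoothZ|under eq_fun do rewrite -mulNr; exact: smoothZ].
have sg1 : smooth g1 by apply: smoothD; [exact: smooth_cst|exact: smoothZ].
have sg2 : smooth g2 by exact: smoothZ.
have pc (y : R) : cos (y + 2 * pi) = cos y by rewrite mulr_natl cosD2pi.
have ps (y : R) : sin (y + 2 * pi) = sin y by rewrite mulr_natl sinD2pi.
have pg1 : periodic_y g1 by move=> x y; rewrite /g1 /h /tilt /= pc ps.
have pg2 : periodic_y g2 by move=> x y; rewrite /g2 /k /= pc ps.
have hk z : h z ^+ 2 + k z ^+ 2 = 1.
  rewrite -[RHS](cos2Dsin2 z.2) -[RHS]mul1r -p12 /h /k /tilt; ring.
have h1 z : `|h z| <= 1 by exact: tilt_norm_le1.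
have k1 z : `|k z| <= 1.
  by rewrite -(@expr_le1 _ 2)// real_normK ?num_real//; have := hk z; have := sqr_ge0 (h z); lra.
have dcos j z : partial_xy j (fun z : V => cos z.2) z = - sin z.2 * (j == None)%:R.
  by rewrite (partial_cos (@smooth_snd R d) (partial_snd j z)).
have dsin j z : partial_xy j (fun z : V => sin z.2) z = cos z.2 * (j == None)%:R.
  by rewrite (partial_sin (@smooth_snd R d) (partial_snd j z)).
have dZ (c : R) (f : V -> R) j z : smooth f ->
    partial_xy j (fun z => c * f z) z = c * partial_xy j f z.
  by move=> sf; rewrite /partial_xy deriveZ//; exact: smooth_derivable.
have dD (f f' : V -> R) j z : smooth f -> smooth f' ->
    partial_xy j (fun z => f z + f' z) z = partial_xy j f z + partial_xy j f' z.
  by move=> sf sf'; rewrite /partial_xy deriveD//; exact: smooth_derivable.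
have dh j z : partial_xy j h z = - k z * (j == None)%:R.
  rewrite /h /tilt dD; [|exact: smoothZ|exact: smoothZ].
  by rewrite !dZ// dcos dsin /k; ring.
have dk j z : partial_xy j k z = h z * (j == None)%:R.
  rewrite /k; under eq_fun do rewrite -mulNr; rewrite dD; [|exact: smoothZ|exact: smoothZ].
  by rewrite !dZ// dcos dsin /h /tilt; ring.
have dg1 j z : partial_xy j g1 z = - g2 z * (j == None)%:R.
  rewrite /g1 dD; [|exact: smooth_cst|exact: smoothZ].
  rewrite dZ// dh (_ : partial_xy j (fun=> a) z = 0) ?/g2; last exact: derive_cst.
  ring.
have dg2 j z : partial_xy j g2 z = b * h z * (j == None)%:R by rewrite /g2 dZ// dk mulrA.
have C0 : 0 <= `|a| + `|b| by rewrite addr_ge0.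
have bh z : `|b * h z| <= `|a| + `|b|.
  by rewrite normrM; apply: le_trans (ler_piMr _ (h1 z)) _ => //; rewrite lerDr.
have bk z : `|b * k z| <= `|a| + `|b|.
  by rewrite normrM; apply: le_trans (ler_piMr _ (k1 z)) _ => //; rewrite lerDr.
have fv := @field_gradientM R d (`|a| + `|b|) g1 g2 u du sg1 sg2 pg1 pg2 _ bk _ _ fu.
set v := (fun z => _ * u z) in fv; set dv := (fun j z => _ + _) in fv.
have {}fv : field_gradient v dv.
  apply: fv.
  - move=> z; apply: le_trans (ler_normD _ _) _; rewrite lerD2l normrM.
    exact: ler_piMr.
  - by move=> j z; rewrite dg1 mulNr normrN /g2; case: (j == None); rewrite ?mulr1 ?mulr0 ?normr0 ?bk.
  - by move=> j z; rewrite dg2; case: (j == None); rewrite ?mulr1 ?mulr0 ?normr0 ?bh.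
have sqg z : sq (g1 z +i* g2 z)%C = 1 + sg * (h z - m).
  have -> : 1 + sg * (h z - m) = a ^+ 2 + b ^+ 2 + 2 * a * b * h z by rewrite ab1 ab2; ring.
  have -> : b ^+ 2 = b ^+ 2 * (h z ^+ 2 + k z ^+ 2) by rewrite hk mulr1.
  by rewrite /sq /g1 /g2 /=; ring.
exists v, dv; split => //.
- by move=> z; rewrite /v sqM sqg.
- move=> i z; rewrite /dv dg1 dg2 !mulr0 -[(0 +i* 0)%C]/(0 : R[i]) mul0r addr0 sqM sqg //.
have ju := intg_sq (field_gradient_L2C fu).
have jdu := intg_sq (field_gradient_dL2C None fu).
have jdv := intg_sq (field_gradient_dL2C None fv).
rewrite /KinY /Mass -!RintZ// -RintD; [|exact: intgZ|exact: intgZ].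
apply: Rint_le => //; first by apply: intgD; exact: intgZ.
move=> z; apply: le_trans (sqD_le _ _ s0) _; rewrite !sqM sqg dg1 dg2.
have -> : sq (- g2 z * (None == None :> option 'I_d)%:R +i* (b * h z * (None == None :> option 'I_d)%:R))%C = b ^+ 2.
  by rewrite eqxx !mulr1 -[RHS]mulr1 -(hk z) /sq /g2 /=; ring.
have U0 := sq_ge0 (u z); have D0 := sq_ge0 (du None z).
have G2 : 1 + sg * (h z - m) <= 1 + 2 * sg.
  have := h1 z; move: m1; rewrite !ler_norml => /andP[? ?] /andP[? ?].
  by rewrite lerD2l mulrC ler_pM2r//; lra.
apply: lerD.
  rewrite mulrA ler_wpM2r//; apply: (@le_trans _ _ ((1 + sg) * (1 + 2 * sg))).
    by rewrite ler_pM2l//; lra.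
  by nra.
rewrite mulrA ler_wpM2r//; apply: (@le_trans _ _ ((1 + sg^-1) * sg ^+ 2)).
  by rewrite ler_wpM2l// addr_ge0// invr_ge0 ltW.
have -> : (1 + sg^-1) * sg ^+ 2 = sg ^+ 2 + sg by field; rewrite gt_eqF.
by nra.
Qed.

End modulation.

(** * Lower semicontinuity *)

Section lower_semicontinuity.
Context {R : realType} (d : nat) (d_gt0 : (0 < d)%N).
Local Notation V := ('rV[R]_d * R)%type.
Local Notation mu := (@leb_xy R d).
Local Notation q := (@crit_q R d).
Local Notation kap := (@crit_kappa R d).
Implicit Types (u v : V -> R[i]) (du dv : option 'I_d -> V -> R[i]).

Let q1 : 1 < q. Proof. exact: crit_q_gt1. Qed.
Let q0 : 0 < q. Proof. exact: lt_trans ltr01 q1. Qed.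

(** With t the scalar product of (m1, m2) and (cos y, sin y), the squared distance
    is at least (1 - t)^2, and t^2 <= 1 - e. *)
Lemma circle_distance_ge (e m1 m2 y : R) : 0 < e -> e <= 1 -> m1 ^+ 2 + m2 ^+ 2 <= 1 - e ->
  (e / 2) ^+ 2 <= (cos y - m1) ^+ 2 + (sin y - m2) ^+ 2.
Proof.
move=> e0 e1 me; have := cos2Dsin2 y; move: (cos y) (sin y) => C S CS.
pose t := m1 * C + m2 * S.
have t2 : t ^+ 2 <= m1 ^+ 2 + m2 ^+ 2.
  have -> : m1 ^+ 2 + m2 ^+ 2 = t ^+ 2 + (m1 * S - m2 * C) ^+ 2.
    rewrite -[LHS]mulr1 -CS /t; ring.
  by rewrite lerDl sqr_ge0.
have te : t <= 1 - e / 2.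
  rewrite leNgt; apply/negP => h; have : (1 - e / 2) ^+ 2 < t ^+ 2 by nra.
  have : 1 - e <= (1 - e / 2) ^+ 2 by nra.
  lra.
apply: (@le_trans _ _ ((1 - t) ^+ 2)); first by nra.
have -> : (C - m1) ^+ 2 + (S - m2) ^+ 2 = C ^+ 2 + S ^+ 2 - 2 * t + (m1 ^+ 2 + m2 ^+ 2).
  by rewrite /t; ring.
rewrite CS; nra.
Qed.

(** The perturbations of the kinetic energy cancel in the sum of the four virials,
    so one of them is at most the average. *)
Lemma four_sum (X N a b N1 N2 N3 N4 k g sg : R) : X = k * N -> 0 < k ->
  4 * N + 4 * g * N <= N1 + N2 + N3 + N4 ->
  [\/ X + sg * a - k * N1 <= - (k * g * N), X - sg * a - k * N2 <= - (k * g * N),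
      X + sg * b - k * N3 <= - (k * g * N) | X - sg * b - k * N4 <= - (k * g * N)].
Proof.
move=> XE k0 /(ler_wpM2l (ltW k0)) H.
have [h1|h1] := leP (X + sg * a - k * N1) (- (k * g * N)); first exact: Or41.
have [h2|h2] := leP (X - sg * a - k * N2) (- (k * g * N)); first exact: Or42.
have [h3|h3] := leP (X + sg * b - k * N3) (- (k * g * N)); first exact: Or43.
apply: Or44; rewrite leNgt; apply/negP => h4; move: H h1 h2 h3 h4.
rewrite XE !mulrDr (_ : k * (4 * N) = 4 * (k * N)); last by ring.
rewrite (_ : k * (4 * g * N) = 4 * (k * g * N)); last by ring.
lra.
Qed.

(** Modulating |u|^2 by 1 + sg (cos (y - t) - m), for the four angles t that are
    multiples of pi/2, preserves mass and, on average over t, longitudinal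
    kinetic energy, whereas strict convexity raises the average potential
    energy, by an amount proportional to the spread of |u|^2 around the circle. *)
Lemma virial_modulation (sg e : R) u du : field_gradient u du -> Pot_finite q u ->
  0 < Mass u -> KinX du = kap * Pot q u -> 0 < sg -> sg <= 1 / 4 -> 0 < e ->
  (forall m1 m2 : R, e * Mass u <=
    \int[mu]_z (((cos z.2 - m1) ^+ 2 + (sin z.2 - m2) ^+ 2) * sq (u z))) ->
  exists v dv, [/\ field_gradient v dv /\ Pot_finite q v, Mass v = Mass u,
    KinX dv - kap * Pot q v <= - (kap * ((q - 1) * sg ^+ 2 * e ^+ 2 / 32) * Pot q u),
    Pot q v <= 2 `^ q * Pot q u &
    KinY dv <= (1 + 4 * sg) * KinY du + 2 * sg * Mass u].
Proof.
move=> fu pu M0 Ku s0 s4 e0 He; have lu := field_gradient_L2C fu; have ju := intg_sq lu.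
have jX := intg_kinX fu; set S := (fun z => \sum_(i < d) sq (du (Some i) z)) in jX.
have mcos : measurable_fun setT (fun z : V => cos z.2).
  apply: measurableT_comp => //.
  by apply: continuous_measurable_fun => y; exact: continuous_cos.
have msin : measurable_fun setT (fun z : V => sin z.2).
  apply: measurableT_comp => //.
  by apply: continuous_measurable_fun => y; exact: continuous_sin.
have jc f : intg mu f -> intg mu (fun z => cos z.2 * f z).
  by move=> jf; apply: (intgM_bounded mcos (fun z => norm_cos_le1 z.2)).
have js f : intg mu f -> intg mu (fun z => sin z.2 * f z).
  by move=> jf; apply: (intgM_bounded msin (fun z => norm_sin_le1 z.2)).
pose m1 := (\int[mu]_z (cos z.2 * sq (u z))) / Mass u.
pose m2 := (\int[mu]_z (sin z.2 * sq (u z))) / Mass u.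
have Mn : Mass u != 0 by rewrite gt_eqF.
have cE : \int[mu]_z (cos z.2 * sq (u z)) = m1 * Mass u by rewrite divfK.
have sE : \int[mu]_z (sin z.2 * sq (u z)) = m2 * Mass u by rewrite divfK.
clearbody m1 m2.
(* Mass, and KinX through its density, are integrals against the modulation
   factor, which is affine in (p1, p2). *)
have lin p1 p2 f : intg mu f ->
    intg mu (fun z => (1 + sg * (tilt p1 p2 z.2 - (p1 * m1 + p2 * m2))) * f z) /\
    \int[mu]_z ((1 + sg * (tilt p1 p2 z.2 - (p1 * m1 + p2 * m2))) * f z) =
    \int[mu]_z f z +
      sg * (p1 * (\int[mu]_z (cos z.2 * f z) - m1 * \int[mu]_z f z) +
            p2 * (\int[mu]_z (sin z.2 * f z) - m2 * \int[mu]_z f z)).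
  move=> jf.
  have E z : (1 + sg * (tilt p1 p2 z.2 - (p1 * m1 + p2 * m2))) * f z =
      (1 - sg * (p1 * m1 + p2 * m2)) * f z + (sg * p1) * (cos z.2 * f z) +
      (sg * p2) * (sin z.2 * f z) by rewrite /tilt; ring.
  have j1 := intgZ (1 - sg * (p1 * m1 + p2 * m2)) jf.
  have j2 := intgZ (sg * p1) (jc _ jf); have j3 := intgZ (sg * p2) (js _ jf).
  split; first by under eq_fun do rewrite E; apply: intgD => //; exact: intgD.
  under eq_Rint => z do rewrite E.
  rewrite (RintD (intgD j1 j2) j3) (RintD j1 j2) (RintZ _ jf) (RintZ _ (jc _ jf)) (RintZ _ (js _ jf)).
  ring.
have me : m1 ^+ 2 + m2 ^+ 2 <= 1 - e.
  have := He m1 m2.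
  have E (z : V) : ((cos z.2 - m1) ^+ 2 + (sin z.2 - m2) ^+ 2) * sq (u z) =
      (1 + m1 ^+ 2 + m2 ^+ 2) * sq (u z) - (2 * m1) * (cos z.2 * sq (u z)) -
      (2 * m2) * (sin z.2 * sq (u z)).
    rewrite -[X in (X + m1 ^+ 2 + _)](cos2Dsin2 z.2); ring.
  under eq_Rint => z do rewrite E.
  rewrite RintB; [|by apply: intgB; apply: intgZ => //; exact: jc|by apply: intgZ; exact: js].
  rewrite RintB; [|exact: intgZ|by apply: intgZ; exact: jc].
  rewrite (RintZ _ ju) (RintZ _ (jc _ ju)) (RintZ _ (js _ ju)) cE sE -/(Mass u).
  have -> : (1 + m1 ^+ 2 + m2 ^+ 2) * Mass u - 2 * m1 * (m1 * Mass u) - 2 * m2 * (m2 * Mass u) =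
    (1 - (m1 ^+ 2 + m2 ^+ 2)) * Mass u by ring.
  by rewrite ler_pM2r//; lra.
have e1 : e <= 1 by have := sqr_ge0 m1; have := sqr_ge0 m2; lra.
have mp p1 p2 : p1 ^+ 2 + p2 ^+ 2 = 1 -> `|p1 * m1 + p2 * m2| <= 1.
  move=> p12; rewrite -(@expr_le1 _ 2)// real_normK ?num_real//.
  apply: (@le_trans _ _ ((p1 ^+ 2 + p2 ^+ 2) * (m1 ^+ 2 + m2 ^+ 2))).
    have := sqr_ge0 (p1 * m2 - p2 * m1); nra.
  rewrite p12; lra.
have z12 p1 p2 y : p1 ^+ 2 + p2 ^+ 2 = 1 ->
    `|sg * (tilt p1 p2 y - (p1 * m1 + p2 * m2))| <= 1.
  move=> p12; rewrite normrM (gtr0_norm s0).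
  have h2 : `|tilt p1 p2 y - (p1 * m1 + p2 * m2)| <= 2.
    apply: le_trans (ler_normB _ _) _.
    by have := tilt_norm_le1 y p12; have := mp _ _ p12; lra.
  apply: (@le_trans _ _ (1 / 4 * 2)); last by lra.
  by apply: ler_pM => //; exact: ltW.
pose Np p1 p2 := \int[mu]_z ((1 + sg * (tilt p1 p2 z.2 - (p1 * m1 + p2 * m2))) `^ q * sq (u z) `^ q).
have jN p1 p2 : p1 ^+ 2 + p2 ^+ 2 = 1 -> intg mu (fun z : V =>
    (1 + sg * (tilt p1 p2 z.2 - (p1 * m1 + p2 * m2))) `^ q * sq (u z) `^ q).
  move=> p12; apply: (@intgM_bounded _ _ _ _ (2 `^ q) _ (fun z : V =>
    (1 + sg * (tilt p1 p2 z.2 - (p1 * m1 + p2 * m2))) `^ q)) => //.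
    apply: (measurableT_comp (measurable_powR q)); apply: measurable_funD => //.
    apply: measurable_funM => //; apply: measurable_funB => //.
    by apply: measurable_funD; apply: measurable_funM.
  move=> z; rewrite ger0_norm ?powR_ge0//.
  have := z12 _ _ z.2 p12; rewrite ler_norml => /andP[h1 h2].
  by apply: ge0_ler_powR; rewrite ?nnegrE//; [exact: ltW|lra|lra].
have Nle p1 p2 : p1 ^+ 2 + p2 ^+ 2 = 1 -> Np p1 p2 <= 2 `^ q * Pot q u.
  move=> p12; rewrite -(RintZ _ pu); apply: Rint_le.
  - exact: jN.
  - exact: intgZ.
  - move=> z; rewrite ler_wpM2r ?powR_ge0//.
    have := z12 _ _ z.2 p12; rewrite ler_norml => /andP[h1 h2].
    by apply: ge0_ler_powR; rewrite ?nnegrE//; [exact: ltW|lra|lra].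
set a := \int[mu]_z (cos z.2 * S z) - m1 * KinX du.
set b := \int[mu]_z (sin z.2 * S z) - m2 * KinX du.
have cand p1 p2 : p1 ^+ 2 + p2 ^+ 2 = 1 -> exists v dv,
    [/\ field_gradient v dv /\ Pot_finite q v, Mass v = Mass u,
      KinX dv = KinX du + sg * (p1 * a + p2 * b), Pot q v = Np p1 p2 &
      KinY dv <= (1 + 4 * sg) * KinY du + 2 * sg * Mass u].
  move=> p12; have [v [dv [fv sv sdv Yv]]] := field_gradient_modulation fu s0 s4 p12 (mp _ _ p12).
  have svq z : sq (v z) `^ q = (1 + sg * (tilt p1 p2 z.2 - (p1 * m1 + p2 * m2))) `^ q * sq (u z) `^ q.
    rewrite sv powRM ?sq_ge0//.
    by have := z12 _ _ z.2 p12; rewrite ler_norml => /andP[h1 h2]; lra.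
  exists v, dv; split => //.
  - by split => //; rewrite /Pot_finite; under eq_fun do rewrite svq; exact: jN.
  - have [_ L] := lin p1 p2 _ ju; rewrite /Mass; under eq_Rint => z do rewrite sv.
    by rewrite L -/(Mass u) cE sE !subrr !mulr0 addr0 mulr0 addr0.
  - have [_ L] := lin p1 p2 _ jX; rewrite /KinX.
    by under eq_Rint => z do [under eq_bigr do rewrite sdv; rewrite -mulr_sumr]; rewrite L.
  - by apply: eq_Rint => z; rewrite svq.
pose D z := (cos z.2 - m1) ^+ 2 + (sin z.2 - m2) ^+ 2.
pose gam := (q - 1) * sg ^+ 2 * e ^+ 2 / 32.
have sum4 : 4 * Pot q u + 4 * gam * Pot q u <= Np 1 0 + Np (-1) 0 + Np 0 1 + Np 0 (-1).
  have o1 : (1 : R) ^+ 2 + 0 ^+ 2 = 1 by ring.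
  have o2 : (-1 : R) ^+ 2 + 0 ^+ 2 = 1 by ring.
  have o3 : (0 : R) ^+ 2 + 1 ^+ 2 = 1 by ring.
  have o4 : (0 : R) ^+ 2 + (-1) ^+ 2 = 1 by ring.
  rewrite /Np -(RintD (jN _ _ o1) (jN _ _ o2)) -(RintD (intgD (jN _ _ o1) (jN _ _ o2)) (jN _ _ o3)).
  rewrite -(RintD (intgD (intgD (jN _ _ o1) (jN _ _ o2)) (jN _ _ o3)) (jN _ _ o4)).
  rewrite -mulrDl -(RintZ _ pu); apply: Rint_le.
  - exact: intgZ.
  - exact: (intgD (intgD (intgD (jN _ _ o1) (jN _ _ o2)) (jN _ _ o3)) (jN _ _ o4)).
  move=> z; rewrite -!mulrDl ler_wpM2r ?powR_ge0//.
  have h1 := powR_strict_convex (ltW q1) (z12 _ _ z.2 o1).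
  have h3 := powR_strict_convex (ltW q1) (z12 _ _ z.2 o3).
  have := circle_distance_ge z.2 e0 e1 me.
  move: h1 h3; rewrite /tilt.
  have -> : 1 + sg * (-1 * cos z.2 + 0 * sin z.2 - (-1 * m1 + 0 * m2)) =
    1 - sg * (1 * cos z.2 + 0 * sin z.2 - (1 * m1 + 0 * m2)) by ring.
  have -> : 1 + sg * (0 * cos z.2 + -1 * sin z.2 - (0 * m1 + -1 * m2)) =
    1 - sg * (0 * cos z.2 + 1 * sin z.2 - (0 * m1 + 1 * m2)) by ring.
  move: (_ `^ q) (_ `^ q) (_ `^ q) (_ `^ q) => A1 A2 A3 A4 h1 h3 hD.
  have w0 : 0 <= (q - 1) / 2 * sg ^+ 2.
    by rewrite mulr_ge0 ?sqr_ge0// divr_ge0// subr_ge0 ltW.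
  have := ler_wpM2l w0 hD; rewrite /gam; move: h1 h3; clear; lra.
have [p1 [p2 [p12 hp]]] : exists p1 p2, p1 ^+ 2 + p2 ^+ 2 = 1 /\
    KinX du + sg * (p1 * a + p2 * b) - kap * Np p1 p2 <= - (kap * gam * Pot q u).
  have k0 : 0 < kap by exact: crit_kappa_gt0.
  have [h|h|h|h] := four_sum a b sg Ku k0 sum4.
  - exists 1, 0; split; first by ring.
    by rewrite (_ : 1 * a + 0 * b = a)//; ring.
  - exists (-1), 0; split; first by ring.
    by rewrite (_ : sg * (-1 * a + 0 * b) = - (sg * a))//; ring.
  - exists 0, 1; split; first by ring.
    by rewrite (_ : 0 * a + 1 * b = b)//; ring.
  - exists 0, (-1); split; first by ring.
    by rewrite (_ : sg * (0 * a + -1 * b) = - (sg * b))//; ring.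
have [v [dv [fpv Mv Xv Nv Yv]]] := cand _ _ p12.
by exists v, dv; split => //; [rewrite Xv Nv|rewrite Nv; exact: Nle].
Qed.

(** From expR x >= 1 + x and ln t >= 1 - 1/t. *)
Lemma powR_deficit (t r : R) : 0 < t -> 0 <= r -> 1 - t `^ r <= r * (t^-1 - 1).
Proof.
move=> t0 r0; have lnt : 1 - t^-1 <= ln t.
  have : ln t^-1 <= t^-1 - 1.
    have := @le_ln1Dx R (t^-1 - 1); rewrite addrCA subrr addr0; apply.
    have : 0 < t^-1 by rewrite invr_gt0.
    lra.
  by rewrite lnV ?posrE//; lra.
rewrite /powR gt_eqF//; have := expR_ge1Dx (r * ln t).
have := ler_wpM2l r0 lnt; rewrite mulrBr mulrBr mulr1; lra.
Qed.

Lemma kinY_budget (sg K c c' r1 r2 : R) : 0 < sg -> 0 < c -> K < 2 * r1 -> c' <= 2 * c ->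
  sg * (4 * (r1 + c)) <= r2 - r1 -> (1 + 4 * sg) * K + 2 * sg * c' <= r2 * 2.
Proof.
move=> s0 c0 /ltW K1 c1 H; have := ler_wpM2l (ltW s0) K1; have := ler_wpM2l (ltW s0) c1.
have : 0 <= sg * c by rewrite mulr_ge0 ?ltW.
lra.
Qed.

(** Take a competitor of mass c' slightly above c. Modulation makes its virial
    negative by a fixed fraction of its potential energy, which pays for scaling
    the mass down to c; the transverse kinetic energy hardly changes. *)
Lemma m_c_right_lsc (c r1 r2 : R) : 0 < c -> r1 < r2 ->
  exists2 de : R, 0 < de & forall c', c < c' -> c' < c + de ->
    (m_c d (4 / d%:R) c' < r1%:E)%E -> (m_c d (4 / d%:R) c <= r2%:E)%E.
Proof.
move=> c0 r12; have [r10|r10] := leP r1 0.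
  exists 1 => // c' cc' _ /(m_c_lt d_gt0)[u [du [_ _ _ _ Y]]].
  have Y0 : 0 <= KinY du by apply: Rint_ge0 => z; exact: sq_ge0.
  by exfalso; lra.
have B0 : 0 <= 2 * r1 by lra.
have [e e0 He] := nonconcentration d c0 B0.
(* This keeps the transverse kinetic energy of the modulated field, whose mass is
   at most 2 c, below 2 r2. *)
pose sg := Num.min (1 / 4) ((r2 - r1) / (4 * (r1 + c))).
have den0 : 0 < 4 * (r1 + c) by lra.
have s0 : 0 < sg by rewrite lt_min divr_gt0//= divr_gt0//; lra.
have s4 : sg <= 1 / 4 by rewrite ge_min lexx.
have sr : sg * (4 * (r1 + c)) <= r2 - r1 by rewrite -ler_pdivlMr// ge_min lexx orbT.
pose gam := (q - 1) * sg ^+ 2 * e ^+ 2 / 32.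
have g0 : 0 < gam by rewrite divr_gt0// !mulr_gt0 ?exprn_gt0// subr_gt0.
have q10 : 0 < q - 1 by rewrite subr_gt0.
have tq0 : 0 < 2 `^ q :> R by rewrite powR_gt0.
have k0 : 0 < kap by exact: crit_kappa_gt0.
exists (Num.min c (c * gam / ((q - 1) * 2 `^ q))) => [|c' cc'].
  by rewrite lt_min c0 divr_gt0// mulr_gt0.
rewrite -ltrBlDl lt_min => /andP[c'1 c'2] /(m_c_lt d_gt0)[u [du [fu pu Mu Ku Yu]]].
have c'0 : 0 < c' by lra.
have c'2c : c' <= 2 * c by lra.
have M0 : 0 < Mass u by rewrite Mu.
have Hu m1 m2 := He u du m1 m2 fu (ltac:(rewrite Mu; exact: ltW)) (ltW Yu).
have [v [dv [[fv pv] Mv Xv Nv Yv]]] := virial_modulation fu pu M0 Ku s0 s4 e0 Hu.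
have lv := field_gradient_L2C fv.
pose t := c / c'; have t0 : 0 < t by rewrite divr_gt0.
have t1 : t <= 1 by rewrite ler_pdivrMr// mul1r ltW.
pose s : R[i] := (Num.sqrt t +i* 0)%C.
have sqs : sq s = t by rewrite sqC sqr_sqrtr// ltW.
have N0 : 0 <= Pot q u by apply: Rint_ge0 => z; exact: powR_ge0.
have Nv0 : 0 <= Pot q v by apply: Rint_ge0 => z; exact: powR_ge0.
have Yv0 : 0 <= KinY dv by apply: Rint_ge0 => z; exact: sq_ge0.
have Ms : Mass (fun z => s * v z) = c by rewrite (MassZ _ lv) sqs Mv Mu /t divfK// gt_eqF.
have Ks : KinX (fun j z => s * dv j z) <= kap * Pot q (fun z => s * v z).
  rewrite (KinXZ _ fv) (PotZ _ pv) sqs.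
  have -> : t `^ q = t * t `^ (q - 1) by rewrite mulr_powRB1 ?ltW.
  rewrite (_ : kap * (t * t `^ (q - 1) * Pot q v) = t * (kap * t `^ (q - 1) * Pot q v)); last by ring.
  rewrite (ler_pM2l t0).
  have dfc := powR_deficit t0 (ltW q10).
  have tq : (1 - t `^ (q - 1)) * 2 `^ q <= gam.
    apply: le_trans (ler_wpM2r (ltW tq0) dfc) _.
    rewrite invf_div (_ : c' / c - 1 = (c' - c) / c); last by rewrite mulrBl divff// gt_eqF.
    rewrite mulrAC mulrA ler_pdivrMr// [leRHS]mulrC mulrC.
    move: c'2; rewrite ltr_pdivlMr ?mulr_gt0// => /ltW H; by rewrite [leLHS]mulrC [leRHS]mulrC.
  have t10 : 0 <= 1 - t `^ (q - 1).
    have : t `^ (q - 1) <= 1 `^ (q - 1).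
      by apply: ge0_ler_powR; rewrite ?nnegrE ?(ltW q10) ?(ltW t0).
    by rewrite powR1 subr_ge0.
  have := ler_wpM2l t10 Nv; rewrite mulrA => h1.
  have := le_trans h1 (ler_wpM2r N0 tq) => h2.
  have := ler_wpM2l (ltW k0) h2; move: Xv.
  rewrite -/gam; move: (Pot q u) (Pot q v) (t `^ (q - 1)) (KinX dv) kap => Nu N' T X k'.
  by clear; lra.
have fs := field_gradientZ s fv; have ps := Pot_finiteZ s pv.
apply: le_trans (m_c_le_virial d_gt0 c0 fs ps Ms Ks) _.
rewrite lee_fin (KinYZ _ fv) sqs ler_pdivrMr//.
apply: (@le_trans _ _ (KinY dv)); first by rewrite ler_piMl.
apply: le_trans Yv _; rewrite Mu.
exact: (kinY_budget s0 c0 Yu c'2c sr).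
Qed.

End lower_semicontinuity.

Theorem proposition1p12 (R : realType) (d : nat) (Q : 'rV[R]_d -> R)
    (d_gt0 : (0 < d)%N) (Q_ground_state : ground_state Q) :
  let alpha : R := 4 / d%:R in
  let J : set R :=
    [set c : R | 0 < c /\ (c%:E < (2 * pi)%:E * Mhat Q)%E] in
  (forall a b : R, J a -> J b -> b < a -> (m_c d alpha a <= m_c d alpha b)%E) /\
  @lower_semicontinuous (subspace J) R (m_c d alpha).
Proof.
move=> alpha J; split; first by move=> a b _ [b0 _]; exact: m_c_nonincreasing.
move=> c r rc; have [Jc|Jc] := pselect (J c); last first.
  (* Points outside J are isolated in the subspace topology. *)
  exists [set c]; last by move=> _ ->.
  by case: (@nbhs_subspaceP _ J c) => // _ c' ->.
have [c0 _] := Jc.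
have [r2 /andP[rr2 r2c]] := ereal_between rc.
have [r1 /andP[rr1 r1r2]] := ereal_between rr2.
rewrite lte_fin in r1r2.
have [de de0 Hde] := m_c_right_lsc d_gt0 c0 r1r2.
exists [set c' | J c' /\ c' < c + de].
  case: (@nbhs_subspaceP _ J c) => // _; rewrite /within /=.
  near=> c' => Jc'; split => //.
  by near: c'; apply: lt_nbhsl; rewrite ltrDl.
(* Below c monotonicity suffices, so the neighbourhood is only restricted above c. *)
move=> c' [[c'0 _] c'd]; have [c'c|cc'|->//] := ltgtP c' c.
  apply: (lt_le_trans rc); exact: m_c_nonincreasing.
rewrite ltNge; apply/negP => c'r.
have := Hde c' cc' c'd (le_lt_trans c'r rr1).
by rewrite leNgt r2c.
Unshelve. all: by end_near. Qed.
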